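(* Assume that $B$ is of type 2 with constant $a$ and that (H-K) holds: the function $\lambda\mapsto\Lambda_F(\lambda)-\inf_{y\in K}\langle\lambda,y\rangle$ on $B'$ achieves its minimum at (at least) one point $\lambda^*\in B'$. Let $\alpha^*$ be the $I$-projection of $\alpha$ on $C=\{\nu\in M_1(E):\int F\,d\nu\in K\}$ (which exists under these hypotheses). Let $(\varepsilon_n)$ be a sequence going to $0$ with $$\varepsilon_n>\frac{c}{\sqrt n},\qquad c=\sqrt{a\,\mathrm{Var}_{\alpha^*}(F)},$$ and $C_n=\{\nu\in M_1(E):\int F\,d\nu\in K^{\varepsilon_n}\}$. Then, for every integer $k\ge1$, $\alpha^n_{C_n,k}$ converges to $(\alpha^* )^{\otimes k}$ in total variation distance as $n\to\infty$.
   Context: $E$ is a Polish space, $M_1(E)$ the set of Borel probability measures on $E$, $\alpha\in M_1(E)$. For $x\in E^n$, $L_n=L_n^x=\frac1n\sum_{i=1}^n\delta_{x_i}$; for $A\subseteq M_1(E)$ with $\alpha^{\otimes n}(L_n\in A)>0$ and $k\le n$, $\alpha^n_{A,k}(D)=\alpha^{\otimes n}((x_1,\dots,x_k)\in D\mid L_n^x\in A)$. $(B,\|\cdot\|)$ is a separable Banach space with dual $B'$, $F:E\to B$ is measurable (for the cylindrical $\sigma$-field), $K\subseteq B$ is a (nonempty) closed convex set, $\int F\,d\nu$ is a Bochner integral (the condition $\int F\,d\nu\in K$ includes $\int\|F\|d\nu<+\infty$), and $K^{\varepsilon}=\{x\in B:d(x,K)\le\varepsilon\}$. $Z_F(\lambda)=\int_E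 e^{\langle\lambda,F(x)\rangle}\alpha(dx)$ and $\Lambda_F=\log Z_F$ for $\lambda\in B'$. Standing assumptions: $\int e^{s\|F\|}d\alpha<+\infty$ for some $s>0$; and $\mathrm{dom}\,\Lambda_F=\{\lambda\in B':\Lambda_F(\lambda)<+\infty\}$ is a nonempty open subset of $B'$. $B$ is of type 2 (with constant $a>0$) if for every sequence $(Z_i)$ of square-integrable i.i.d. $B$-valued random variables with zero mean and variance equal to $1$, $\mathbb E\|\sum_{i=1}^nZ_i\|^2\le a\sum_{i=1}^n\mathbb E\|Z_i\|^2$. $\mathrm{Var}_{\alpha^*}(F)=\int\|F-\int F\,d\alpha^*\|^2d\alpha^*$. $H(\beta\mid\gamma)=\int\log\frac{d\beta}{d\gamma}\,d\beta$ if $\beta\ll\gamma$ and this is finite, $+\infty$ otherwise; the $I$-projection of $\alpha$ on a convex set $C$ is the unique $\alpha^*\in C$ with $H(\alpha^*\mid\alpha)=\inf_{\nu\in C}H(\nu\mid\alpha)<+\infty$, if it exists. *)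

(* Defs.v *)
From HB Require Import structures.
From mathcomp Require Import all_boot all_order all_algebra finmap.
From mathcomp Require Import all_classical all_reals all_analysis.

Set Implicit Arguments.
Unset Strict Implicit.
Unset Printing Implicit Defensive.

Import Order.TTheory GRing.Theory Num.Theory.
Import numFieldNormedType.Exports.

Local Open Scope classical_set_scope.
Local Open Scope ring_scope.

Definition separable (T : topologicalType) : Prop :=
  exists2 D : set T, countable D & dense D.

(* Homeomorphic to a complete metric space. *)
Definition completely_metrizable (R : realType) (T : topologicalType) : Prop :=
  exists (M : metricType R) (f : T -> M) (g : M -> T),
    [/\ cancel f g, cancel g f, continuous f, continuous g &
        forall G : set_system M, ProperFilter G -> cauchy G -> exists x : M, G --> x].

Definition polish (R : realType) (T : topologicalType) : Prop :=
  separable T /\ completely_metrizable R T.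

Notation borel E := (g_sigma_algebraType (@open E)).

Section Dual.
Context {R : realType} {B : normedModType R}.

Definition dual : set {linear B -> R^o} := [set l | continuous (l : B -> R^o)].

Definition dual_norm (f : B -> R) : R :=
  sup [set `|f x| | x in [set x : B | `|x| <= 1]].

(* Openness in [dual], for the topology of [dual_norm]. *)
Definition dual_open (U : set {linear B -> R^o}) : Prop :=
  forall l, U l -> exists2 e : R, 0 < e &
    forall m, dual m -> dual_norm (fun x => m x - l x) < e -> U m.

Definition cylinders : set (set B) :=
  [set A | exists (l : {linear B -> R^o}) (U : set R),
     [/\ dual l, measurable U & A = l @^-1` U]].

(* The closed [e]-neighbourhood of [K]. *)
Definition fattening (K : set B) (e : R) : set B :=
  [set x | (edist_inf K x <= e%:E)%E].

End Dual.

Notation cylindrical B := (g_sigma_algebraType (@cylinders _ B)).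

Section Bochner.
Context {R : realType} {B : normedModType R} {d : measure_display}
  {T : measurableType d}.

(* The list [s] of pairs (A, v) encodes the simple function [\sum 1_A v]. *)
Definition simple_val (s : seq (set T * B)) (x : T) : B :=
  \sum_(p <- s) (\1_(p.1) x : R) *: p.2.

Definition simple_integral (nu : probability T R) (s : seq (set T * B)) : B :=
  \sum_(p <- s) fine (nu p.1) *: p.2.

Definition is_bochner_integral (nu : probability T R) (F : T -> B) (y : B) :=
  exists s : nat -> seq (set T * B),
    [/\ forall n, {in s n, forall p, measurable p.1},
        (fun n => \int[nu]_x (`|F x - simple_val (s n) x|)%:E)%E
          @ \oo --> 0%E &
        (fun n => simple_integral nu (s n)) @ \oo --> y].

Definition bochner_integrable (nu : probability T R) (F : T -> B) : Prop :=
  measurable_fun setT (F : T -> cylindrical B) /\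
  (\int[nu]_x (`|F x|)%:E < +oo)%E.

(* Meaningful for [bochner_integrable] functions with values in a separable
   Banach space. *)
Definition bochner_integral (nu : probability T R) (F : T -> B) : B :=
  xget 0 (is_bochner_integral nu F).

Definition bochner_variance (nu : probability T R) (F : T -> B) : \bar R :=
  (\int[nu]_x (`|F x - bochner_integral nu F| ^+ 2)%:E)%E.

Definition mean_in (F : T -> B) (K : set B) : set (probability T R) :=
  [set nu | bochner_integrable nu F /\ K (bochner_integral nu F)].

Definition Zlaplace (alpha : probability T R) (F : T -> B)
    (l : {linear B -> R^o}) : \bar R :=
  (\int[alpha]_x (expR (l (F x)))%:E)%E.

Definition Lambda (alpha : probability T R) (F : T -> B)
    (l : {linear B -> R^o}) : \bar R :=
  lne (Zlaplace alpha F l).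

Definition dom_Lambda (alpha : probability T R) (F : T -> B) :
    set {linear B -> R^o} :=
  [set l | dual l /\ (Lambda alpha F l < +oo)%E].

Definition HK_objective (alpha : probability T R) (F : T -> B) (K : set B)
    (l : {linear B -> R^o}) : \bar R :=
  (Lambda alpha F l - ereal_inf [set (l y : R)%:E | y in K])%E.

Definition hypothesis_HK (alpha : probability T R) (F : T -> B) (K : set B) :=
  exists2 ls : {linear B -> R^o}, dual ls &
    forall l, dual l -> (HK_objective alpha F K ls <= HK_objective alpha F K l)%E.

End Bochner.

Definition iid (R : realType) d (T : measurableType d) d'
    (T' : measurableType d') (P : probability T R) (Z : nat -> T -> T') : Prop :=
  [/\ forall i, measurable_fun setT (Z i),
      forall (i j : nat) (A : set T'), measurable A ->
        P (Z i @^-1` A) = P (Z j @^-1` A) &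
      forall (J : {fset nat}) (A : nat -> set T'),
        (forall i, measurable (A i)) ->
        fine (P (\bigcap_(i in [set` J]) (Z i @^-1` A i))) =
        \prod_(i <- J) fine (P (Z i @^-1` A i))].

Definition type2 (R : realType) (B : normedModType R) (a : R) : Prop :=
  0 < a /\
  forall (d : measure_display) (T : measurableType d) (P : probability T R)
         (Z : nat -> T -> B),
    iid P (Z : nat -> T -> cylindrical B) ->
    (forall i, \int[P]_w (`|Z i w| ^+ 2)%:E < +oo)%E ->
    (forall i, bochner_integral P (Z i) = 0) ->
    (forall i, bochner_variance P (Z i) = 1%E) ->
    forall n : nat,
      (\int[P]_w (`|\sum_(i < n) Z i w| ^+ 2)%:E <=
       a%:E * \sum_(i < n) \int[P]_w (`|Z i w| ^+ 2)%:E)%E.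

Section Entropy.
Context {R : realType} {d : measure_display} {T : measurableType d}.
Local Open Scope charge_scope.

(* The negative part of [log (d beta / d gamma)] always is beta-integrable, so
   that the integral below is well defined, possibly equal to +oo. *)
Definition relative_entropy (beta gamma : probability T R) : \bar R :=
  let I := (\int[beta]_x
    lne (('d (charge_of_finite_measure beta) '/d gamma) x))%E in
  if `[< beta `<< gamma /\ I \is a fin_num >] then I else +oo%E.

(* Uniqueness is up to equality on measurable sets: the values of a
   [probability] on the other sets are irrelevant. *)
Definition is_I_projection (alpha : probability T R)
    (C : set (probability T R)) (astar : probability T R) : Prop :=
  let inf_C := ereal_inf [set relative_entropy nu alpha | nu in C] in
  [/\ C astar, relative_entropy astar alpha = inf_C, (inf_C < +oo)%E &
      forall nu, C nu -> relative_entropy nu alpha = inf_C ->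
        forall A, measurable A -> nu A = astar A].

End Entropy.

Section ProductMeasure.
Context {R : realType} {d : measure_display} {T : measurableType d}.

Definition tcons (n : nat) (p : T * n.-tuple T) : n.+1.-tuple T :=
  [tuple of p.1 :: p.2].

Lemma measurable_tcons (n : nat) : measurable_fun setT (@tcons n).
Proof. exact: measurable_cons. Qed.

HB.instance Definition _ (n : nat) :=
  isMeasurableFun.Build _ _ _ _ (@tcons n) (@measurable_tcons n).

(* The [n]-fold product measure, as the image of [alpha \x alpha^(n-1)] by
   [tcons]. *)
Fixpoint power (alpha : probability T R) (n : nat) :
    probability (n.-tuple T) R :=
  match n with
  | 0 => dirac [tuple]
  | m.+1 => distribution (alpha \x power alpha m)%E (@tcons m)
  end.

Definition empirical (n : nat) (x : n.+1.-tuple T) : set T -> \bar R :=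
  mscale (n.+1%:R^-1)%:nng (msum (fun i => \d_(nth point x i)) n.+1).

HB.instance Definition _ n (x : n.+1.-tuple T) := Measure.on (empirical x).

Lemma empirical_setT (n : nat) (x : n.+1.-tuple T) :
  empirical x setT = 1%E.
Proof.
rewrite /empirical /mscale /= /msum.
rewrite (eq_bigr (fun=> 1%E)); last by move=> i _; exact: diracT.
by rewrite sumEFin -EFinM sumr_const card_ord mulVf.
Qed.

HB.instance Definition _ n (x : n.+1.-tuple T) :=
  Measure_isProbability.Build _ _ _ (empirical x) (empirical_setT x).

Definition empirical_in (n : nat) (A : set (probability T R)) :
    set (n.+1.-tuple T) :=
  [set x | A (empirical x)].

Definition first_in (n k : nat) (D : set (k.-tuple T)) : set (n.-tuple T) :=
  [set x | exists2 y : k.-tuple T, D y & take k x = y :> seq T].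

(* Law of the first [k] points of an [n.+1]-sample given that its empirical
   measure is in [A]: meaningful for [k <= n.+1] and when the conditioning event
   has positive probability. *)
Definition conditional_law (alpha : probability T R)
    (A : set (probability T R)) (n k : nat) (D : set (k.-tuple T)) : R :=
  fine (power alpha n.+1 (first_in D `&` @empirical_in n A)) /
  fine (power alpha n.+1 (@empirical_in n A)).

End ProductMeasure.

Arguments empirical_in {R d T} n A x.
Arguments conditional_law {R d T} alpha A n k D.

Definition tv_dist (R : realType) d (T : measurableType d)
    (p q : set T -> R) : R :=
  sup [set `|p D - q D| | D in [set D : set T | measurable D]].

(* Main.v *)
From HB Require Import structures.
Require Import Defs.
From mathcomp Require Import all_boot all_order all_algebra finmap perm.
From mathcomp Require Import all_classical all_reals all_analysis.
From mathcomp Require Import measurable_realfun.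
From mathcomp Require Import ring lra zify.
Import Order.TTheory GRing.Theory Num.Theory.
Import numFieldNormedType.Exports.
Local Open Scope classical_set_scope.
Local Open Scope ring_scope.
Set Implicit Arguments.
Unset Strict Implicit.
Unset Printing Implicit Defensive.

(** The minimiser [ls] of the dual problem determines the I-projection: it is the
    exponential tilt [astar] of [alpha], with density [exp (ls F) / z]. The first
    order condition satisfied by [ls] says that the mean [m] of [F] under [astar]
    lies in [K], and that [ls] attains its minimum over [K] at [m]
    ([exponential_projection]); a functional separating [m] from [K] would indeed
    be a direction of descent. Gibbs' inequality then gives minimality and
    uniqueness ([tilt_is_I_projection]).

    Let [N] be the sample size, [A] the event that the sample mean of [F] is
    within [e] of [K], and compare the [N]-fold products [P] of [alpha] and [P*]
    of [astar]. The density of [P*] with respect to [P] is a function of the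
    sample mean only, [exp (N (ls mean - ln z))]. As [ls] is minimal over [K] at
    [m], this density is at least [exp (N (ls m - M e - ln z))] on [A]; and it is
    at most [exp (N (ls m + M e - ln z))] where the mean is within [e] of [m]. If
    the latter event, which is contained in [A], has probability [q] under [P*],
    then the law [P] conditioned on [A] is at most [exp (2 N M e) / q] times [P*]
    ([conditional_density_le]).

    The cost [2 N M e - ln q] is [o(N)]. Type 2 bounds the mean square of the
    centered sum by [a N Var], so Markov's inequality makes [q] positive as soon
    as [e > sqrt (a Var / N)]. For the ball of radius [sqrt (a N Var)] itself the
    inequality is too weak, and [small_ball] proves [q >= exp (- C sqrt N)]:
    if the centered sum almost never is in that ball, its square norm exceeds
    [a N Var] by little in the mean; a perturbation of [astar] by a density
    [1 + O(N ^ - 1/2)], which multiplies probabilities by [exp (O (sqrt N))] at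
    most, moves the mean of the sum by the order of [sqrt N], too far for this.

    Finally, an exchangeable law whose density with respect to a product is
    [exp (o(N))] has asymptotically independent marginals: by exchangeability all
    the blocks of [k] consecutive points have the same law, and their empirical
    frequencies concentrate exponentially fast under the product law
    ([conditioned_block_le]). The bound is uniform over events, so it is a bound
    in total variation.

    Three tools are built on the way: the Hahn-Banach theorem, the reduction of
    Bochner integrals to continuous functionals, and infinite product measures,
    since the type 2 inequality speaks of infinite sequences of variables. *)

(** * Hahn-Banach separation *)

Section Sublinear.
Context {R : realType} {V : lmodType R}.
Implicit Types p q : V -> R.

Definition sublinear p :=
  (forall x y, p (x + y) <= p x + p y) /\
  (forall (t : R) x, 0 < t -> p (t *: x) <= t * p x).

Lemma sublinear0 p : sublinear p -> p 0 = 0.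
Proof.
move=> [pD pZ]; apply/eqP; rewrite eq_le; apply/andP; split.
  have := pZ 2^-1 0; rewrite scaler0 => /(_ ltac:(lra)); lra.
by have := pD 0 0; rewrite addr0; lra.
Qed.

Lemma sublinear_ge p x : sublinear p -> - p (- x) <= p x.
Proof. by move=> sp; have := sp.1 x (- x); rewrite subrr sublinear0//; lra. Qed.

Lemma sublinearZ p t x : sublinear p -> 0 <= t -> p (t *: x) = t * p x.
Proof.
move=> sp; rewrite le_eqVlt => /predU1P[<-|t0].
  by rewrite scale0r mul0r sublinear0.
apply/eqP; rewrite eq_le sp.2//=.
have := sp.2 t^-1 (t *: x); rewrite scalerA mulVf ?gt_eqF// scale1r invr_gt0.
by move=> /(_ t0); rewrite ler_pdivlMl.
Qed.

Section Translate.
Variables (p : V -> R) (G : V -> R -> Prop).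
Hypothesis sp : sublinear p.
Hypothesis G0 : G 0 0.
Hypothesis GD : forall w c w' c', G w c -> G w' c' -> G (w + w') (c + c').
Hypothesis GZ : forall t w c, 0 < t -> G w c -> G (t *: w) (t * c).
Hypothesis Gp : forall w c, G w c -> c <= p w.

Let S x : set R := [set r | exists w c, G w c /\ r = p (x + w) - c].

Definition lower_translate x : R := inf (S x).

Let lbS x : has_inf (S x).
Proof.
split; first by exists (p (x + 0) - 0); exists 0, 0.
exists (- p (- x)) => _ [w [c [Gwc ->]]].
have := sp.1 (x + w) (- x); rewrite (addrC x) addrK => h.
by have := Gp Gwc; lra.
Qed.

Lemma lower_translate_le x w c : G w c -> lower_translate x <= p (x + w) - c.
Proof. by move=> Gwc; apply: ge_inf; [exact: (lbS x).2|exists w, c]. Qed.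

(** Minorising [p] along a convex cone of prescribed pairs (vector, value):
    both the extension step of the Hahn-Banach theorem and the functional
    separating a point from a convex set are of this form. *)
Lemma lower_translate_sublinear : sublinear lower_translate.
Proof.
split=> [x y|t x t0].
- rewrite -lerBlDr; apply: lb_le_inf; first exact: (lbS x).1.
  move=> _ [w [c [Gwc ->]]]; rewrite lerBlDl -lerBlDr.
  apply: lb_le_inf; first exact: (lbS y).1.
  move=> _ [w' [c' [Gwc' ->]]].
  have := lower_translate_le (x + y) (GD Gwc Gwc').
  rewrite [x + y + _](_ : _ = (x + w) + (y + w')); last by rewrite addrACA.
  have := sp.1 (x + w) (y + w'); lra.
- rewrite -ler_pdivrMl//; apply: lb_le_inf; first exact: (lbS x).1.
  move=> _ [w [c [Gwc ->]]]; rewrite ler_pdivrMl//.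
  have := lower_translate_le (t *: x) (GZ t0 Gwc).
  rewrite -scalerDr; have := sp.2 t (x + w) t0; lra.
Qed.

End Translate.

(** A sublinear functional that is minimal for the pointwise order is linear:
    [x |-> inf_(t >= 0) q (x + t y) - t q y] is sublinear and below [q], so it
    equals [q], which makes [q] superadditive. *)
Lemma minimal_sublinear_additive q : sublinear q ->
  (forall q', sublinear q' -> (forall x, q' x <= q x) -> q' = q) ->
  forall x y, q (x + y) = q x + q y.
Proof.
move=> sq qmin x y; apply/eqP; rewrite eq_le sq.1/=.
pose G (w : V) (c : R) := exists2 t : R, 0 <= t & w = t *: y /\ c = t * q y.
have G0 : G 0 0 by exists 0 => //; rewrite scale0r mul0r.
have GD w c w' c' : G w c -> G w' c' -> G (w + w') (c + c').
  move=> [t t0 [-> ->]] [t' t'0 [-> ->]]; exists (t + t'); first exact: addr_ge0.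
  by rewrite scalerDl mulrDl.
have GZ t w c : 0 < t -> G w c -> G (t *: w) (t * c).
  move=> t0 [s s0 [-> ->]]; exists (t * s); first by rewrite mulr_ge0// ltW.
  by rewrite scalerA mulrA.
have Gq w c : G w c -> c <= q w.
  by move=> [s s0 [-> ->]]; rewrite sublinearZ.
have qE : lower_translate q G = q.
  apply: qmin; first exact: lower_translate_sublinear.
  by move=> z; have := lower_translate_le sq G0 Gq z G0; rewrite addr0 subr0.
have := lower_translate_le sq G0 Gq x (w := y) (c := q y).
by rewrite qE lerBrDr; apply; exists 1 => //; rewrite scale1r mul1r.
Qed.

Lemma sublinear_chain_inf p (A : set (V -> R)) : A !=set0 ->
  (forall q, A q -> sublinear q /\ forall x, q x <= p x) ->
  (forall q q', A q -> A q' -> (forall x, q x <= q' x) \/ (forall x, q' x <= q x)) ->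
  exists2 q, sublinear q & forall q', A q' -> forall x, q x <= q' x.
Proof.
move=> [q0 Aq0] Ap Atot.
have lbA x : has_inf [set q x | q in A].
  split; first by exists (q0 x); exists q0.
  exists (- p (- x)) => _ [q Aq <-].
  by have [sq qp] := Ap _ Aq; have := sublinear_ge x sq; have := qp (- x); lra.
exists (fun x => inf [set q x | q in A]); last first.
  by move=> q' Aq' x; apply: ge_inf; [exact: (lbA x).2|exists q'].
have le_q q x : A q -> inf [set q x | q in A] <= q x.
  by move=> Aq; apply: ge_inf; [exact: (lbA x).2|exists q].
split=> [x y|t x t0].
- rewrite -lerBlDr; apply: lb_le_inf; first exact: (lbA x).1.
  move=> _ [q1 Aq1 <-]; rewrite lerBlDl -lerBlDr.
  apply: lb_le_inf; first exact: (lbA y).1.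
  move=> _ [q2 Aq2 <-].
  have [q12|q21] := Atot _ _ Aq1 Aq2.
    have := (Ap _ Aq1).1.1 x y; have := q12 y; have := le_q _ (x + y) Aq1; lra.
  have := (Ap _ Aq2).1.1 x y; have := q21 x; have := le_q _ (x + y) Aq2; lra.
- rewrite -ler_pdivrMl//; apply: lb_le_inf; first exact: (lbA x).1.
  move=> _ [q Aq <-]; rewrite ler_pdivrMl//.
  by have := (Ap _ Aq).1.2 _ x t0; have := le_q _ (t *: x) Aq; lra.
Qed.

(** Zorn's lemma provides a minimal sublinear functional below [p]; it is
    additive, and additivity extends positive homogeneity to all scalars. *)
Lemma hahn_banach p : sublinear p ->
  exists l : {linear V -> R^o}, forall x, l x <= p x.
Proof.
move=> sp.
pose T := {q : V -> R | sublinear q /\ forall x, q x <= p x}.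
pose le (q q' : T) := `[< forall x, sval q' x <= sval q x >].
have [||||[q [sq qp]] qmin] := @Zorn T le.
- by move=> q; apply/asboolP.
- move=> q r s /asboolP qr /asboolP rs; apply/asboolP => x.
  exact: le_trans (rs x) (qr x).
- move=> [q hq] [r hr] /asboolP/= qr /asboolP/= rq.
  have E : q = r by apply/funext => x; apply/eqP; rewrite eq_le rq qr.
  by case: _ / E hr {qr rq} => hr; congr exist; exact: Prop_irrelevance.
- move=> A Atot; have [[a Aa]|A0] := pselect (exists a, A a); last first.
    exists (exist _ p (conj sp (fun x => lexx (p x)))) => s As.
    by exfalso; apply: A0; exists s.
  have [|_ [b _ <-]||q sq qA] :=
      @sublinear_chain_inf p [set sval a | a in A].
  + by exists (sval a); exists a.
  + exact: (svalP b).
  + move=> _ _ [q Aq <-] [q' Aq' <-].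
    by have [/asboolP|/asboolP] := Atot _ _ Aq Aq'; [right|left].
  have qp x : q x <= p x.
    by apply: le_trans ((svalP a).2 x); apply: qA; exists a.
  exists (exist _ q (conj sq qp)) => s As; apply/asboolP => x /=.
  by apply: qA; exists s.
have qD : forall x y, q (x + y) = q x + q y.
  apply: minimal_sublinear_additive => // q' sq' q'q.
  have q'p x : q' x <= p x by exact: le_trans (q'q x) (qp x).
  have := qmin (exist _ q' (conj sq' q'p)) ltac:(by apply/asboolP).
  by move=> /(congr1 sval).
have qN x : q (- x) = - q x.
  by apply/eqP; rewrite -addr_eq0 -qD addNr sublinear0.
have lq : linear (q : V -> R^o).
  move=> t x y; rewrite qD; congr (_ + _).
  have [t0|t0] := leP 0 t; first by rewrite sublinearZ.
  have -> : q (t *: x) = - q (- t *: x) by rewrite -qN -scaleNr opprK.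
  by rewrite sublinearZ ?oppr_ge0 ?ltW// mulNr opprK.
pose l : {linear V -> R^o} :=
  HB.pack (q : V -> R^o) (GRing.isLinear.Build _ _ _ _ _ lq).
by exists l.
Qed.

End Sublinear.

Section Separation.
Context {R : realType} {B : normedModType R}.

Lemma sublinear_norm : sublinear (fun x : B => `|x|).
Proof.
split=> [x y|t x t0]; first exact: ler_normD.
by rewrite normrZ gtr0_norm.
Qed.

Lemma dual_of_bound (l : {linear B -> R^o}) (M : R) :
  (forall x, `|l x| <= M * `|x|) -> dual l.
Proof.
move=> lM; apply: bounded_linear_continuous; apply/linear_boundedP.
near=> r => x; apply: (le_trans (lM x)); rewrite ler_wpM2r//.
Unshelve. all: end_near. Qed.

Lemma le_norm_linear (l : {linear B -> R^o}) :
  (forall x, l x <= `|x|) -> forall x, `|l x| <= `|x|.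
Proof.
move=> lx x; rewrite ler_norml lx andbT.
by have := lx (- x); rewrite normrN linearN /=; lra.
Qed.

Lemma convex_comb (K : set B) x y (t : R) : convex_set K ->
  K x -> K y -> 0 <= t <= 1 -> K (t *: x + (1 - t) *: y).
Proof.
move=> cK Kx Ky /andP[t0 t1].
have := cK x y (Itv01 t0 t1); rewrite !inE; exact.
Qed.

(** Hahn-Banach for [p v = inf_(k in K, t >= 0) |v + t (k - x)| - t r]: it is at
    most [|v|], which bounds the functional, and at most [- r] at [x - k], which
    separates [x] from [K] with a margin [r]. *)
Lemma separation (K : set B) (x : B) (r : R) : K !=set0 -> convex_set K ->
  (forall k, K k -> r <= `|k - x|) ->
  exists l : {linear B -> R^o}, [/\ dual l, forall y, `|l y| <= `|y| &
    forall k, K k -> l x + r <= l k].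
Proof.
move=> [k0 Kk0] cK xr.
pose G (w : B) (c : R) :=
  exists t : R, exists2 k, K k & 0 <= t /\ w = t *: (k - x) /\ c = t * r.
have G0 : G 0 0 by exists 0, k0; rewrite // scale0r mul0r.
have GD w c w' c' : G w c -> G w' c' -> G (w + w') (c + c').
  move=> [t [k Kk [t0 [-> ->]]]] [t' [k' Kk' [t'0 [-> ->]]]].
  have [tt'|tt'] := eqVneq (t + t') 0.
    have -> : t = 0 by lra.
    have -> : t' = 0 by lra.
    by rewrite !scale0r !mul0r !addr0.
  have tt'0 : 0 < t + t' by rewrite lt_neqAle eq_sym tt' addr_ge0.
  exists (t + t'), ((t / (t + t')) *: k + (1 - t / (t + t')) *: k').
    apply: convex_comb => //; rewrite divr_ge0 ?addr_ge0//=.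
    by rewrite ler_pdivrMr// mul1r; lra.
  split; first by rewrite ltW.
  split; last by rewrite mulrDl.
  rewrite !scalerBr scalerDr !scalerA.
  rewrite [_ * (_ / _)](_ : _ = t); last by field.
  rewrite [_ * (1 - _)](_ : _ = t'); last by field.
  by rewrite addrACA -opprD -scalerDl.
have GZ t w c : 0 < t -> G w c -> G (t *: w) (t * c).
  move=> t0 [s [k Kk [s0 [-> ->]]]]; exists (t * s), k => //.
  split; first by apply: mulr_ge0 => //; exact: ltW.
  by rewrite scalerA mulrA.
have Gn w c : G w c -> c <= `|w|.
  by move=> [t [k Kk [t0 [-> ->]]]]; rewrite normrZ ger0_norm// ler_wpM2l// xr.
have [l lp] := hahn_banach (lower_translate_sublinear sublinear_norm G0 GD GZ Gn).
have le := lower_translate_le sublinear_norm G0 Gn.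
have ln : forall y, `|l y| <= `|y|.
  apply: le_norm_linear => y; apply: (le_trans (lp y)).
  by have := le y _ _ G0; rewrite addr0 subr0.
exists l; split => //.
  by apply: (@dual_of_bound _ 1) => y; rewrite mul1r.
move=> k Kk; have := le (x - k) (k - x) r.
rewrite subrKA subrr normr0 sub0r => h.
have : G (k - x) r by exists 1, k => //; rewrite scale1r mul1r.
by move=> /h h'; have := lp (x - k); rewrite linearB/=; lra.
Qed.

Lemma norming_functional (x : B) : exists l : {linear B -> R^o},
  [/\ dual l, forall y, `|l y| <= `|y| & l x = `|x|].
Proof.
have [||k ->|l [dl ln lx]] := @separation [set x] 0 `|x|.
- by exists x.
- by move=> y z t; rewrite !inE => -> ->; rewrite convmm.
- by rewrite subr0.
exists l; split => //; apply/eqP; rewrite eq_le (le_trans (ler_norm _) (ln x)).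
by have := lx x erefl; rewrite linear0 add0r.
Qed.

End Separation.

(** * The cylindrical sigma-algebra of a separable normed space *)

Section Cylindrical.
Context {R : realType} {B : normedModType R}.

Lemma dense_sequence : separable B ->
  exists u : nat -> B, forall x (e : R), 0 < e -> exists n, `|x - u n| < e.
Proof.
move=> [D cD dD].
have /pcard_surjP[u uD] : countable D by [].
exists u => x e e0.
have [|y [xy Dy]] := dD (ball x e) _ (ball_open x e).
  by exists x; exact: ballxx.
have [n _ uny] := uD y Dy.
by exists n; rewrite uny; move: xy; rewrite -ball_normE.
Qed.

Lemma norming_sequence : separable B ->
  exists l : nat -> {linear B -> R^o}, [/\ forall n, dual (l n),
    forall n x, `|l n x| <= `|x| &
    forall x (e : R), 0 < e -> exists n, `|x| - e < l n x].
Proof.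
move=> /dense_sequence[u du].
have [l lu] := choice (fun n => norming_functional (u n)).
exists l; split=> [n|n x|x e e0]; [by have [] := lu n|by have [] := lu n|].
have [|n xun] := du x (e / 2); first lra.
(* a functional norming a point norms its neighbours up to twice the distance *)
exists n; have [_ ln lun] := lu n.
have := ln (x - u n); rewrite ler_norml linearB lun /= => /andP[].
have := lerB_dist x (u n); lra.
Qed.

Context {d : measure_display} {T : measurableType d}.

Lemma measurable_dual (f : T -> B) (l : {linear B -> R^o}) : dual l ->
  measurable_fun setT (f : T -> cylindrical B) ->
  measurable_fun setT (l \o f : T -> R).
Proof.
move=> dl mf _ U mU; rewrite setTI comp_preimage -[X in measurable X]setTI.
by apply: mf => //; apply: sub_sigma_algebra; exists l, U.
Qed.

Lemma measurable_cylindrical (f : T -> B) :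
  (forall l, dual l -> measurable_fun setT (l \o f : T -> R)) ->
  measurable_fun setT (f : T -> cylindrical B).
Proof.
move=> mf; apply: (@measurability _ _ T (cylindrical B) setT f (@cylinders R B)) => //.
move=> _ [_ [l [U [dl mU ->]]] <-]; rewrite -comp_preimage.
exact: mf.
Qed.

Lemma measurable_cylindrical_cst (c : B) :
  measurable_fun setT (cst c : T -> cylindrical B).
Proof. exact: measurable_cst. Qed.

Lemma measurable_cylindricalD (f g : T -> B) :
  measurable_fun setT (f : T -> cylindrical B) ->
  measurable_fun setT (g : T -> cylindrical B) ->
  measurable_fun setT ((fun x => f x + g x) : T -> cylindrical B).
Proof.
move=> mf mg; apply: measurable_cylindrical => l dl.
rewrite (_ : _ \o _ = (l \o f : T -> R) \+ (l \o g : T -> R)); last first.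
  by apply/funext => x /=; rewrite linearD.
by apply: measurable_funD; exact: measurable_dual.
Qed.

Lemma measurable_cylindricalZ (f : T -> B) (c : R) :
  measurable_fun setT (f : T -> cylindrical B) ->
  measurable_fun setT ((fun x => c *: f x) : T -> cylindrical B).
Proof.
move=> mf; apply: measurable_cylindrical => l dl.
rewrite (_ : _ \o _ = (cst c \* (l \o f : T -> R))); last first.
  by apply/funext => x /=; rewrite linearZ.
by apply: measurable_funM => //; exact: measurable_dual.
Qed.

Lemma measurable_cylindricalB (f : T -> B) (c : B) :
  measurable_fun setT (f : T -> cylindrical B) ->
  measurable_fun setT ((fun x => f x - c) : T -> cylindrical B).
Proof.
by move=> mf; apply: measurable_cylindricalD => //; exact: measurable_cylindrical_cst.
Qed.

Lemma measurable_cylindrical_sum (I : Type) (s : seq I) (f : I -> T -> B) :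
  (forall i, measurable_fun setT (f i : T -> cylindrical B)) ->
  measurable_fun setT ((fun x => \sum_(i <- s) f i x) : T -> cylindrical B).
Proof.
move=> mf; elim: s => [|i s IH].
  rewrite (_ : (fun _ => _) = cst 0); first exact: measurable_cylindrical_cst.
  by apply/funext => x; rewrite big_nil.
rewrite (_ : (fun _ => _) = (fun x => f i x + \sum_(i <- s) f i x)).
  exact: measurable_cylindricalD.
by apply/funext => x; rewrite big_cons.
Qed.

(** The norm is a countable supremum of continuous functionals. *)
Lemma measurable_cylindrical_norm (f : T -> B) : separable B ->
  measurable_fun setT (f : T -> cylindrical B) ->
  measurable_fun setT (fun x => `|f x|).
Proof.
move=> /norming_sequence[l [dl ln lx]] mf.
have ub x : has_ubound (range ((fun n => (l n \o f : T -> R)) ^~ x)).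
  by exists `|f x| => _ [n _ <-] /=; rewrite (le_trans (ler_norm _)).
rewrite (_ : (fun _ => _) =
  (fun x => sups ((fun n => (l n \o f : T -> R)) ^~ x) 0)).
  apply: measurable_fun_sups => // m; exact: measurable_dual.
apply/funext => x; apply/eqP; rewrite eq_le; apply/andP; split.
- apply/ler_addgt0Pr => e e0.
  have [n xn] := lx (f x) e e0.
  have : l n (f x) <= sups ((fun n => (l n \o f : T -> R)) ^~ x) 0.
    apply: ub_le_sup; last by exists n.
    by case: (ub x) => M hM; exists M => _ [m _ <-]; apply: hM; exists m.
  by move: xn; lra.
- apply: ge_sup; first by exists (l 0%N (f x)); exists 0%N.
  by move=> _ [n _ <-] /=; rewrite (le_trans (ler_norm _)).
Qed.

(** By separability an open set is a countable union of balls centered on a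
    dense sequence, and distances are measurable. *)
Lemma measurable_cylindrical_open (f : T -> B) (O : set B) : separable B ->
  measurable_fun setT (f : T -> cylindrical B) -> open O ->
  measurable (f @^-1` O).
Proof.
move=> sB mf oO; have [u du] := dense_sequence sB.
rewrite (_ : f @^-1` O = \bigcup_n \bigcup_(k in
  [set k | ball (u n) (k.+1%:R^-1 : R) `<=` O])
  [set x | `|f x - u n| < k.+1%:R^-1]).
  apply: bigcupT_measurable => n; apply: bigcup_measurable => k _.
  have mfn : measurable_fun setT (fun x => `|f x - u n|).
    by apply: measurable_cylindrical_norm => //; exact: measurable_cylindricalB.
  rewrite -[X in measurable X]setTI.
  rewrite (_ : [set x | _] = (fun x => `|f x - u n|) @^-1` `]-oo, k.+1%:R^-1[).
    exact: mfn.
  by apply/seteqP; split => x /=; rewrite in_itv.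
apply/seteqP; split=> [x Ofx|x [n _ [k kO /= fx]]]; last first.
  by apply: kO; rewrite -ball_normE /= distrC.
have /nbhs_ballP[e /= e0 eO] : nbhs (f x) O by exact: open_nbhs_nbhs.
have [k ke] : exists k, k.+1%:R^-1 < e / 2.
  have e2 : 0 < e / 2 by lra.
  exists (Num.truncn (e / 2)^-1); rewrite invf_plt ?posrE//.
  exact: truncnS_gt.
have [n fxn] := du (f x) k.+1%:R^-1 ltac:(by rewrite invr_gt0).
exists n => //; exists k => //= y; rewrite -ball_normE /= => uny.
apply: eO; rewrite -ball_normE /=.
rewrite (le_lt_trans (ler_distD (u n) _ _))//.
by rewrite (splitr e) ltrD// (lt_trans _ ke).
Qed.

Lemma measurable_cylindrical_closed (f : T -> B) (C : set B) : separable B ->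
  measurable_fun setT (f : T -> cylindrical B) -> closed C ->
  measurable (f @^-1` C).
Proof.
move=> sB mf cC; rewrite -[X in measurable X]setCK preimage_setC.
apply: measurableC; apply: measurable_cylindrical_open => //.
exact: closed_openC.
Qed.

End Cylindrical.

(** * Real-valued integrals under a probability measure *)

Notation intR mu f := (mu.-integrable setT (EFin \o f)).

Section RealIntegral.
Context {d : measure_display} {T : measurableType d} {R : realType}
  (P : probability T R).
Implicit Types f g : T -> R.

Lemma intR_measurable f : intR P f -> measurable_fun setT f.
Proof. by move=> /measurable_int/measurable_EFinP. Qed.

Lemma intR_le f g : measurable_fun setT f -> (forall x, `|f x| <= g x) ->
  intR P g -> intR P f.
Proof.
move=> mf fg; apply: le_integrable => //; first exact/measurable_EFinP.
by move=> x _ /=; rewrite lee_fin (le_trans (fg x))// ler_norm.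
Qed.

Lemma intR_cst (c : R) : intR P (cst c).
Proof. exact: finite_measure_integrable_cst. Qed.

Lemma intR_bounded f (M : R) : measurable_fun setT f ->
  (forall x, `|f x| <= M) -> intR P f.
Proof. by move=> mf fM; apply: (intR_le mf fM); exact: intR_cst. Qed.

Lemma intR_indic (A : set T) : measurable A -> intR P (\1_A : T -> R).
Proof.
move=> mA; apply: (@intR_bounded _ 1); first exact: measurable_indic.
by move=> x; rewrite indicE; case: (_ \in _); rewrite /= ?normr1// normr0.
Qed.

Lemma intR_lty f : measurable_fun setT f -> (forall x, 0 <= f x) ->
  (\int[P]_x (f x)%:E < +oo)%E -> intR P f.
Proof.
move=> mf f0 fy; apply/integrableP; split; first exact/measurable_EFinP.
by under eq_integral do rewrite /= ger0_norm//.
Qed.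

Lemma RintE f : intR P f -> (\int[P]_x f x)%:E = (\int[P]_x (f x)%:E)%E.
Proof. by move=> fi; rewrite fineK//; exact: integrable_fin_num. Qed.

Lemma intR_ltyP f : intR P f -> (\int[P]_x (f x)%:E < +oo)%E.
Proof. by move=> /RintE <-; rewrite ltry. Qed.

Lemma intRD f g : intR P f -> intR P g -> intR P (fun x => f x + g x).
Proof.
move=> fi gi; rewrite (_ : _ \o _ = (EFin \o f) \+ (EFin \o g))%E//.
exact: integrableD.
Qed.

Lemma intRN f : intR P f -> intR P (fun x => - f x).
Proof.
by move=> fi; rewrite (_ : _ \o _ = (-%E \o (EFin \o f)))//; exact: integrableN.
Qed.

Lemma intRB f g : intR P f -> intR P g -> intR P (fun x => f x - g x).
Proof. by move=> fi gi; apply: intRD => //; exact: intRN. Qed.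

Lemma intRZ (c : R) f : intR P f -> intR P (fun x => c * f x).
Proof.
move=> fi; rewrite (_ : _ \o _ = (fun x => c%:E * (f x)%:E)%E)//.
exact: integrableZl.
Qed.

Lemma intR_norm f : intR P f -> intR P (fun x => `|f x|).
Proof. by move=> fi; exact: integrable_norm. Qed.

Lemma intR_sum (I : Type) (s : seq I) (f : I -> T -> R) :
  (forall i, intR P (f i)) -> intR P (fun x => \sum_(i <- s) f i x).
Proof.
move=> fi; elim: s => [|i s IH].
  by under [X in EFin \o X]funext do rewrite big_nil; exact: intR_cst.
by under [X in EFin \o X]funext do rewrite big_cons; exact: intRD.
Qed.

Lemma RintD f g : intR P f -> intR P g ->
  \int[P]_x (f x + g x) = \int[P]_x f x + \int[P]_x g x.
Proof. by move=> fi gi; rewrite RintegralD. Qed.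

Lemma RintB f g : intR P f -> intR P g ->
  \int[P]_x (f x - g x) = \int[P]_x f x - \int[P]_x g x.
Proof. by move=> fi gi; rewrite RintegralB. Qed.

Lemma RintZ (c : R) f : intR P f -> \int[P]_x (c * f x) = c * \int[P]_x f x.
Proof. by move=> fi; rewrite RintegralZl. Qed.

Lemma Rint_cst (c : R) : \int[P]_x (cst c x) = c.
Proof.
rewrite /= Rintegral_cst// -[RHS]mulr1; congr (_ * _).
exact: (congr1 fine (probability_setT P)).
Qed.

Lemma Rint_sum (I : Type) (s : seq I) (f : I -> T -> R) :
  (forall i, intR P (f i)) ->
  \int[P]_x (\sum_(i <- s) f i x) = \sum_(i <- s) \int[P]_x f i x.
Proof.
move=> fi; elim: s => [|i s IH].
  rewrite big_nil -[RHS](Rint_cst 0); congr Rintegral.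
  by apply/funext => x; rewrite big_nil.
rewrite big_cons -IH -RintD//; last exact: intR_sum.
by congr Rintegral; apply/funext => x; rewrite big_cons.
Qed.

Lemma Rint_le f g : intR P f -> intR P g -> (forall x, f x <= g x) ->
  \int[P]_x f x <= \int[P]_x g x.
Proof. by move=> fi gi fg; apply: le_Rintegral => // x _. Qed.

Lemma Rint_ge0 f : (forall x, 0 <= f x) -> 0 <= \int[P]_x f x.
Proof. by move=> f0; apply: Rintegral_ge0. Qed.

Lemma Rint_indic (A : set T) : measurable A ->
  \int[P]_x (\1_A x) = fine (P A).
Proof. by move=> mA; rewrite /Rintegral integral_indic// setIT. Qed.

Lemma Rint_norm f : intR P f -> `|\int[P]_x f x| <= \int[P]_x `|f x|.
Proof. by move=> fi; exact: le_normr_Rintegral. Qed.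

End RealIntegral.

(** * The Bochner integral through continuous functionals *)

Section BochnerTheory.
Context {R : realType} {d : measure_display} {T : measurableType d}.

Section Functionals.
Context {B : normedModType R} (sepB : separable B) (nu : probability T R).
Implicit Types (F : T -> B) (l : {linear B -> R^o}).

Lemma dual_bounded l : dual l -> exists2 M : R, 0 < M &
  forall x, `|l x| <= M * `|x|.
Proof.
move=> dl; have /linear_boundedP lb := (linear_bounded_continuous l).2 dl.
near +oo_R => M; exists M => //.
by near: M.
Unshelve. all: end_near. Qed.

(** The weak topology is separated: a Bochner integral is determined
    by real integrals. *)
Lemma dual_separates (x y : B) : (forall l, dual l -> l x = l y) -> x = y.
Proof.
move=> lxy; apply/eqP; rewrite -subr_eq0 -normr_eq0; apply/eqP.
have [l [dl _ <-]] := norming_functional (x - y).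
by rewrite linearB/= lxy// subrr.
Qed.

Lemma simple_val_dual l (s : seq (set T * B)) x :
  l (simple_val s x) = \sum_(p <- s) l p.2 * \1_(p.1) x.
Proof.
rewrite /simple_val linear_sum; apply: eq_bigr => p _.
by rewrite linearZ mulrC.
Qed.

Lemma simple_integral_dual l (s : seq (set T * B)) :
  {in s, forall p, measurable p.1} ->
  intR nu (fun x => l (simple_val s x)) /\
  \int[nu]_x l (simple_val s x) = l (simple_integral nu s).
Proof.
elim: s => [_|p s IH ms].
  rewrite /simple_integral big_nil linear0.
  rewrite (_ : (fun x => _) = cst 0) ?Rint_cst; first by split => //; exact: intR_cst.
  by apply/funext => x; rewrite /simple_val big_nil linear0.
have [|is1 es] := IH.
  by move=> q qs; apply: ms; rewrite inE qs orbT.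
have mp : measurable p.1 by apply: ms; rewrite inE eqxx.
have -> : (fun x => l (simple_val (p :: s) x)) =
    (fun x => l p.2 * \1_(p.1) x + l (simple_val s x)).
  by apply/funext => x; rewrite !simple_val_dual big_cons.
have ip : intR nu (fun x => l p.2 * \1_(p.1) x).
  by apply: intRZ; exact: intR_indic.
split; first exact: intRD.
rewrite RintD// RintZ ?Rint_indic//; last exact: intR_indic.
rewrite es /simple_integral big_cons linearD linearZ /=.
by congr (_ + _); rewrite mulrC.
Qed.

Lemma measurable_simple_val (s : seq (set T * B)) :
  {in s, forall p, measurable p.1} ->
  measurable_fun setT (simple_val s : T -> cylindrical B).
Proof.
move=> ms; apply: measurable_cylindrical => l dl.
exact: intR_measurable (simple_integral_dual l ms).1.
Qed.

Lemma measurable_dist_simple_val F (s : seq (set T * B)) :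
  measurable_fun setT (F : T -> cylindrical B) ->
  {in s, forall p, measurable p.1} ->
  measurable_fun setT (fun x => `|F x - simple_val s x|).
Proof.
move=> mF ms; apply: measurable_cylindrical_norm => //.
apply: measurable_cylindricalD => //.
rewrite (_ : (fun x => _) = (fun x => (-1) *: simple_val s x)).
  by apply: measurable_cylindricalZ; exact: measurable_simple_val.
by apply/funext => x; rewrite scaleN1r.
Qed.

Lemma bochner_integrable_norm F : bochner_integrable nu F ->
  intR nu (fun x => `|F x|).
Proof.
move=> [mF Fy]; apply: intR_lty => //; exact: measurable_cylindrical_norm.
Qed.

Lemma bochner_integrable_dual F l : bochner_integrable nu F -> dual l ->
  intR nu (fun x => l (F x)).
Proof.
move=> Fi dl; have [M M0 lM] := dual_bounded dl.
apply: (@intR_le _ _ _ _ _ (fun x => M * `|F x|)) => //.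
  exact: measurable_dual dl Fi.1.
by apply: intRZ; exact: bochner_integrable_norm.
Qed.

Lemma is_bochner_integral_dual F y l : bochner_integrable nu F ->
  is_bochner_integral nu F y -> dual l -> l y = \int[nu]_x l (F x).
Proof.
move=> Fi [s [ms s0 sy]] dl; have [M M0 lM] := dual_bounded dl.
have lF := bochner_integrable_dual Fi dl.
have mFs n := measurable_dist_simple_val Fi.1 (ms n).
have lsy : l (simple_integral nu (s n)) @[n --> \oo] --> l y.
  by apply: continuous_cvg => //; exact: dl.
have lsF : l (simple_integral nu (s n)) @[n --> \oo] --> (\int[nu]_x l (F x) : R^o).
  apply/cvgrPdist_lt => e e0.
  have eM : 0 < e / M by exact: divr_gt0.
  move/fine_cvgP : s0 => [sfin /cvgrPdist_lt/(_ _ eM) s0].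
  near=> n.
  have sfinn : (\int[nu]_x (`|F x - simple_val (s n) x|)%:E)%E \is a fin_num.
    by near: n.
  have ifs : intR nu (fun x => `|F x - simple_val (s n) x|).
    by apply: intR_lty => //; rewrite -ge0_fin_numE// integral_ge0.
  have [is1 <-] := simple_integral_dual l (ms n).
  rewrite -RintB//; apply: (le_lt_trans (Rint_norm _)).
    exact: intRB.
  have : \int[nu]_x `|F x - simple_val (s n) x| < e / M.
    have : `|0 - fine (\int[nu]_x (`|F x - simple_val (s n) x|)%:E)| < e / M.
      by near: n.
    rewrite sub0r normrN ger0_norm//.
    by apply: Rint_ge0.
  rewrite ltr_pdivlMr//; apply: le_lt_trans.
  rewrite mulrC -RintZ//; apply: Rint_le.
  - by apply: intR_norm; exact: intRB.
  - exact: intRZ.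
  - by move=> x; rewrite -linearB.
exact: (cvg_unique _ lsy lsF).
Unshelve. all: by end_near. Qed.

End Functionals.

End BochnerTheory.

Section BochnerExistence.
Context {R : realType} {d : measure_display} {T : measurableType d}
  {B : completeNormedModType R} (sepB : separable B) (nu : probability T R).

(** Among the first [n] points of the sequence [u] and the origin, the [n]-th
    simple function picks one that is closest to [F x]. *)
Fixpoint nearest_simple (F : T -> B) (u : nat -> B) (n : nat) :
    seq (set T * B) :=
  match n with
  | 0 => [::]
  | m.+1 =>
    let s := nearest_simple F u m in
    let D := [set x | `|F x - u m| < `|F x - simple_val s x|] in
    (D, u m) :: [seq (p.1 `\` D, p.2) | p <- s]
  end.

Section Nearest.
Variables (F : T -> B) (u : nat -> B).
Hypothesis mF : measurable_fun setT (F : T -> cylindrical B).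
Local Notation s := (nearest_simple F u).

Lemma nearest_simpleS n x : simple_val (s n.+1) x =
  if `|F x - u n| < `|F x - simple_val (s n) x| then u n else simple_val (s n) x.
Proof.
rewrite /= {1}/simple_val big_cons big_map /=.
case: ifPn => [h|/negP h].
  rewrite indicE mem_set// scale1r big1 ?addr0// => p _.
  by rewrite indicE memNset ?scale0r// => -[].
rewrite indicE memNset// scale0r add0r; apply: eq_bigr => p _.
congr (_ *: _); rewrite !indicE; congr (_ _)%:R; apply/idP/idP.
  by rewrite !inE => -[].
by rewrite !inE; split.
Qed.

Lemma nearest_simple_measurable n :
  {in s n, forall p, measurable p.1}.
Proof.
elim: n => [|n IH] p //=.
have mD : measurable [set x | `|F x - u n| < `|F x - simple_val (s n) x|].
  rewrite -[X in measurable X]setTI; apply: measurable_fun_ltr => //.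
    by apply: measurable_cylindrical_norm => //; exact: measurable_cylindricalB.
  exact: (measurable_dist_simple_val sepB nu).
rewrite inE => /predU1P[->//|/mapP[q qs ->]] /=.
by apply: measurableD => //; exact: IH.
Qed.

Lemma nearest_simple_le n x : `|F x - simple_val (s n) x| <= `|F x|.
Proof.
elim: n => [|n IH]; first by rewrite /simple_val big_nil subr0.
by rewrite nearest_simpleS; case: ifPn => // /ltW h; rewrite (le_trans h).
Qed.

Lemma nearest_simple_nincr m n x : (m <= n)%N ->
  `|F x - simple_val (s n) x| <= `|F x - simple_val (s m) x|.
Proof.
move=> /subnK <-; elim: (n - m)%N => [|k IH]; first by rewrite add0n.
by rewrite addSn nearest_simpleS; case: ifPn => // /ltW h; rewrite (le_trans h).
Qed.

Lemma nearest_simple_le_seq n x : `|F x - simple_val (s n.+1) x| <= `|F x - u n|.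
Proof. by rewrite nearest_simpleS; case: ifPn => //; rewrite -leNgt. Qed.

End Nearest.

(** Nearest-point simple functions converge to [F] in mean by domination. Their
    integrals form a Cauchy sequence: the norm of a difference is the value of a
    norming functional, hence a real integral. *)
Lemma bochner_exists (F : T -> B) : bochner_integrable nu F ->
  exists y, is_bochner_integral nu F y.
Proof.
move=> Fi; have mF := Fi.1; have [u du] := dense_sequence sepB.
pose s := nearest_simple F u.
have ms n : {in s n, forall p, measurable p.1}.
  exact: nearest_simple_measurable.
pose g n x := `|F x - simple_val (s n) x|.
have mg n : measurable_fun setT (g n).
  exact: (measurable_dist_simple_val sepB nu).
have iF := bochner_integrable_norm sepB Fi.
have g_le n x : `|g n x| <= `|F x| by rewrite normr_id nearest_simple_le.
have ig n : intR nu (g n) by exact: intR_le iF.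
have g0 x : g ^~ x @ \oo --> 0.
  apply/cvgrPdist_lt => e e0; have [n xun] := du (F x) e e0.
  near=> m; rewrite sub0r normrN normr_id.
  apply: (le_lt_trans _ xun).
  apply: (le_trans _ (nearest_simple_le_seq F u n x)).
  by apply: nearest_simple_nincr; near: m; exists n.+1.
have [] := @dominated_convergence _ _ _ nu setT measurableT
  (fun n x => (g n x)%:E) (cst 0%E) (fun x => (`|F x|)%:E).
- by move=> n; exact/measurable_EFinP.
- exact: measurable_cst.
- by apply: aeW => x _; apply: cvg_EFin => //; [near=> n|exact: g0].
- exact: iF.
- by apply: aeW => x n _; rewrite /= lee_fin g_le.
rewrite integral0 => _ _ Ig0.
have Ig0' : (fun n => \int[nu]_x g n x) @ \oo --> 0.
  by have /fine_cvgP[_] := Ig0.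
have I_le m n : `|simple_integral nu (s m) - simple_integral nu (s n)| <=
    \int[nu]_x g m x + \int[nu]_x g n x.
  have [l [dl ln <-]] :=
    norming_functional (simple_integral nu (s m) - simple_integral nu (s n)).
  have [im em] := simple_integral_dual nu l (ms m).
  have [jn en] := simple_integral_dual nu l (ms n).
  rewrite linearB/= -em -en -RintB// -RintD//.
  apply: Rint_le; [exact: intRB|exact: intRD|] => x.
  rewrite -linearB (le_trans (ler_norm _))// (le_trans (ln _))//.
  by rewrite /g (distrC (F x)) ler_distD.
have /cauchy_cvgP Icvg : cauchy ((fun n => simple_integral nu (s n)) @ \oo).
  apply/cauchy_exP => e e0; have e2 : 0 < e / 2 by lra.
  move/cvgrPdist_lt/(_ _ e2): Ig0' => [N _ hN].
  have small n : (N <= n)%N -> \int[nu]_x g n x < e / 2.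
    move=> /hN /=; rewrite sub0r normrN ger0_norm//.
    by apply: Rint_ge0 => x; exact: normr_ge0.
  exists (simple_integral nu (s N)); exists N => // n /= Nn.
  rewrite -ball_normE /= (le_lt_trans (I_le _ _))//.
  by rewrite (splitr e) ltrD// small.
exists (lim ((fun n => simple_integral nu (s n)) @ \oo)), s; split => //.
Unshelve. all: by end_near. Qed.

Lemma bochner_integral_dual (F : T -> B) (l : {linear B -> R^o}) :
  bochner_integrable nu F -> dual l ->
  l (bochner_integral nu F) = \int[nu]_x l (F x).
Proof.
move=> Fi dl; apply: is_bochner_integral_dual => //.
by have [y Fy] := bochner_exists Fi; exact: xgetI Fy.
Qed.

Lemma bochner_integral_unique (F : T -> B) (y : B) : bochner_integrable nu F ->
  (forall l : {linear B -> R^o}, dual l -> l y = \int[nu]_x l (F x)) ->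
  bochner_integral nu F = y.
Proof.
move=> Fi ly; apply: dual_separates => l dl.
by rewrite ly// bochner_integral_dual.
Qed.

End BochnerExistence.

(** * Probability measures with a density *)

Section Density.
Context {d : measure_display} {T : measurableType d} {R : realType}.

Definition is_density (mu nu : probability T R) (h : T -> R) :=
  [/\ measurable_fun setT h, forall x, 0 <= h x &
    forall A, measurable A -> nu A = (\int[mu]_(x in A) (h x)%:E)%E].

Section WithDensity.
Variables (mu : probability T R) (h : T -> R).
Hypotheses (mh : measurable_fun setT h) (h0 : forall x, 0 <= h x).
Hypothesis h1 : (\int[mu]_x (h x)%:E = 1)%E.

(** The proofs are arguments, so that the measure and probability structures
    attached to this set function may depend on them. *)
Definition with_density (_ : measurable_fun setT h) (_ : forall x, 0 <= h x)
    (_ : (\int[mu]_x (h x)%:E = 1)%E) (A : set T) : \bar R :=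
  (\int[mu]_(x in A) (h x)%:E)%E.

Local Notation m := (with_density mh h0 h1).

Let m0 : m set0 = 0%E. Proof. exact: integral_set0. Qed.

Let m_ge0 A : (0 <= m A)%E.
Proof. by apply: integral_ge0 => x _; rewrite lee_fin. Qed.

Let m_sigma_additive : semi_sigma_additive m.
Proof.
apply: semi_sigma_additive_nng_induced; first exact/measurable_EFinP.
by move=> x; rewrite lee_fin.
Qed.

HB.instance Definition _ := isMeasure.Build _ _ _ m m0 m_ge0 m_sigma_additive.

HB.instance Definition _ := Measure_isProbability.Build _ _ _ m h1.

Lemma density_exists : exists nu, is_density mu nu h.
Proof. by exists m. Qed.

End WithDensity.

Section Theory.
Variables (mu nu : probability T R) (h : T -> R).
Hypothesis nuh : is_density mu nu h.

Let mh : measurable_fun setT h. Proof. by have [] := nuh. Qed.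
Let h0 x : 0 <= h x. Proof. by have [_] := nuh. Qed.

Lemma density_dominates : nu `<< mu.
Proof.
apply/null_content_dominatesP => A mA A0; have [_ _ ->//] := nuh.
by apply: null_set_integral => //; exact/measurable_funTS/measurable_EFinP.
Qed.

Lemma density_intR : intR mu h.
Proof.
apply: intR_lty => //; have [_ _ <-//] := nuh.
by rewrite probability_setT ltry.
Qed.

Let ae_RN : ae_eq mu setT (Radon_Nikodym_SigmaFinite.f nu mu) (EFin \o h).
Proof.
apply: integral_ae_eq => //.
- exact: Radon_Nikodym_SigmaFinite.f_integrable density_dominates.
- exact/measurable_EFinP.
- move=> A _ mA; have [_ _ nuE] := nuh; apply: etrans (nuE A mA).
  apply/esym/Radon_Nikodym_SigmaFinite.f_integral => //.
  exact: density_dominates.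
Qed.

Lemma density_Radon_Nikodym :
  ae_eq mu setT (Radon_Nikodym (charge_of_finite_measure nu) mu) (EFin \o h).
Proof.
apply: ae_eq_trans ae_RN; apply: ae_eq_sym.
by apply: ae_eq_Radon_Nikodym_SigmaFinite => //; exact: density_dominates.
Qed.

Lemma density_ge0_integral (f : T -> \bar R) : measurable_fun setT f ->
  (forall x, 0 <= f x)%E -> (\int[nu]_x f x = \int[mu]_x (f x * (h x)%:E))%E.
Proof.
move=> mf f0.
rewrite -(Radon_Nikodym_SigmaFinite.change_of_variables density_dominates f0)//.
apply: ae_eq_integral => //.
- apply: emeasurable_funM => //.
  apply: measurable_int.
  exact: Radon_Nikodym_SigmaFinite.f_integrable density_dominates.
- by apply: emeasurable_funM => //; exact/measurable_EFinP.
- exact: ae_eqe_mul2l ae_RN.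
Qed.

Lemma density_intRP (f : T -> R) : measurable_fun setT f ->
  intR nu f <-> intR mu (fun x => f x * h x).
Proof.
move=> mf; split => [/integrableP[_ fy]|/integrableP[_ fy]]; apply/integrableP.
- split; first by apply/measurable_EFinP; exact: measurable_funM.
  apply: le_lt_trans fy; rewrite density_ge0_integral//.
    apply: ge0_le_integral => //=.
    + by apply/measurable_EFinP/measurableT_comp => //; exact: measurable_funM.
    + by apply: emeasurable_funM; exact/measurable_EFinP/measurableT_comp.
    + by move=> x _; rewrite normrM (ger0_norm (h0 x)).
  by apply/measurable_EFinP/measurableT_comp.
- split; first exact/measurable_EFinP.
  rewrite density_ge0_integral//=; last first.
    by apply/measurable_EFinP/measurableT_comp.
  apply: le_lt_trans fy; apply: ge0_le_integral => //=.
  + by move=> x _; rewrite mule_ge0// lee_fin.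
  + by apply: emeasurable_funM; exact/measurable_EFinP/measurableT_comp.
  + by apply/measurable_EFinP/measurableT_comp => //; exact: measurable_funM.
  + by move=> x _; rewrite normrM (ger0_norm (h0 x)).
Qed.

Lemma density_Rint (f : T -> R) : intR nu f ->
  \int[nu]_x f x = \int[mu]_x (f x * h x).
Proof.
move=> fi; rewrite /Rintegral.
rewrite -(Radon_Nikodym_change_of_variables density_dominates measurableT fi).
congr fine; apply: ae_eq_integral => //.
- apply: emeasurable_funM.
    by apply/measurable_EFinP; exact: intR_measurable fi.
  apply: (measurable_int mu); apply: Radon_Nikodym_integrable.
  exact: density_dominates.
- apply/measurable_EFinP/measurable_funM => //; exact: intR_measurable fi.
- exact: (ae_eqe_mul2l (EFin \o f) density_Radon_Nikodym).
Qed.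

End Theory.

End Density.

(** * Change of variables along a map with prescribed law *)

Section Law.
Context {d d' : measure_display} {S : measurableType d} {T : measurableType d'}
  {R : realType}.

Definition has_law (P : probability S R) (X : S -> T) (mu : probability T R) :=
  measurable_fun setT X /\ forall A, measurable A -> P (X @^-1` A) = mu A.

Variables (P : probability S R) (X : S -> T) (mu : probability T R).
Hypothesis Xmu : has_law P X mu.

Lemma law_ge0_integral (f : T -> \bar R) : measurable_fun setT f ->
  (forall x, 0 <= f x)%E -> (\int[P]_w f (X w) = \int[mu]_x f x)%E.
Proof.
move=> mf f0.
transitivity (\int[pushforward P X]_x f x)%E.
  by rewrite (ge0_integral_pushforward Xmu.1)// preimage_setT.
by apply: eq_measure_integral => [|mX A mA _]; [exact: Xmu.1|exact: (Xmu.2 A mA)].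
Qed.

Lemma law_intR (f : T -> R) : intR mu f -> intR P (fun w => f (X w)).
Proof.
move=> fi; have mf := intR_measurable fi; apply/integrableP; split.
  by apply/measurable_EFinP; exact: (measurableT_comp mf Xmu.1).
rewrite (@law_ge0_integral (fun a => `|(f a)%:E|%E))//.
  by case/integrableP : fi.
by apply/measurableT_comp => //; exact/measurable_EFinP.
Qed.

Lemma law_Rint (f : T -> R) : intR mu f ->
  \int[P]_w f (X w) = \int[mu]_x f x.
Proof.
move=> fi; rewrite /Rintegral; congr fine.
transitivity (\int[pushforward P X]_x (f x)%:E)%E.
  rewrite (integral_pushforward Xmu.1 (f := EFin \o f)) ?preimage_setT//.
    exact: (measurable_int mu).
  exact: law_intR.
by apply: eq_measure_integral => [|mX A mA _]; [exact: Xmu.1|exact: (Xmu.2 A mA)].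
Qed.

End Law.

(** * Finite product measures on tuples *)

Section Boxes.
Context {d : measure_display} {T : measurableType d} {R : realType}.

Definition box n (A : 'I_n -> set T) : set (n.-tuple T) :=
  [set x | forall i, A i (tnth x i)].

Lemma measurable_box n (A : 'I_n -> set T) :
  (forall i, measurable (A i)) -> measurable (box A).
Proof.
move=> mA.
rewrite (_ : box A = \bigcap_(i in [set: 'I_n])
  ((@tnth n T ^~ i) @^-1` A i)); last first.
  by apply/seteqP; split => x /= xA i; [move=> _; exact: xA|exact: (xA i I)].
apply: fin_bigcap_measurable => // i _.
by rewrite -[X in measurable X]setTI; exact: measurable_tnth.
Qed.

Lemma tuple_measure_ext n (m1 m2 : probability (n.-tuple T) R) :
  (forall A : 'I_n -> set T, (forall i, measurable (A i)) ->
    m1 (box A) = m2 (box A)) ->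
  forall S, measurable S -> m1 S = m2 S.
Proof.
move=> m12 S mS.
pose G := [set box A | A in [set A : 'I_n -> set T | forall i, measurable (A i)]].
have boxT : box (fun _ : 'I_n => setT) = setT by apply/seteqP; split.
have GT : G setT by exists (fun _ => setT) => //= i; exact: measurableT.
apply: (@g_sigma_algebra_measure_unique _ _ _ G _ (fun _ => setT)) => //.
- by move=> _ [A mA <-]; exact: measurable_box.
- exact: bigcup_const.
- move=> _ _ [A mA <-] [A' mA' <-]; exists (fun i => A i `&` A' i).
    by move=> i; apply: measurableI; [exact: mA|exact: mA'].
  apply/seteqP; split => x /=; first by move=> h; split => i; have [] := h i.
  by move=> [hA hA'] i; split.
- by move=> _ [A mA <-]; exact: m12.
- by move=> _; rewrite -ge0_fin_numE//; exact: fin_num_measure.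
have : measurable_fun [set: g_sigma_algebraType G]
    (id : g_sigma_algebraType G -> n.-tuple T).
  apply/measurable_fun_tnthP => i _ A mA; rewrite setTI.
  apply: sub_sigma_algebra.
  exists (fun j => if j == i then A else setT) => /= [j|].
    by case: ifP => _; [exact: mA|exact: measurableT].
  apply/seteqP; split => x /=; first by move=> /(_ i); rewrite eqxx.
  by move=> Ax j; case: eqP => // ->.
by move=> /(_ measurableT S mS); rewrite setTI.
Qed.

Variable alpha : probability T R.

Lemma integral_powerS n (f : n.+1.-tuple T -> \bar R) :
  measurable_fun setT f -> (forall x, 0 <= f x)%E ->
  (\int[power alpha n.+1]_x f x =
   \int[alpha]_a \int[power alpha n]_x f (tcons (a, x)))%E.
Proof.
move=> mf f0; rewrite /= ge0_integral_distribution//.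
rewrite fubini_tonelli1//=.
exact: measurableT_comp.
Qed.

Lemma measurable_integral_tcons n (f : n.+1.-tuple T -> \bar R) :
  measurable_fun setT f -> (forall x, 0 <= f x)%E ->
  measurable_fun setT (fun a => \int[power alpha n]_x f (tcons (a, x)))%E.
Proof.
move=> mf f0.
apply: (@measurable_fun_fubini_tonelli_F _ _ _ _ _ (power alpha n)
  (f \o @tcons _ T n)).
- exact: measurableT_comp.
- by move=> x; exact: f0.
Qed.

Lemma measurable_prod_tnth n (g : 'I_n -> T -> R) :
  (forall i, measurable_fun setT (g i)) ->
  measurable_fun setT (fun x : n.-tuple T => \prod_(i < n) g i (tnth x i)).
Proof.
move=> mg; apply: measurable_prod => i _.
apply: measurableT_comp; [exact: mg|exact: measurable_tnth].
Qed.

Lemma integral_power_prod n (g : 'I_n -> T -> R) :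
  (forall i, measurable_fun setT (g i)) -> (forall i x, 0 <= g i x) ->
  (forall i, intR alpha (g i)) ->
  (\int[power alpha n]_x (\prod_(i < n) g i (tnth x i))%:E =
   (\prod_(i < n) \int[alpha]_a g i a)%R%:E)%E.
Proof.
elim: n g => [|n IH] g mg g0 gi.
  rewrite big_ord0 /= integral_dirac//=.
    by rewrite diracT mul1e big_ord0.
  by apply/measurable_EFinP; exact: measurable_prod_tnth.
rewrite integral_powerS; last 2 first.
- by apply/measurable_EFinP; exact: measurable_prod_tnth.
- by move=> x; rewrite lee_fin; apply: prodr_ge0 => i _.
rewrite big_ord_recl.
under eq_integral => a _.
  under eq_integral => x _.
    rewrite big_ord_recl tnth0.
    under eq_bigr => i _ do rewrite tnthS.
    rewrite EFinM; over.
  rewrite /= ge0_integralZl_EFin//; last 2 first.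
  - by move=> x _; rewrite lee_fin; apply: prodr_ge0 => i _.
  - apply/measurable_EFinP.
    exact: (@measurable_prod_tnth n (fun i => g (lift ord0 i))).
  rewrite (IH (fun i => g (lift ord0 i)))// muleC; over.
rewrite ge0_integralZl_EFin//; first by rewrite -RintE// -EFinM mulrC.
- by move=> a _; rewrite lee_fin.
- exact/measurable_EFinP.
- by apply: prodr_ge0 => i _; exact: Rint_ge0.
Qed.

Lemma indic_box n (A : 'I_n -> set T) x :
  \1_(box A) x = \prod_(i < n) \1_(A i) (tnth x i) :> R.
Proof.
rewrite indicE; have [xA|xA] := pselect (box A x).
  rewrite mem_set// big1// => i _; rewrite indicE mem_set//; exact: xA.
rewrite memNset//; move/existsNP : xA => [i xAi].
by rewrite (bigD1 i)//= indicE memNset ?mul0r.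
Qed.

Lemma power_box n (A : 'I_n -> set T) : (forall i, measurable (A i)) ->
  power alpha n (box A) = (\prod_(i < n) fine (alpha (A i)))%:E.
Proof.
move=> mA; transitivity (\int[power alpha n]_x (\1_(box A) x : R)%:E)%E.
  by rewrite integral_indic ?setIT//; exact: measurable_box.
under eq_integral do rewrite indic_box.
rewrite (@integral_power_prod n (fun i => \1_(A i))).
- by congr EFin; apply: eq_bigr => i _; rewrite Rint_indic.
- by move=> i; exact: measurable_indic.
- by [].
- by move=> i; exact: intR_indic.
Qed.

Definition tuple_perm n (s : {perm 'I_n}) (x : n.-tuple T) : n.-tuple T :=
  [tuple tnth x (s i) | i < n].

Lemma measurable_tuple_perm n (s : {perm 'I_n}) :
  measurable_fun setT (tuple_perm s).
Proof.
apply/measurable_fun_tnthP => i.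
rewrite (_ : _ \o _ = (@tnth n T ^~ (s i))); first exact: measurable_tnth.
by apply/funext => x /=; rewrite tnth_mktuple.
Qed.

HB.instance Definition _ n (s : {perm 'I_n}) :=
  isMeasurableFun.Build _ _ _ _ (tuple_perm s) (measurable_tuple_perm s).

(** Boxes are permuted among themselves, and they determine a measure. *)
Lemma power_perm n (s : {perm 'I_n}) (S : set (n.-tuple T)) : measurable S ->
  power alpha n (tuple_perm s @^-1` S) = power alpha n S.
Proof.
move=> mS.
apply: (@tuple_measure_ext n (distribution (power alpha n) (tuple_perm s))) => //.
move=> A mA; rewrite power_box//.
transitivity (power alpha n (tuple_perm s @^-1` box A)); first by [].
rewrite (_ : _ @^-1` _ = box (fun i => A ((s^-1)%g i))); last first.
  apply/seteqP; split => x /= xA i.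
    by have := xA ((s^-1)%g i); rewrite tnth_mktuple permKV.
  by have := xA (s i); rewrite tnth_mktuple permK.
rewrite power_box; last by move=> i; exact: mA.
by congr EFin; rewrite (reindex_inj (@perm_inj _ s))/=; under eq_bigr do rewrite permK.
Qed.

Lemma power_tnth n (i : 'I_n) (A : set T) : measurable A ->
  power alpha n ((@tnth n T ^~ i) @^-1` A) = alpha A.
Proof.
move=> mA.
rewrite (_ : _ @^-1` _ = box (fun j => if j == i then A else setT)); last first.
  apply/seteqP; split => x /=; first by move=> Ax j; case: eqP => // ->.
  by move=> /(_ i); rewrite eqxx.
rewrite power_box => [|j]; last by case: ifP.
rewrite (bigD1 i)//= eqxx big1 ?mulr1 ?fineK ?fin_num_measure// => j /negPf ->.
by rewrite probability_setT.
Qed.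

Lemma law_tnth n (i : 'I_n) :
  has_law (power alpha n) (fun x => tnth x i) alpha.
Proof. by split; [exact: measurable_tnth|exact: power_tnth]. Qed.

End Boxes.

Section PowerDensity.
Context {d : measure_display} {T : measurableType d} {R : realType}.
Variable alpha : probability T R.

Lemma power_density (beta : probability T R) (h : T -> R) n :
  is_density alpha beta h ->
  is_density (power alpha n) (power beta n)
    (fun x => \prod_(i < n) h (tnth x i)).
Proof.
move=> abh; have [mh h0 hE] := abh; have hi := density_intR abh.
have mH := @measurable_prod_tnth _ _ _ n (fun=> h) (fun=> mh).
have H0 (x : n.-tuple T) : 0 <= \prod_(i < n) h (tnth x i).
  by apply: prodr_ge0.
have h1 : \int[alpha]_a h a = 1.
  by rewrite /Rintegral -hE// probability_setT.
have [|nu nuH] := density_exists (mu := power alpha n) mH H0.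
  by rewrite (@integral_power_prod _ _ _ alpha n (fun=> h))// big1.
split => // S mS; have [_ _ <-//] := nuH; apply: tuple_measure_ext => // A mA.
have [_ _ ->] := nuH; last exact: measurable_box.
rewrite power_box// integral_mkcond.
transitivity (\int[power alpha n]_x
    (\prod_(i < n) (h (tnth x i) * \1_(A i) (tnth x i)))%:E)%E; last first.
  apply: eq_integral => x _; rewrite big_split/= -indic_box.
  by rewrite patchE indicE; case: (x \in _); rewrite ?mulr1// mulr0.
rewrite (@integral_power_prod _ _ _ alpha n (fun i a => h a * \1_(A i) a)).
- congr EFin; apply: eq_bigr => i _; rewrite hE//.
  rewrite /Rintegral [X in fine X = _]integral_mkcond; congr fine.
  apply: eq_integral => a _.
  by rewrite patchE indicE; case: (a \in _); rewrite ?mulr1// mulr0.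
- by move=> i; apply: measurable_funM => //; exact: measurable_indic.
- by move=> i a; rewrite mulr_ge0.
- move=> i; apply: (intR_le _ _ hi).
    by apply: measurable_funM => //; exact: measurable_indic.
  move=> a; rewrite ger0_norm ?mulr_ge0// indicE.
  by case: (_ \in _); rewrite ?mulr1// mulr0.
Qed.

Lemma measurable_cat_tuple k n : measurable_fun setT
  (fun z : k.-tuple T * n.-tuple T => [tuple of z.1 ++ z.2]).
Proof.
apply/measurable_fun_tnthP => i; case: (split_ordP i) => j ->.
  rewrite (_ : _ \o _ = (@tnth _ T ^~ j) \o fst).
    by apply: measurableT_comp => //; exact: measurable_tnth.
  by apply/funext => z /=; rewrite tnth_lshift.
rewrite (_ : _ \o _ = (@tnth _ T ^~ j) \o snd).
  by apply: measurableT_comp => //; exact: measurable_tnth.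
by apply/funext => z /=; rewrite tnth_rshift.
Qed.

Lemma measurable_integral_cat k n (f : (k + n).-tuple T -> \bar R) :
  measurable_fun setT f -> (forall x, 0 <= f x)%E ->
  measurable_fun setT
    (fun x : k.-tuple T => \int[power alpha n]_y f [tuple of x ++ y])%E.
Proof.
move=> mf f0.
apply: (@measurable_fun_fubini_tonelli_F _ _ _ _ _ (power alpha n)
  (fun z : k.-tuple T * n.-tuple T => f [tuple of z.1 ++ z.2])).
- by apply: measurableT_comp => //; exact: measurable_cat_tuple.
- by move=> z; exact: f0.
Qed.

Lemma integral_power_cat k n (f : (k + n).-tuple T -> \bar R) :
  measurable_fun setT f -> (forall x, 0 <= f x)%E ->
  (\int[power alpha (k + n)]_z f z =
   \int[power alpha k]_x \int[power alpha n]_y f [tuple of x ++ y])%E.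
Proof.
elim: k f => [|k IH] f mf f0.
  rewrite [RHS]integral_dirac//=; last exact: measurable_integral_cat.
  rewrite [X in _ = (X * _)%E]diracT mul1e.
  by apply: eq_integral => x _; congr f; exact: val_inj.
rewrite [RHS]integral_powerS; last 2 first.
- exact: measurable_integral_cat.
- by move=> x; apply: integral_ge0.
rewrite [LHS](@integral_powerS _ _ _ alpha (k + n) f mf f0).
apply: eq_integral => a _; rewrite IH//.
- apply: eq_integral => x _; apply: eq_integral => y _; congr f.
  exact: val_inj.
- apply: measurableT_comp => //; apply: measurable_cons => //.
  exact: measurable_id.
Qed.

End PowerDensity.

(** * An infinite sequence of independent points *)

Definition stream (T : Type) := nat -> T.

HB.instance Definition _ (T : pointedType) := Pointed.copy (stream T) (nat -> T).

Section Cylinders.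
Context {d : measure_display} {T : measurableType d}.
Implicit Types C D : set (stream T).

Definition trunc n (w : stream T) : n.-tuple T := [tuple w i | i < n].

(** The default value beyond [n] is irrelevant to sets that depend only on the
    first [n] coordinates. *)
Definition extend n (x : n.-tuple T) : stream T := nth point x.

Definition scons (a : T) (w : stream T) : stream T :=
  fun i => if i is j.+1 then w j else a.

(** The cylinders with base in the first [n] coordinates. *)
Definition based n C := exists2 S : set (n.-tuple T),
  measurable S & C = trunc n @^-1` S.

Lemma extendK n : cancel (@extend n) (@trunc n).
Proof.
by move=> x; apply: eq_from_tnth => i; rewrite tnth_mktuple /extend -tnth_nth.
Qed.

Lemma trunc_scons n a (w : stream T) :
  trunc n.+1 (scons a w) = [tuple of a :: trunc n w].
Proof.
apply: eq_from_tnth => i; rewrite tnth_mktuple.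
case: (unliftP ord0 i) => [j ->|->]; last by rewrite tnth0.
by rewrite tnthS tnth_mktuple.
Qed.

Lemma basedE n C w : based n C -> C w = C (extend (trunc n w)).
Proof. by move=> [S mS ->]; rewrite /preimage /mkset extendK. Qed.

Lemma based_agree n C (w w' : stream T) : based n C ->
  (forall i, (i < n)%N -> w i = w' i) -> C w = C w'.
Proof.
move=> bC ww'; rewrite (basedE w bC) (basedE w' bC).
by congr (C (extend _)); apply: eq_from_tnth => i; rewrite !tnth_mktuple ww'.
Qed.

Lemma based_measurable n C : based n C -> measurable (@extend n @^-1` C).
Proof.
move=> [S mS ->]; rewrite -comp_preimage (_ : _ \o _ = id) ?preimage_id//.
by apply/funext => x /=; rewrite extendK.
Qed.

Lemma basedD n m C : based n C -> based (n + m) C.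
Proof.
move=> [S mS ->].
exists ((fun x : (n + m).-tuple T => [tuple tnth x (lshift m i) | i < n]) @^-1` S).
  suff : measurable_fun setT
      (fun x : (n + m).-tuple T => [tuple tnth x (lshift m i) | i < n]).
    by move=> /(_ measurableT S mS); rewrite setTI.
  apply/measurable_fun_tnthP => i.
  rewrite (_ : _ \o _ = (@tnth (n + m) T ^~ (lshift m i))).
    exact: measurable_tnth.
  by apply/funext => x /=; rewrite tnth_mktuple.
apply/funext => w; rewrite /preimage /mkset; congr (S _).
by apply: eq_from_tnth => i; rewrite !tnth_mktuple.
Qed.

Lemma based_leq n m C : (n <= m)%N -> based n C -> based m C.
Proof. by move=> /subnKC <-; exact: basedD. Qed.

Definition cylinder : set (set (stream T)) := [set C | exists n, based n C].

Lemma cylinder0 : cylinder set0.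
Proof. by exists 0%N, set0 => //; rewrite preimage_set0. Qed.

Lemma cylinderU : setU_closed cylinder.
Proof.
move=> C D [n bC] [m bD].
have [S mS CE] := basedD m bC.
have [S' mS' DE] : based (n + m) D by rewrite addnC; exact: basedD.
exists (n + m)%N, (S `|` S'); first exact: measurableU.
by rewrite CE DE preimage_setU.
Qed.

Lemma cylinderC : setC_closed cylinder.
Proof.
move=> C [n [S mS ->]]; exists n, (~` S); first exact: measurableC.
by rewrite preimage_setC.
Qed.

Lemma based_scons n C a : based n.+1 C -> based n (scons a @^-1` C).
Proof.
move=> [S mS ->]; exists ((fun x : n.-tuple T => [tuple of a :: x]) @^-1` S).
  have := measurable_cons (measurable_cst a) (@measurable_id _ (n.-tuple T) setT).
  by move=> /(_ measurableT S mS); rewrite setTI.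
by apply/funext => w; rewrite /preimage /mkset trunc_scons.
Qed.

End Cylinders.

(** Cylinders form an algebra of sets only; a display of their own keeps this
    structure apart from the sigma-algebra that they generate. *)
Definition stream_display : measure_display -> measure_display.
Proof. exact. Qed.

HB.instance Definition _ d (T : measurableType d) :=
  isAlgebraOfSets.Build (stream_display d) (stream T)
    (@cylinder0 d T) (@cylinderU d T) (@cylinderC d T).

Section StreamMeasure.
Context {d : measure_display} {T : measurableType d} {R : realType}.
Variable alpha : probability T R.
Implicit Types C D : set (stream T).

(** A choice of base; [stream_contentE] shows that the content is the same for
    every other one. *)
Definition base C : nat := xget 0%N [set n | based n C].

Definition stream_content C : \bar R :=
  power alpha (base C) (@extend _ T (base C) @^-1` C).

Lemma power_based n m C : based n C ->
  power alpha (n + m) (@extend _ T (n + m) @^-1` C) =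
  power alpha n (@extend _ T n @^-1` C).
Proof.
move=> bC; have mC := based_measurable bC.
have mC' := based_measurable (basedD m bC).
have indicE' k (S : set (k.-tuple T)) : measurable S ->
    power alpha k S = (\int[power alpha k]_x (\1_S x : R)%:E)%E.
  by move=> mS; rewrite integral_indic ?setIT.
rewrite indicE'// [RHS]indicE'// integral_power_cat//; last first.
  by apply/measurable_EFinP; exact: measurable_indic.
apply: eq_integral => x _.
transitivity (\int[power alpha m]_y (cst (\1_(@extend _ T n @^-1` C) x)%:E y))%E.
  apply: eq_integral => y _; rewrite /= !indicE; congr (_%:R%:E).
  congr (_ _); apply/idP/idP; rewrite !inE /preimage /mkset.
    rewrite (based_agree (w' := extend x) bC)// => i ilen.
    by rewrite /extend nth_cat size_tuple ilen.
  rewrite (based_agree (w' := extend x) bC)// => i ilen.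
  by rewrite /extend nth_cat size_tuple ilen.
rewrite integral_cst// [X in (_ * X)%E](_ : _ = 1%E) ?mule1//.
exact: probability_setT.
Qed.

Lemma stream_contentE n C : based n C ->
  stream_content C = power alpha n (@extend _ T n @^-1` C).
Proof.
move=> bC; have bbC : based (base C) C 
  by apply: (@xgetPex _ 0%N [set n | based n C]); exists n.
by rewrite /stream_content -(power_based n bbC) addnC power_based.
Qed.

Lemma stream_content_ge0 C : (0 <= stream_content C)%E.
Proof. exact: measure_ge0. Qed.

Lemma stream_content0 : stream_content set0 = 0%E.
Proof. by rewrite /stream_content preimage_set0 measure0. Qed.

Lemma stream_content_additive2 : additive2 stream_content.
Proof.
move=> C D [n bC] [m bD] CD.
have {}bC : based (n + m) C by exact: basedD.
have {}bD : based (n + m) D by rewrite addnC; exact: basedD.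
have bCD : based (n + m) (C `|` D).
  case: bC bD => [S mS ->] [S' mS' ->]; exists (S `|` S').
    exact: measurableU.
  by rewrite preimage_setU.
rewrite !(@stream_contentE (n + m))// preimage_setU measureU//.
- exact: based_measurable.
- exact: based_measurable.
- by rewrite -preimage_setI CD preimage_set0.
Qed.

HB.instance Definition _ := isContent.Build _ _ _ stream_content
  stream_content_ge0
  ((additive2P stream_content0).2 stream_content_additive2).

Lemma stream_content_setT : stream_content setT = 1%E.
Proof. by rewrite /stream_content preimage_setT; exact: probability_setT. Qed.

End StreamMeasure.

Section StreamContinuity.
Context {d : measure_display} {T : measurableType d} {R : realType}.
Variable alpha : probability T R.
Implicit Types C D : set (stream T).
Local Notation mu := (stream_content alpha).

(** Fubini's theorem on a cylinder: the first coordinate is integrated last. *)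
Lemma stream_content_scons C : cylinder C ->
  measurable_fun setT (fun a => mu (scons a @^-1` C)) /\
  mu C = (\int[alpha]_a mu (scons a @^-1` C))%E.
Proof.
move=> [n bC]; have {n bC} [n bC] : exists n, based n.+1 C.
  by exists n; exact: based_leq bC.
have mC := based_measurable bC.
pose f (x : n.+1.-tuple T) : \bar R := (\1_(@extend _ T n.+1 @^-1` C) x)%:E.
have mf : measurable_fun setT f.
  by apply/measurable_EFinP; exact: measurable_indic.
have f0 x : (0 <= f x)%E by rewrite lee_fin.
have E a : mu (scons a @^-1` C) = (\int[power alpha n]_x f (tcons (a, x)))%E.
  have bCa := based_scons a bC.
  rewrite (stream_contentE _ bCa).
  transitivity (\int[power alpha n]_x
      (\1_(@extend _ T n @^-1` (scons a @^-1` C)) x : R)%:E)%E.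
    by rewrite integral_indic ?setIT//; exact: based_measurable.
  apply: eq_integral => x _; rewrite /f !indicE; congr (_%:R%:E).
  rewrite (_ : (_ \in _) = (tcons (a, x) \in @extend _ T n.+1 @^-1` C))//.
  have sE : scons a (extend x) = extend (tcons (a, x)).
    by apply/funext; case=> [|i]; reflexivity.
  by apply/idP/idP; rewrite !inE /preimage /mkset sE.
split.
  by under eq_fun do rewrite E; exact: measurable_integral_tcons.
under eq_integral do rewrite E.
rewrite -integral_powerS// (stream_contentE _ bC).
by rewrite integral_indic ?setIT.
Qed.

Lemma stream_content_le1 C : cylinder C -> (mu C <= 1)%E.
Proof.
move=> [n bC]; rewrite (stream_contentE _ bC); apply: probability_le1.
exact: based_measurable.
Qed.

(** Sections have mass at most one, so the first coordinates whose section keeps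
    half of the mass [e] themselves have mass at least [e / 2]. These sets of
    coordinates decrease, so they have a common point. *)
Lemma stream_content_step (C : nat -> set (stream T)) (e : R) : 0 < e ->
  (forall k, cylinder (C k)) -> (forall k, C k.+1 `<=` C k) ->
  (forall k, (e%:E <= mu (C k))%E) ->
  exists a, forall k, ((e / 2)%:E <= mu (scons a @^-1` C k))%E.
Proof.
move=> e0 cC Cdec eC.
pose G k : set T := [set a | ((e / 2)%:E <= mu (scons a @^-1` C k))%E].
have mG k : measurable (G k).
  rewrite -[X in measurable X]setTI.
  apply: emeasurable_fun_c_infty => //.
  exact: (stream_content_scons (cC k)).1.
have cS k a : measurable (scons a @^-1` C k : set (stream T)).
  have [n bC] := cC k; exists n; apply: based_scons.
  exact: based_leq bC.
have Gdec : nonincreasing_seq G.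
  apply/nonincreasing_seqP => k; apply/subsetPset => a /= h.
  apply: (le_trans h); apply: le_measure; rewrite ?inE//.
  by move=> w /Cdec.
have eG k : ((e / 2)%:E <= alpha (G k))%E.
  have [mk Ek] := stream_content_scons (cC k).
  have : (e%:E <= \int[alpha]_a ((\1_(G k) a : R)%:E + (e / 2)%:E))%E.
    apply: (le_trans (eC k)); rewrite Ek; apply: ge0_le_integral => //.
    - apply: emeasurable_funD => //.
      by apply/measurable_EFinP; exact: measurable_indic.
    - move=> a _; rewrite indicE; case: (boolP (a \in G k)) => [_|aG].
        rewrite -EFinD; apply: (le_trans (stream_content_le1 (cS k a))).
        by rewrite lee_fin /= -[leLHS]addr0 lerD2l; lra.
      rewrite -EFinD add0r ltW//; move: aG; rewrite notin_setE => /negP.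
      by rewrite -ltNge.
  rewrite ge0_integralD//; first last.
  - by move=> a _; rewrite lee_fin; lra.
  - by apply/measurable_EFinP; exact: measurable_indic.
  rewrite integral_indic// setIT integral_cst// [X in ((e / 2)%:E * X)%E](_ : _ = 1%E).
    rewrite mule1 => h.
    rewrite -(leeD2rE (x := (e / 2)%:E))// -EFinD.
    by rewrite (_ : e / 2 + e / 2 = e)//; lra.
  exact: probability_setT.
have : alpha (\bigcap_k G k) <> 0%E.
  move=> a0.
  have /cvge_to_ge : alpha \o G @ \oo --> alpha (\bigcap_k G k).
    apply: nonincreasing_cvg_mu => //.
    - by rewrite -ge0_fin_numE// fin_num_measure.
    - by apply: bigcap_measurable => // k _.
  move=> /(_ (e / 2)%:E); rewrite a0.
  have : (\forall k \near \oo, (e / 2)%:E <= (alpha \o G) k)%E by near=> k; exact: eG.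
  by move=> h /(_ h); rewrite lee_fin; lra.
move=> G0; have [a aG] : \bigcap_k G k !=set0.
  by apply/set0P/eqP => GE; apply: G0; rewrite GE measure0.
by exists a => k; exact: (aG k I).
Unshelve. all: by end_near. Qed.

End StreamContinuity.

Section StreamProbability.
Context {d : measure_display} {T : measurableType d} {R : realType}.
Variable alpha : probability T R.
Local Notation mu := (stream_content alpha).

Let good (s : (nat -> set (stream T)) * R) := [/\ 0 < s.2,
  forall k, cylinder (s.1 k), forall k, s.1 k.+1 `<=` s.1 k &
  forall k, (s.2%:E <= mu (s.1 k))%E].

Let good_step (s : {s | good s}) : exists p : T * {s | good s},
  forall k, (sval p.2).1 k = scons p.1 @^-1` (sval s).1 k.
Proof.
case: s => -[C e] /= [e0 cC Cdec eC] /=.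
have [a aC] := stream_content_step e0 cC Cdec eC.
have gs : good ((fun k => scons a @^-1` C k), e / 2).
  split => /=; first by rewrite divr_gt0.
  - move=> k; have [n bC] := cC k; exists n; apply: based_scons.
    exact: based_leq bC.
  - by move=> k w /Cdec.
  - exact: aC.
by exists (a, exist _ _ gs).
Qed.

(** The coordinates are chosen one after the other, so that all sections keep a
    positive mass, hence are never empty. A set that depends on finitely many
    coordinates contains the resulting sequence as soon as the corresponding
    section is nonempty. *)
Lemma stream_content_bigcap (C : nat -> set (stream T)) (e : R) : 0 < e ->
  (forall k, cylinder (C k)) -> (forall k, C k.+1 `<=` C k) ->
  (forall k, (e%:E <= mu (C k))%E) -> \bigcap_k C k !=set0.
Proof.
move=> e0 cC Cdec eC.
have gC : good (C, e) by [].
have [h hE] := choice good_step.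
pose S := fix S j := if j is i.+1 then (h (S i)).2 else exist _ _ gC.
pose w j := (h (S j)).1.
pose prepend j (v : stream T) : stream T :=
  fun i => if (i < j)%N then w i else v (i - j)%N.
have SE j k v : (sval (S j)).1 k v = C k (prepend j v).
  elim: j v => [|j IH] v.
    by congr (C k _); apply/funext => i; rewrite /prepend ltn0 subn0.
  rewrite /= hE /preimage /mkset IH; congr (C k _).
  apply/funext => i; rewrite /prepend ltnS [(i <= j)%N]leq_eqVlt.
  have [->|ij] /= := eqVneq i j; first by rewrite ltnn subnn.
  case: ltnP => // ji; rewrite -(subnSK (m := j) (n := i))//.
  by rewrite ltn_neqAle eq_sym ij.
exists w => k _; have [n bC] := cC k.
have [v Sv] : (sval (S n)).1 k !=set0.
  apply/set0P/eqP => S0; have [s0 _ _ /(_ k)] := svalP (S n).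
  by rewrite S0 stream_content0 lee_fin leNgt s0.
move: Sv; rewrite SE.
rewrite (based_agree (w' := w) bC)// => i ilen.
by rewrite /prepend ilen.
Qed.

(** Otherwise what a countable cover leaves of a cylinder after finitely many
    steps would keep a fixed mass, and these remainders would have a common
    point. *)
Lemma stream_content_sigma_subadditive : measurable_subset_sigma_subadditive mu.
Proof.
move=> A F mF mA AF; rewrite leNgt; apply/negP => lt.
set s := (\sum_(n <oo) mu (F n))%E in lt.
have s0 : (0 <= s)%E by apply: nneseries_ge0.
have muAfin : mu A \is a fin_num.
  rewrite ge0_fin_numE//; apply: (le_lt_trans (stream_content_le1 _ mA)).
  exact: ltry.
have sfin : s \is a fin_num.
  by rewrite ge0_fin_numE//; apply: (lt_le_trans lt); exact: leey.
pose e : R := fine (mu A) - fine s.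
have e0 : 0 < e by rewrite subr_gt0 fine_lt.
pose B n := A `\` \big[setU/set0]_(i < n) F i.
have mB n : measurable (B n).
  by apply: measurableD => //; exact: bigsetU_measurable.
have [|n|n|w Bw] := @stream_content_bigcap B e e0.
- exact: mB.
- by apply: setDS; rewrite big_ord_recr; exact: subsetUl.
- have : (mu A <= s + mu (B n))%E.
    pose G i := if (i < n)%N then F i else B n.
    have Gn : G n = B n by rewrite /G ltnn.
    have GF (i : 'I_n) : G i = F i by rewrite /G ltn_ord.
    apply: (@le_trans _ _ (\sum_(i < n.+1) mu (G i))%E).
      apply: content_subadditive => //.
        by move=> i _; rewrite /G; case: ifP.
      move=> x Ax; rewrite big_ord_recr /= Gn.
      rewrite (eq_bigr (fun i : 'I_n => F i)); last by move=> i _; exact: GF.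
      have [xF|xF] := pselect ((\big[setU/set0]_(i < n) F i) x); [by left|by right].
    rewrite big_ord_recr /= Gn leeD2r//.
    rewrite (eq_bigr (fun i : 'I_n => mu (F i))); last by move=> i _; rewrite GF.
    rewrite -(big_mkord xpredT (fun i => mu (F i))).
    by apply: nneseries_lim_ge.
  rewrite -(fineK muAfin) -(fineK sfin) => h.
  by rewrite /e EFinB leeBlDl.
have [i _ Fiw] := AF w (Bw 0%N I).1.
have [_] := Bw i.+1 I; apply.
by rewrite big_ord_recr; right.
Qed.

HB.instance Definition _ := Content_SigmaSubAdditive_isMeasure.Build _ _ _
  mu stream_content_sigma_subadditive.

Definition stream_measure :
    set (g_sigma_algebraType (@measurable _ (stream T))) -> \bar R :=
  measure_extension mu.

HB.instance Definition _ := Measure.copy stream_measure (measure_extension mu).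

Lemma stream_measureE (C : set (stream T)) : cylinder C ->
  stream_measure C = mu C.
Proof.
by move=> mC; rewrite /stream_measure /measure_extension measurable_mu_extE.
Qed.

Lemma stream_measure_setT : stream_measure setT = 1%E.
Proof.
rewrite stream_measureE; last by exists 0%N, setT => //; rewrite preimage_setT.
exact: stream_content_setT.
Qed.

HB.instance Definition _ :=
  Measure_isProbability.Build _ _ _ stream_measure stream_measure_setT.

Lemma infinite_product : exists d' (S : measurableType d') (P : probability S R)
    (X : nat -> S -> T),
  (forall i, measurable_fun setT (X i)) /\
  forall n (A : set (n.-tuple T)), measurable A ->
    P [set w | A [tuple X i w | i < n]] = power alpha n A.
Proof.
exists _, (g_sigma_algebraType (@measurable _ (stream T))), stream_measure.
exists (fun i w => w i).
have cylE n (A : set (n.-tuple T)) : measurable A ->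
    cylinder ([set w | A [tuple w i | i < n]] : set (stream T)).
  by move=> mA; exists n, A.
split=> [i _ A mA|n A mA].
  rewrite setTI; apply: sub_sigma_algebra.
  exists i.+1, ((@tnth _ T ^~ ord_max) @^-1` A).
    rewrite -[X in measurable X]setTI.
    exact: (@measurable_tnth _ T i.+1 ord_max measurableT A mA).
  by apply/funext => w; rewrite /preimage /mkset tnth_mktuple.
rewrite [LHS]stream_measureE; last exact: cylE.
rewrite (@stream_contentE _ _ _ _ n); last by exists A.
congr (power alpha n _); apply/funext => x; rewrite /preimage /mkset.
by congr A; exact: (extendK x).
Qed.

End StreamProbability.

(** * The type 2 inequality for samples *)

Section Iid.
Context {d d' d'' : measure_display} {S : measurableType d}
  {T : measurableType d'} {T' : measurableType d''} {R : realType}.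
Variables (P : probability S R) (X : nat -> S -> T) (alpha : probability T R).
Hypothesis mX : forall i, measurable_fun setT (X i).
Hypothesis lawX : forall n (A : set (n.-tuple T)), measurable A ->
  P [set w | A [tuple X i w | i < n]] = power alpha n A.

Lemma law_sample n : has_law P (fun w => [tuple X i w | i < n]) (power alpha n).
Proof.
split; last exact: lawX.
apply/measurable_fun_tnthP => i.
rewrite (_ : _ \o _ = X i); first exact: mX.
by apply/funext => w /=; rewrite tnth_mktuple.
Qed.

Lemma law_coordinate i : has_law P (X i) alpha.
Proof.
split=> // A mA; rewrite -(power_tnth alpha (@ord_max i) mA) -lawX.
  by congr (P _); apply/funext => w; rewrite /preimage /mkset tnth_mktuple.
by rewrite -[X in measurable X]setTI; exact: measurable_tnth.
Qed.

Lemma iid_comp (g : T -> T') : measurable_fun setT g ->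
  iid P (fun i w => g (X i w)).
Proof.
move=> mg.
have mgA A : measurable A -> measurable (g @^-1` A).
  by move=> mA; rewrite -[X in measurable X]setTI; exact: mg.
have PE i A : measurable A ->
    P ((fun w => g (X i w)) @^-1` A) = alpha (g @^-1` A).
  by move=> mA; exact: (law_coordinate i).2 (mgA _ mA).
split.
- by move=> i; exact: measurableT_comp mg (mX i).
- by move=> i j A mA; rewrite !PE.
move=> J A mA.
pose N := (\max_(i <- J) i).+1.
have JN i : i \in J -> (i < N)%N by move=> iJ; rewrite ltnS; exact: leq_bigmax_seq.
pose A' (i : 'I_N) := if (val i) \in J then g @^-1` A i else setT.
have mA' i : measurable (A' i).
  by rewrite /A'; case: ifP => _; [exact: mgA|exact: measurableT].
rewrite (_ : \bigcap_(i in _) _ = [set w | box A' [tuple X i w | i < N]]).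
  rewrite lawX; last exact: measurable_box.
  rewrite power_box//= (eq_bigr (fun i : 'I_N => if val i \in J
    then fine (P ((fun w => g (X i w)) @^-1` A i)) else 1)); last first.
    move=> i _; rewrite /A'; case: ifP => _; first by rewrite PE.
    by rewrite probability_setT.
  rewrite -(big_mkord xpredT (fun i => if i \in J
    then fine (P ((fun w => g (X i w)) @^-1` A i)) else 1)) -big_mkcond.
  rewrite -big_filter; apply: perm_big; apply: uniq_perm => //.
  - by rewrite filter_uniq ?iota_uniq.
  - exact: fset_uniq.
  - move=> i; rewrite mem_filter mem_index_iota /= andb_idr//.
    exact: JN.
apply/seteqP; split => w /= Aw => [i|i iJ].
  by rewrite /A' tnth_mktuple; case: ifP => // /Aw.
by have := Aw (Ordinal (JN i iJ)); rewrite /A' tnth_mktuple /= iJ.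
Qed.

End Iid.

Section SquareSum.
Context {R : realType} {B : normedModType R}.

(** A crude constant, obtained by iterating [(x + y)^2 <= 2 x^2 + 2 y^2]; it
    serves for integrability and for the degenerate case of zero variance. *)
Lemma sqr_norm_sum_le (I : Type) (s : seq I) (f : I -> B) :
  `|\sum_(i <- s) f i| ^+ 2 <= 2 ^+ size s * \sum_(i <- s) `|f i| ^+ 2.
Proof.
elim: s => [|i s IH]; first by rewrite !big_nil normr0 expr0n mulr0.
rewrite !big_cons /= [2 ^+ (size s).+1]exprS.
set u := \sum_(j <- s) f j in IH *; set q := \sum_(j <- s) _ in IH *.
have q0 : 0 <= q by apply: sumr_ge0 => j _; rewrite exprn_ge0.
have p1 : 1 <= 2 ^+ size s :> R by rewrite exprn_ege1// ler1n.
have h : `|f i + u| ^+ 2 <= (`|f i| + `|u|) ^+ 2.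
  by rewrite ler_pXn2r ?nnegrE ?addr_ge0// ler_normD.
have h2 : `|f i| ^+ 2 <= 2 ^+ size s * `|f i| ^+ 2.
  by rewrite ler_peMl// exprn_ge0.
have h3 : 0 <= (`|f i| - `|u|) ^+ 2 by exact: sqr_ge0.
apply: (le_trans h); move: IH h2 h3.
by move: (2 ^+ size s) (`|f i|) (`|u|) => p x y IH h2 h3; lra.
Qed.

End SquareSum.

Section Type2.
Context {R : realType} {B : completeNormedModType R} (sepB : separable B)
  {d : measure_display} {T : measurableType d}.
Variables (alpha : probability T R) (a : R) (G : T -> B).
Hypothesis type2B : type2 B a.
Hypothesis mG : measurable_fun setT (G : T -> cylindrical B).
Hypothesis iG2 : intR alpha (fun x => `|G x| ^+ 2).

Lemma square_integrable_bochner : bochner_integrable alpha G.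
Proof.
split => //; apply: intR_ltyP.
apply: (@intR_le _ _ _ _ _ (fun x => 1 + `|G x| ^+ 2)).
- exact: measurable_cylindrical_norm.
- move=> x; rewrite normr_id.
  have := sqr_ge0 (`|G x| - 1); rewrite sqrrB1.
  have := normr_ge0 (G x); have := sqr_ge0 (`|G x|).
  by move: (`|G x| ^+ 2) => y; rewrite -mulr_natl; lra.
- by apply: intRD => //; exact: intR_cst.
Qed.

Lemma measurable_sum_tnth n : measurable_fun setT
  ((fun x : n.-tuple T => \sum_(i < n) G (tnth x i)) : _ -> cylindrical B).
Proof.
apply: measurable_cylindrical_sum => i.
by apply: measurableT_comp mG _; exact: measurable_tnth.
Qed.

Lemma intR_sqr_norm_sum n :
  intR (power alpha n) (fun x => `|\sum_(i < n) G (tnth x i)| ^+ 2).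
Proof.
apply: (@intR_le _ _ _ _ _
  (fun x => 2 ^+ n * \sum_(i < n) `|G (tnth x i)| ^+ 2)).
- apply: measurable_funX.
  by apply: measurable_cylindrical_norm => //; exact: measurable_sum_tnth.
- move=> x; rewrite ger0_norm ?exprn_ge0//.
  by have := sqr_norm_sum_le (index_enum 'I_n) (fun i => G (tnth x i));
    rewrite /index_enum -enumT size_enum_ord.
- apply: intRZ; apply: intR_sum => i.
  exact: (law_intR (law_tnth alpha i) (f := fun x => `|G x| ^+ 2)).
Qed.

Hypothesis G0 : bochner_integral alpha G = 0.

(** The definition of type 2 concerns infinite sequences of variables of variance
    one: the vectors are normalised and carried by an infinite product space. *)
Lemma type2_sample n :
  \int[power alpha n]_x (`|\sum_(i < n) G (tnth x i)| ^+ 2) <=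
  a * n%:R * \int[alpha]_x (`|G x| ^+ 2).
Proof.
have iS := intR_sqr_norm_sum.
set V := \int[alpha]_x (`|G x| ^+ 2).
have V0 : 0 <= V by apply: Rint_ge0 => x; rewrite exprn_ge0.
have [VE|Vneq0] := eqVneq V 0.
  (* vectors of zero variance cannot be normalised, but their sum vanishes *)
  rewrite VE mulr0.
  have : \int[power alpha n]_x (2 ^+ n * \sum_(i < n) `|G (tnth x i)| ^+ 2) = 0.
    have iGi (i : 'I_n) := law_intR (law_tnth alpha i) iG2.
    rewrite RintZ ?Rint_sum//; last exact: intR_sum.
    by rewrite big1 ?mulr0// => i _; rewrite (law_Rint (law_tnth alpha i) iG2).
  move=> <-; apply: Rint_le => //.
    apply: intRZ; apply: intR_sum => i.
    exact: (law_intR (law_tnth alpha i) (f := fun x => `|G x| ^+ 2)).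
  move=> x; have := sqr_norm_sum_le (index_enum 'I_n) (fun i => G (tnth x i));
    by rewrite /index_enum -enumT size_enum_ord.
have Vgt0 : 0 < V by rewrite lt_neqAle eq_sym Vneq0.
have [a0 t2] := type2B.
have [d' [S [P [X [mX lawX]]]]] := infinite_product alpha.
pose c := (Num.sqrt V)^-1.
have c2 : c ^+ 2 = V^-1 by rewrite exprVn sqr_sqrtr.
have mcG : measurable_fun setT ((fun x => c *: G x) : T -> cylindrical B).
  exact: measurable_cylindricalZ.
have lawi := law_coordinate mX lawX.
have sq1 i : (\int[P]_w (`|c *: G (X i w)| ^+ 2)%:E = 1)%E.
  under eq_integral do rewrite normrZ exprMn.
  rewrite (law_ge0_integral (lawi i)
    (f := fun x => (`|c| ^+ 2 * `|G x| ^+ 2)%:E)).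
  - rewrite -RintE; last exact: intRZ.
    by rewrite RintZ// real_normK ?num_real// c2 mulVf.
  - by apply/measurable_EFinP; apply: (@intR_measurable _ _ _ alpha); exact: intRZ.
  - by move=> x; rewrite lee_fin mulr_ge0 ?exprn_ge0.
have bG := square_integrable_bochner.
have bZ i : bochner_integrable P (fun w => c *: G (X i w)).
  split; first exact: (measurableT_comp mcG (mX i)).
  have iN : intR alpha (fun x => `|c| * `|G x|).
    by apply: intRZ; exact: bochner_integrable_norm.
  have := intR_ltyP (law_intR (lawi i) iN).
  by under eq_integral do rewrite -normrZ.
have Z0 i : bochner_integral P (fun w => c *: G (X i w)) = 0.
  apply: bochner_integral_unique => // l dl.
  have il := bochner_integrable_dual sepB bG dl.
  rewrite linear0 -[LHS](mulr0 c) -[in LHS](linear0 l) -G0.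
  rewrite bochner_integral_dual// -(law_Rint (lawi i) il).
  have ilX := law_intR (lawi i) il.
  rewrite -(RintZ c ilX).
  by congr Rintegral; apply/funext => w; rewrite linearZ.
have Z1 i : bochner_variance P (fun w => c *: G (X i w)) = 1%E.
  rewrite /bochner_variance Z0.
  by under eq_integral do rewrite subr0; exact: sq1.
have := t2 _ _ P (fun i w => c *: G (X i w)) (iid_comp mX lawX mcG)
  (fun i => _) Z0 Z1 n.
move=> /(_ ltac:(by move=> i; rewrite sq1 ltry)).
under [X in (_ <= _ * X)%E]eq_bigr do rewrite sq1.
rewrite sumEFin sumr_const card_ord -EFinM.
under eq_integral do rewrite -scaler_sumr normrZ exprMn real_normK ?num_real// c2.
have iSn := iS n.
rewrite (_ : (\int[P]_w _)%E =
    (V^-1 * \int[power alpha n]_x (`|\sum_(i < n) G (tnth x i)| ^+ 2))%:E).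
  by rewrite lee_fin ler_pdivrMl// mulrC.
rewrite -RintZ// RintE; last exact: intRZ.
rewrite -(law_ge0_integral (law_sample mX lawX n)).
- apply: eq_integral => w _; congr ((_ * `|_| ^+ 2)%:E).
  by apply: eq_bigr => i _; rewrite tnth_mktuple.
- apply/measurable_EFinP; apply: (@intR_measurable _ _ _ (power alpha n)).
  exact: intRZ.
- by move=> x; rewrite lee_fin mulr_ge0 ?invr_ge0// exprn_ge0.
Qed.

End Type2.

(** * Small balls for sums of independent vectors *)

Section AlmostEverywhere.
Context {d : measure_display} {T : measurableType d} {R : realType}
  (P : probability T R).

Lemma Rint_eq0_ae (f : T -> R) : intR P f -> (forall x, 0 <= f x) ->
  \int[P]_x f x = 0 -> {ae P, forall x, f x = 0}.
Proof.
move=> fi f0 If; have mf := intR_measurable fi.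
have /(ae_eq_integral_abs P measurableT) : measurable_fun setT (EFin \o f).
  exact/measurable_EFinP.
move=> [+ _]; have -> : (\int[P]_x `|(EFin \o f) x| = 0)%E.
  under eq_integral do rewrite /= ger0_norm//.
  by rewrite -RintE// If.
by move=> /(_ erefl); apply: filterS => x /(_ I) [].
Qed.

Lemma ae_probability1 (A : set T) : measurable A -> {ae P, forall x, A x} ->
  P A = 1%E.
Proof.
move=> mA [N [mN N0 AN]].
have : P (~` A) = 0%E.
  apply: (subset_measure0 _ _ _ N0) => //; first exact: measurableC.
rewrite probability_setC//.
have fA : P A \is a fin_num by exact: fin_num_measure.
by rewrite -(fineK fA) -EFinB => -[PA]; congr EFin; lra.
Qed.

Lemma markov_le (f : T -> R) (m r : R) : intR P f -> (forall x, 0 <= f x) ->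
  \int[P]_x f x <= m -> m < r -> 0 < fine (P [set x | f x <= r]).
Proof.
move=> fi f0 fm mr; have mf := intR_measurable fi.
have r0 : 0 < r by apply: le_lt_trans mr; apply: le_trans fm; exact: Rint_ge0.
have mA : measurable [set x | f x <= r].
  by rewrite -[X in measurable X]setTI; exact: measurable_fun_ler.
have iA := intR_indic P mA.
have : \int[P]_x (1 - \1_[set x | f x <= r] x) <= \int[P]_x (r^-1 * f x).
  apply: Rint_le => [||x]; [by apply: intRB => //; exact: intR_cst|exact: intRZ|].
  rewrite indicE; case: (boolP (x \in _)) => [_|/=].
    by rewrite subrr mulr_ge0// invr_ge0 ltW.
  rewrite notin_setE /= => /negP; rewrite -ltNge => rx.
  by rewrite subr0 ler_pdivlMl// mulr1 ltW.
rewrite (RintB (intR_cst P 1) iA) (Rint_cst P 1) RintZ// Rint_indic// => h.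
have : r^-1 * \int[P]_x f x < 1 by rewrite ltr_pdivrMl// mulr1 (le_lt_trans fm).
lra.
Qed.

End AlmostEverywhere.

Section SmallBall.
Context {R : realType} {B : completeNormedModType R} (sepB : separable B)
  {d : measure_display} {T : measurableType d}.
Variables (alpha : probability T R) (a : R) (G : T -> B).
Hypothesis type2B : type2 B a.
Hypothesis mG : measurable_fun setT (G : T -> cylindrical B).
Hypothesis iG2 : intR alpha (fun x => `|G x| ^+ 2).
Hypothesis G0 : bochner_integral alpha G = 0.

Let V := \int[alpha]_x (`|G x| ^+ 2).
Let S n (x : n.-tuple T) := \sum_(i < n) G (tnth x i).

Lemma variance_ge0 : 0 <= V.
Proof. by apply: Rint_ge0 => x; rewrite exprn_ge0. Qed.

Lemma measurable_sum_ball n (r : R) :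
  measurable [set x | `|S (n := n) x| ^+ 2 <= r].
Proof.
rewrite -[X in measurable X]setTI; apply: measurable_fun_ler => //.
exact: intR_measurable (intR_sqr_norm_sum sepB mG iG2 n).
Qed.

(** Otherwise all the functionals of a norming sequence would vanish almost
    everywhere on the vectors, and so would their norm. *)
Lemma nondegenerate_functional : 0 < V -> exists l : {linear B -> R^o},
  [/\ dual l, forall y, `|l y| <= `|y| & 0 < \int[alpha]_x `|l (G x)|].
Proof.
move=> V0; have [l [dl ln lx]] := norming_sequence sepB.
have bG := square_integrable_bochner sepB mG iG2.
have il n := bochner_integrable_dual sepB bG (dl n).
apply: contrapT => /forallNP none.
have l0 n : {ae alpha, forall x, l n (G x) = 0}.
  have /Rint_eq0_ae : intR alpha (fun x => `|l n (G x)|) by exact: intR_norm.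
  move=> /(_ (fun x => normr_ge0 _)).
  have -> : \int[alpha]_x `|l n (G x)| = 0.
    apply/eqP; rewrite eq_le [X in _ && X]Rint_ge0// andbT leNgt.
    by apply/negP => pos; apply: (none (l n)); split.
  by move=> /(_ erefl); apply: filterS => x /normr0_eq0.
have G_ae0 : {ae alpha, forall x, `|G x| ^+ 2 = 0}.
  apply: filterS (ae_foralln l0) => x lG0.
  apply/eqP; rewrite sqrf_eq0 eq_le normr_ge0 andbT leNgt; apply/negP => Gx.
  have [n] := lx (G x) (`|G x| / 2) (divr_gt0 Gx (ltr0Sn _ 1)).
  by rewrite lG0; lra.
have : V = 0.
  rewrite /V /Rintegral.
  have -> : (\int[alpha]_x (`|G x| ^+ 2)%:E = \int[alpha]_x cst 0 x)%E.
    apply: ae_eq_integral => //.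
      by apply/measurable_EFinP; exact: intR_measurable iG2.
    by apply: filterS G_ae0 => x /= -> _.
  by rewrite integral0.
by move=> VE; rewrite VE ltxx in V0.
Qed.

(** A change of law with bounded density that moves the mean by the order of
    [t]: the density is [1 + t g] with [g] the sign of the functional, centered
    and halved so that [|g| <= 1]. *)
Lemma tilted_mean : 0 < V -> exists (l : {linear B -> R^o}) (v : R),
  [/\ dual l, forall y, `|l y| <= `|y|, 0 < v &
    forall t, 0 <= t <= 1 -> exists (beta : probability T R) (h : T -> R),
      [/\ is_density alpha beta h, forall x, h x <= 1 + t,
        intR beta (fun x => l (G x)) & \int[beta]_x l (G x) = t * v]].
Proof.
move=> V0; have [l [dl ln lpos]] := nondegenerate_functional V0.
have bG := square_integrable_bochner sepB mG iG2.
have il := bochner_integrable_dual sepB bG dl.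
have ml := intR_measurable il.
have lG0 : \int[alpha]_x l (G x) = 0.
  by rewrite -bochner_integral_dual// G0 linear0.
exists l, (\int[alpha]_x `|l (G x)| / 2); split => //; first by rewrite divr_gt0.
move=> t /andP[t0 t1].
pose A := [set x | 0 <= l (G x)].
have mA : measurable A.
  by rewrite -[X in measurable X]setTI; exact: measurable_fun_ler.
pose sg x : R := 2 * \1_A x - 1.
have sgE x : sg x = if 0 <= l (G x) then 1 else -1.
  rewrite /sg indicE; case: ifPn => lx.
    by rewrite mem_set//= mulr1; lra.
  by rewrite memNset /=; [rewrite mulr0 sub0r|exact/negP].
have isg : intR alpha sg.
  by apply: intRB; [apply: intRZ; exact: intR_indic|exact: intR_cst].
pose s := \int[alpha]_x sg x.
have sg_le x : `|sg x| <= 1 by rewrite sgE; case: ifP; rewrite ?normrN normr1.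
have s_le : `|s| <= 1.
  apply: (le_trans (Rint_norm isg)); rewrite -(Rint_cst alpha 1).
  by apply: Rint_le => //; [exact: intR_norm|exact: intR_cst].
pose g x := (sg x - s) / 2.
have g_le x : `|g x| <= 1.
  rewrite /g normrM (@ger0_norm _ 2^-1) ?invr_ge0// ler_pdivrMr// mul1r.
  by rewrite (le_trans (ler_normB _ _))// (_ : 2 = 1 + 1)// lerD.
have isB : intR alpha (fun x => sg x - s) by exact: intRB isg (intR_cst alpha s).
have ig : intR alpha g.
  rewrite (_ : g = fun x => 2^-1 * (sg x - s)).
    exact: intRZ.
  by apply/funext => x; rewrite mulrC.
have Ig : \int[alpha]_x g x = 0.
  rewrite (_ : \int[alpha]_x g x = \int[alpha]_x (2^-1 * (sg x - s))).
    by rewrite RintZ// (RintB isg (intR_cst alpha s)) (Rint_cst alpha s) subrr mulr0.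
  by congr Rintegral; apply/funext => x; rewrite mulrC.
pose h x := 1 + t * g x.
have mh : measurable_fun setT h.
  apply: (@intR_measurable _ _ _ alpha).
  by apply: intRD; [exact: intR_cst|exact: intRZ].
have h0 x : 0 <= h x.
  have := g_le x; rewrite ler_norml => /andP[gN _].
  have : - 1 <= t * g x; last by rewrite /h; lra.
  apply: (@le_trans _ _ (- t)); first by rewrite lerN2.
  by rewrite -mulrN1 ler_wpM2l.
have h_le x : h x <= 1 + t.
  by rewrite lerD2l ler_piMr// (le_trans (ler_norm _)).
have [|beta bh] := density_exists (mu := alpha) mh h0.
  rewrite -RintE; last by apply: intRD; [exact: intR_cst|exact: intRZ].
  by rewrite (RintD (intR_cst alpha 1) (intRZ t ig)) (Rint_cst alpha 1) RintZ//
    Ig mulr0 addr0.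
have ilg : intR alpha (fun x => l (G x) * g x).
  apply: (intR_le _ _ (intR_norm il)).
    by apply: measurable_funM => //; exact: intR_measurable ig.
  by move=> x; rewrite normrM ler_piMr.
have ilh : intR alpha (fun x => l (G x) * h x).
  rewrite (_ : (fun _ => _) = fun x => l (G x) + t * (l (G x) * g x)).
    by apply: intRD => //; exact: intRZ.
  by apply/funext => x; rewrite /h; ring.
exists beta, h; split => //; first exact/(density_intRP bh ml).
rewrite (density_Rint bh); last exact/(density_intRP bh ml).
rewrite (_ : \int[alpha]_x _ = \int[alpha]_x (l (G x) + t * (l (G x) * g x))).
  rewrite RintD ?RintZ//; last exact: intRZ.
  rewrite lG0 add0r; congr (_ * _).
  rewrite (_ : \int[alpha]_x _ =
    \int[alpha]_x (2^-1 * (`|l (G x)| - s * l (G x)))).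
    rewrite RintZ; last by apply: intRB; [exact: intR_norm|exact: intRZ].
    by rewrite (RintB (intR_norm il) (intRZ s il)) RintZ// lG0 mulr0 subr0 mulrC.
  congr Rintegral; apply/funext => x.
  have -> : `|l (G x)| = l (G x) * sg x.
    rewrite sgE; case: ifPn => lx; first by rewrite ger0_norm// mulr1.
    by rewrite ltr0_norm ?mulrN1// ltNge.
  by rewrite /g; field.
by congr Rintegral; apply/funext => x; rewrite /h; ring.
Qed.

Lemma small_ball_pos n (r : R) : a * n%:R * V < r ->
  0 < fine (power alpha n [set x | `|S (n := n) x| ^+ 2 <= r]).
Proof.
move=> Vr; apply: (markov_le _ _ _ Vr).
- exact: intR_sqr_norm_sum.
- by move=> x; rewrite exprn_ge0.
- exact: type2_sample.
Qed.

(** The mean square norm is at most [q = a n V], so that the mean of the excess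
    [(|S|^2 - q)^+] is at most [q] times the probability of the ball, and at most
    [(1 + t) ^+ n] times that under the changed law. There the mean of the sum is
    [n t v] in the direction of [l], whose square is at most the mean square norm. *)
Lemma small_ball_tilt n (t : R) (l : {linear B -> R^o}) (v : R)
    (beta : probability T R) (h : T -> R) :
  (forall y, `|l y| <= `|y|) -> 0 <= t -> is_density alpha beta h ->
  (forall x, h x <= 1 + t) -> intR beta (fun x => l (G x)) ->
  \int[beta]_x l (G x) = t * v ->
  (n%:R * (t * v)) ^+ 2 <= a * n%:R * V *
    (1 + (1 + t) ^+ n *
      fine (power alpha n [set x | `|S (n := n) x| ^+ 2 <= a * n%:R * V])).
Proof.
move=> ln t0 bh h_le ilb lv; set A := [set x | _]; set q := a * n%:R * V.
have mA : measurable A by exact: measurable_sum_ball.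
have q0 : 0 <= q by rewrite !mulr_ge0 ?variance_ge0// ltW//; have [] := type2B.
have iS := intR_sqr_norm_sum sepB mG iG2 n.
have ES := type2_sample sepB type2B mG iG2 G0 n.
pose e x := Num.max (`|S (n := n) x| ^+ 2 - q) 0.
have e0 x : 0 <= e x by rewrite le_max lexx orbT.
have me : measurable_fun setT e.
  apply: measurable_maxr => //; apply: measurable_funB => //.
  exact: intR_measurable iS.
have ie : intR (power alpha n) e.
  apply: (intR_le me _ iS) => x; rewrite ger0_norm// ge_max exprn_ge0// andbT.
  by rewrite gerBl.
have Ee : \int[power alpha n]_x e x <= q * fine (power alpha n A).
  rewrite -Rint_indic// -RintZ; last exact: intR_indic.
  have iSq : intR (power alpha n) (fun x => `|S (n := n) x| ^+ 2 - q).
    by apply: intRB => //; exact: intR_cst.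
  have iqA : intR (power alpha n) (fun x => q * \1_A x).
    by apply: intRZ; exact: intR_indic.
  apply: (@le_trans _ _ (\int[power alpha n]_x
      ((`|S (n := n) x| ^+ 2 - q) + q * \1_A x))).
    apply: Rint_le => //; first exact: intRD.
    move=> x; rewrite /e indicE; case: (boolP (x \in A)) => [|].
      rewrite inE /A /= mulr1 subrK ge_max exprn_ge0// andbT.
      by rewrite gerBl.
    rewrite notin_setE /A /= => /negP; rewrite -ltNge => qx.
    by rewrite mulr0 addr0 ge_max lexx subr_ge0 ltW.
  rewrite RintD// (RintB iS (intR_cst _ q)) (Rint_cst _ q).
  by rewrite gerDr subr_le0.
have Hd := power_density n bh.
have [mH H0 _] := Hd.
have H_le (x : n.-tuple T) : \prod_(i < n) h (tnth x i) <= (1 + t) ^+ n.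
  rewrite -[X in _ ^+ X](card_ord n) -prodr_const; apply: ler_prod => i _.
  by have [_ -> _] := bh; rewrite h_le.
have ieH : intR (power alpha n) (fun x => e x * \prod_(i < n) h (tnth x i)).
  apply: (@intR_le _ _ _ _ _ (fun x => (1 + t) ^+ n * e x)).
  - exact: measurable_funM.
  - by move=> x; rewrite ger0_norm ?mulr_ge0// mulrC ler_wpM2r.
  - exact: intRZ.
have ieb : intR (power beta n) e by exact/(density_intRP Hd me).
pose lS (x : n.-tuple T) := \sum_(i < n) l (G (tnth x i)).
have ilS : intR (power beta n) lS.
  by apply: intR_sum => i; exact: (law_intR (law_tnth beta i) ilb).
have ElS : \int[power beta n]_x lS x = n%:R * (t * v).
  rewrite Rint_sum; last by move=> i; exact: (law_intR (law_tnth beta i) ilb).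
  under eq_bigr => i _ do rewrite (law_Rint (law_tnth beta i) ilb) lv.
  by rewrite sumr_const card_ord mulr_natl.
set r := n%:R * (t * v).
have : \int[power beta n]_x (2 * r * lS x - r ^+ 2) <=
       \int[power beta n]_x (q + e x).
  apply: Rint_le => [||x].
  - by apply: intRB; [exact: intRZ|exact: intR_cst].
  - by apply: intRD => //; exact: intR_cst.
  apply: (@le_trans _ _ (`|S x| ^+ 2)); last first.
    by rewrite -lerBlDl /e le_max lexx.
  have lSE : lS x = l (S x) by rewrite /S linear_sum.
  have : lS x ^+ 2 <= `|S x| ^+ 2.
    by rewrite -[lS x ^+ 2]real_normK ?num_real// lSE ler_pXn2r ?nnegrE.
  have := sqr_ge0 (lS x - r); rewrite sqrrB.
  by move: (`|S x| ^+ 2) => y; lra.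
rewrite (RintB (intRZ (2 * r) ilS) (intR_cst _ (r ^+ 2))) (Rint_cst _ (r ^+ 2)).
rewrite RintZ// ElS -/r (RintD (intR_cst _ q) ieb) (Rint_cst _ q).
rewrite (density_Rint Hd)// => h1.
have h2 : \int[power alpha n]_x (e x * \prod_(i < n) h (tnth x i)) <=
    (1 + t) ^+ n * (q * fine (power alpha n A)).
  apply: (@le_trans _ _ (\int[power alpha n]_x ((1 + t) ^+ n * e x))).
    apply: Rint_le => //; first exact: intRZ.
    by move=> x; rewrite mulrC ler_wpM2r.
  by rewrite RintZ// ler_wpM2l// exprn_ge0// addr_ge0.
rewrite mulrDr mulr1 mulrCA; lra.
Qed.

(** The parameter [t = C / sqrt n] is such that the shifted mean has square
    [2 a n V], twice the bound on the mean square: one half of it has to come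
    from the ball, whose probability is thus at least [(1 + t) ^- n]. *)
Lemma small_ball : exists2 C : R, 0 <= C & \forall n \near \oo,
  expR (- (C * Num.sqrt n%:R)) <=
  fine (power alpha n [set x | `|S (n := n) x| ^+ 2 <= a * n%:R * V]).
Proof.
have a0 : 0 < a by have [] := type2B.
have [VE|Vneq0] := eqVneq V 0.
  exists 0 => //; near=> n; rewrite mul0r oppr0 expR0.
  rewrite VE mulr0 (@ae_probability1 _ _ _ (power alpha n))//.
    exact: measurable_sum_ball.
  have := type2_sample sepB type2B mG iG2 G0 n; rewrite -/V VE mulr0 => le0.
  have := Rint_eq0_ae (intR_sqr_norm_sum sepB mG iG2 n).
  move=> /(_ (fun x => exprn_ge0 _ (normr_ge0 _))).
  have -> : \int[power alpha n]_x (`|\sum_(i < n) G (tnth x i)| ^+ 2) = 0.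
    apply/eqP; rewrite eq_le le0 andTb.
    by apply: Rint_ge0 => x; rewrite exprn_ge0.
  by move=> /(_ erefl); apply: filterS => x /= xE; rewrite /S xE.
have V0 : 0 < V by rewrite lt_neqAle eq_sym Vneq0 variance_ge0.
have [l [v [dl ln v0 lt]]] := tilted_mean V0.
pose C := Num.sqrt (2 * a * V) / v.
have C0 : 0 <= C by rewrite divr_ge0// ltW.
exists C => //; near=> n.
have n0 : (0 : R) < n%:R by rewrite ltr0n; near: n; exact: nbhs_infty_gt.
have sn0 : 0 < Num.sqrt n%:R :> R by rewrite sqrtr_gt0.
set t := C / Num.sqrt n%:R.
have t0 : 0 <= t by rewrite divr_ge0// ltW.
have t1 : t <= 1.
  rewrite ler_pdivrMr// mul1r -[leLHS]ger0_norm// -sqrtr_sqr ler_wsqrtr//.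
  by near: n; exact: nbhs_infty_ger.
have [|beta [h [bh h_le ilb lv]]] := lt t; first by rewrite t0 t1.
have := small_ball_tilt n ln t0 bh h_le ilb lv.
set p := fine _.
have p0 : 0 <= p by exact: fine_ge0.
have sq2 : Num.sqrt n%:R ^+ 2 = n%:R :> R by rewrite sqr_sqrtr// ltW.
have -> : (n%:R * (t * v)) ^+ 2 = 2 * (a * n%:R * V).
  have Cv : (C * v) ^+ 2 = 2 * a * V.
    by rewrite /C divfK ?gt_eqF// sqr_sqrtr// !mulr_ge0// ltW.
  rewrite /t -{1}sq2.
  transitivity (Num.sqrt n%:R ^+ 2 * (C * v) ^+ 2); last by rewrite Cv sq2; ring.
  by field; rewrite gt_eqF.
have q0 : 0 < a * n%:R * V by rewrite !mulr_gt0.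
rewrite [leLHS]mulrC ler_pM2l// => le2.
have e1 : (1 + t) ^+ n <= expR (C * Num.sqrt n%:R).
  have -> : C * Num.sqrt n%:R = n%:R * t.
    by rewrite /t -{2}sq2; field; rewrite gt_eqF.
  rewrite expRM_natl; apply: lerXn2r; rewrite ?nnegrE ?expR_ge0 ?addr_ge0//.
  exact: expR_ge1Dx.
rewrite expRN -[leLHS]mulr1 ler_pdivrMl ?expR_gt0//.
apply: (@le_trans _ _ ((1 + t) ^+ n * p)); first by move: le2; lra.
by rewrite ler_wpM2r.
Unshelve. all: by end_near. Qed.

End SmallBall.

(** * Exponential tilting *)

Section LinearCombination.
Context {R : realType} {B : normedModType R}.

Lemma linear_comb (l m : {linear B -> R^o}) (t : R) :
  exists k : {linear B -> R^o}, forall x, k x = l x + t * m x.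
Proof.
pose f x : R^o := l x + t * m x.
have lf : linear f.
  by move=> c x y; rewrite /f !linearP /= /GRing.scale /=; ring.
pose k : {linear B -> R^o} := HB.pack f (GRing.isLinear.Build _ _ _ _ _ lf).
by exists k.
Qed.

Lemma dual_comb (l m k : {linear B -> R^o}) (t : R) : dual l -> dual m ->
  (forall x, k x = l x + t * m x) -> dual k.
Proof.
move=> dl dm kE.
have [L _ lL] := dual_bounded dl; have [M _ mM] := dual_bounded dm.
apply: (@dual_of_bound _ _ _ (L + `|t| * M)) => x; rewrite kE mulrDl.
by rewrite (le_trans (ler_normD _ _))// lerD// normrM -mulrA ler_wpM2l.
Qed.

Lemma dual_norm_le (f : B -> R) (M : R) : 0 <= M ->
  (forall x, `|f x| <= M * `|x|) -> dual_norm f <= M.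
Proof.
move=> M0 fM; apply: ge_sup.
  by exists `|f 0|; exists 0 => //=; rewrite normr0.
by move=> _ [x /= x1 <-]; rewrite (le_trans (fM x))// ler_piMr.
Qed.

Lemma zero_functional : exists2 o : {linear B -> R^o}, dual o & forall x, o x = 0.
Proof.
have lf : linear ((fun=> 0) : B -> R^o).
  by move=> c x y; rewrite scaler0 addr0.
pose k : {linear B -> R^o} :=
  HB.pack ((fun=> 0) : B -> R^o) (GRing.isLinear.Build _ _ _ _ _ lf).
exists k => //; apply: (@dual_of_bound _ _ _ 0) => x.
by rewrite mul0r normr0.
Qed.

End LinearCombination.

Section ExpBounds.
Context {R : realType}.
Implicit Types x u s t : R.

Lemma expR_sqr_le x : 0 <= x -> x ^+ 2 <= 2 * expR x.
Proof. by move=> x0; have := expR_ge1Dxn 1 x0; rewrite /= !factS fact0 /=; lra. Qed.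

Lemma expR_norm_le u : expR `|u| <= expR u + expR (- u).
Proof.
have [u0|u0] := leP 0 u; first by rewrite ger0_norm// lerDl expR_ge0.
by rewrite ltr0_norm// lerDr expR_ge0.
Qed.

(** For both signs of [x] this follows from [1 + x <= exp x] at [x] and at [- x]. *)
Lemma expR_le_quadratic x : expR x <= 1 + x + x ^+ 2 * expR `|x|.
Proof.
have e0 := expR_gt0 x.
have eN : expR x * expR (- x) = 1 by rewrite -expRD subrr expR0.
have h1 := expR_ge1Dx x; have h2 := expR_ge1Dx (- x).
have h3 : expR x * (1 - x) <= expR x * expR (- x) by rewrite ler_pM2l.
rewrite eN in h3.
have [x0|x0] := leP 0 x.
  rewrite ger0_norm//.
  have h4 : expR x - 1 <= x * expR x by lra.
  have h5 : x * (expR x - 1) <= x * (x * expR x) by rewrite ler_wpM2l.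
  by rewrite expr2 -mulrA; lra.
rewrite ltr0_norm//.
have h4 : 1 <= expR (- x) by lra.
have h5 : x ^+ 2 <= x ^+ 2 * expR (- x) by rewrite ler_peMr// sqr_ge0.
have h6 : expR x - 1 - x <= x ^+ 2; last by lra.
have h7 : expR x - 1 <= x * expR x by lra.
have h8 : - x * (1 - expR x) <= - x * (- x).
  by rewrite ler_wpM2l//; lra.
lra.
Qed.

(** [u ^ 2] is absorbed by an arbitrarily small exponential. *)
Lemma expR_le_affine (r t u : R) : 0 < r -> 0 <= t <= r / 2 ->
  expR (t * u) <= 1 + t * u + t ^+ 2 * (8 / r ^+ 2 * expR (r * `|u|)).
Proof.
move=> r0 /andP[t0 tr]; apply: (le_trans (expR_le_quadratic _)).
rewrite lerD2l exprMn -[t ^+ 2 * u ^+ 2 * _]mulrA ler_wpM2l ?sqr_ge0//.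
have n0 : 0 <= `|u| by [].
have h1 : expR `|t * u| <= expR (r / 2 * `|u|).
  by rewrite ler_expR normrM (ger0_norm t0) ler_wpM2r.
have h2 : u ^+ 2 <= 8 / r ^+ 2 * expR (r / 2 * `|u|).
  have := @expR_sqr_le (r / 2 * `|u|) ltac:(by rewrite mulr_ge0// ltW// divr_gt0).
  rewrite exprMn real_normK ?num_real// => h.
  rewrite -mulrA -ler_pdivrMl// ler_pdivlMl ?exprn_gt0//.
  by move: h; rewrite expr_div_n; lra.
have -> : expR (r * `|u|) = expR (r / 2 * `|u|) * expR (r / 2 * `|u|).
  by rewrite -expRD -mulrDl -splitr.
by rewrite mulrA; apply: ler_pM => //; exact: sqr_ge0.
Qed.

(** Either [u] is small compared to [y] and the second exponential dominates, or
    [y] is of the order of [u] and a slightly larger multiple of [u] absorbs the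
    square. *)
Lemma sqr_expR_le (s dl : R) : 0 < s -> 0 < dl -> exists2 C : R, 0 <= C &
  forall y u, 0 <= y ->
    y ^+ 2 * expR u <= C * (expR ((1 + dl) * u) + expR (s * y)).
Proof.
move=> s0 dl0.
have a1 : 0 <= 8 / s ^+ 2 by rewrite divr_ge0// exprn_ge0// ltW.
have a2 : 0 <= 8 / (s ^+ 2 * dl ^+ 2).
  by rewrite divr_ge0// mulr_ge0// exprn_ge0// ltW.
exists (8 / s ^+ 2 + 8 / (s ^+ 2 * dl ^+ 2)); first exact: addr_ge0.
move=> y u y0.
have [le|lt] := leP u (s / 2 * y).
- apply: (@le_trans _ _ (8 / s ^+ 2 * expR (s * y))).
    have -> : expR (s * y) = expR (s / 2 * y) * expR (s / 2 * y).
      by rewrite -expRD -mulrDl -splitr.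
    rewrite mulrA; apply: ler_pM; rewrite ?sqr_ge0 ?expR_ge0 ?ler_expR//.
    have := @expR_sqr_le (s / 2 * y) ltac:(by rewrite mulr_ge0// ltW// divr_gt0).
    rewrite exprMn expr_div_n => h.
    rewrite -mulrA -ler_pdivrMl// ler_pdivlMl ?exprn_gt0//; lra.
  apply: ler_pM; rewrite ?expR_ge0// ?lerDl// lerDr expR_ge0//.
- have u0 : 0 < u by apply: le_lt_trans lt; rewrite mulr_ge0// ltW// divr_gt0.
  apply: (@le_trans _ _ (8 / (s ^+ 2 * dl ^+ 2) * expR ((1 + dl) * u))).
    have -> : expR ((1 + dl) * u) = expR (dl * u) * expR u.
      by rewrite -expRD; congr expR; ring.
    rewrite mulrA ler_wpM2r ?expR_ge0//.
    have := @expR_sqr_le (dl * u) ltac:(by rewrite mulr_ge0// ltW).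
    rewrite exprMn => h.
    have hy : y ^+ 2 <= (2 / s * u) ^+ 2.
      have s20 : 0 <= 2 / s * u by rewrite mulr_ge0 ?(ltW u0)// divr_ge0// ltW.
      rewrite ler_pXn2r ?nnegrE//.
      have := ltW lt; rewrite -ler_pdivlMl ?divr_gt0//.
      by move=> /le_trans; apply; rewrite invf_div.
    apply: (le_trans hy).
    rewrite -ler_pdivrMl ?divr_gt0 ?mulr_gt0 ?exprn_gt0//.
    apply: le_trans (_ : 2^-1 * (dl ^+ 2 * u ^+ 2) <= _); last lra.
    by rewrite le_eqVlt; apply/orP; left; apply/eqP; field; rewrite !gt_eqF.
  apply: ler_pM; rewrite ?expR_ge0// ?lerDr// lerDl expR_ge0//.
Qed.

End ExpBounds.

Section ExponentialTilt.
Context {R : realType} {B : completeNormedModType R} (sepB : separable B)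
  {d : measure_display} {T : measurableType d}.
Variables (alpha : probability T R) (F : T -> B) (K : set B).
Hypothesis mF : measurable_fun setT (F : T -> cylindrical B).
Hypothesis exp_moment : exists2 s : R, 0 < s &
  (\int[alpha]_x (expR (s * `|F x|))%:E < +oo)%E.
Hypothesis dom_open : dual_open (dom_Lambda alpha F).

Lemma Zlaplace_gt0 (l : {linear B -> R^o}) : dual l ->
  (0 < Zlaplace alpha F l)%E.
Proof.
move=> dl; have ml := measurable_dual dl mF.
have me : measurable_fun setT (fun x => expR (l (F x))).
  by apply: measurableT_comp ml.
rewrite lt_neqAle integral_ge0 ?andbT; last by move=> x _; rewrite lee_fin expR_ge0.
apply/eqP => Z0.
have ie : intR alpha (fun x => expR (l (F x))).
  apply: intR_lty => //.
  by have := Z0; rewrite /Zlaplace => <-; exact: ltry.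
have := Rint_eq0_ae ie (fun x => expR_ge0 _).
rewrite /Rintegral -[X in fine X]Z0 /= => /(_ erefl).
move=> [N [mN N0 AN]].
have : alpha setT = 0%E.
  apply: (subset_measure0 _ _ _ N0) => // x _; apply: AN => /=.
  by apply/eqP; rewrite expR_eq0.
rewrite probability_setT => /eqP; by rewrite onee_eq0.
Qed.

Lemma dom_LambdaP (l : {linear B -> R^o}) : dual l ->
  dom_Lambda alpha F l <-> intR alpha (fun x => expR (l (F x))).
Proof.
move=> dl; have Z0 := Zlaplace_gt0 dl.
have ml := measurable_dual dl mF.
have me : measurable_fun setT (fun x => expR (l (F x))).
  by apply: measurableT_comp ml.
split=> [[_]|ie].
  move=> Ly; apply: intR_lty => //.
  move: Ly Z0; rewrite /Lambda -/(Zlaplace alpha F l).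
  by case: (Zlaplace alpha F l) => // r _ _; exact: ltry.
split => //; rewrite /Lambda /Zlaplace -RintE//.
have : (0 < (\int[alpha]_x expR (l (F x)))%:E)%E by rewrite RintE.
by rewrite lte_fin => p; rewrite lne_EFin// ltry.
Qed.

Lemma LambdaE (l : {linear B -> R^o}) : dual l ->
  intR alpha (fun x => expR (l (F x))) ->
  0 < \int[alpha]_x expR (l (F x)) /\
  Lambda alpha F l = (ln (\int[alpha]_x expR (l (F x))))%:E.
Proof.
move=> dl ie; have := Zlaplace_gt0 dl.
rewrite /Lambda /Zlaplace -RintE// lte_fin => p.
by split => //; rewrite lne_EFin.
Qed.

(** Tilts near [l] keep finite exponential moments: this is the room needed for
    the second moment of the norm and for the second order expansion below. *)
Lemma dom_Lambda_line (l m : {linear B -> R^o}) :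
  dual l -> dual m -> dom_Lambda alpha F l ->
  exists2 rho : R, 0 < rho & forall t, `|t| <= rho ->
    intR alpha (fun x => expR (l (F x) + t * m (F x))).
Proof.
move=> dl dm Ll; have [e e0 he] := dom_open Ll.
have [M M0 mM] := dual_bounded dm.
exists (e / 2 / M); first by rewrite !divr_gt0.
move=> t tr; have [k kE] := linear_comb l m t.
have dk := dual_comb dl dm kE.
rewrite (_ : (fun _ => _) = (fun x => expR (k (F x)))); last first.
  by apply/funext => x; rewrite kE.
apply/(dom_LambdaP dk); apply: he => //.
apply: (@le_lt_trans _ _ (`|t| * M)).
  apply: dual_norm_le; first by rewrite mulr_ge0// ltW.
  by move=> x; rewrite kE addrAC subrr add0r normrM -mulrA ler_wpM2l.
apply: (@le_lt_trans _ _ (e / 2)); first by rewrite -ler_pdivlMr.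
lra.
Qed.

Section Tilt.
Variables (ls : {linear B -> R^o}) (astar : probability T R).
Hypothesis dls : dual ls.
Hypothesis dom_ls : dom_Lambda alpha F ls.
Let z := \int[alpha]_x expR (ls (F x)).
Hypothesis tilt : is_density alpha astar (fun x => expR (ls (F x)) / z).

Lemma tilt_mass_gt0 : 0 < z.
Proof. by have [] := LambdaE dls ((dom_LambdaP dls).1 dom_ls). Qed.

Lemma tilt_intR (f : T -> R) : measurable_fun setT f ->
  intR astar f <-> intR alpha (fun x => f x * expR (ls (F x))).
Proof.
move=> mf; rewrite (density_intRP tilt mf); split=> h.
  rewrite (_ : (fun _ => _) = fun x => z * (f x * (expR (ls (F x)) / z))).
    exact: intRZ.
  by apply/funext => x; field; rewrite gt_eqF ?tilt_mass_gt0.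
rewrite (_ : (fun _ => _) = fun x => z^-1 * (f x * expR (ls (F x)))).
  exact: intRZ.
by apply/funext => x; field; rewrite gt_eqF ?tilt_mass_gt0.
Qed.

Lemma tilt_square_integrable : intR astar (fun x => `|F x| ^+ 2).
Proof.
have mN : measurable_fun setT (fun x => `|F x|).
  exact: measurable_cylindrical_norm.
have mls := measurable_dual dls mF.
apply/tilt_intR; first exact: measurable_funX.
have [s s0 es] := exp_moment.
have [dl dl0 line] := dom_Lambda_line dls dls dom_ls.
have [C C0 hC] := sqr_expR_le s0 dl0.
apply: (@intR_le _ _ _ _ _ (fun x => C * (expR ((1 + dl) * ls (F x)) +
   expR (s * `|F x|)))).
- apply: measurable_funM; first exact: measurable_funX.
  exact: measurableT_comp mls.
- move=> x; rewrite ger0_norm ?mulr_ge0 ?exprn_ge0 ?expR_ge0//.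
  exact: hC.
- apply: intRZ; apply: intRD.
    rewrite (_ : (fun _ => _) = fun x => expR (ls (F x) + dl * ls (F x))).
      by apply: line; rewrite gtr0_norm.
    by apply/funext => x; rewrite mulrDl mul1r.
  apply: intR_lty => //.
  by apply: measurableT_comp => //; exact: measurable_funM.
Qed.

Let bF := square_integrable_bochner sepB mF tilt_square_integrable.
Let m := bochner_integral astar F.

(** The log-Laplace transform is differentiable at [ls], with gradient the
    mean of the tilted law. *)
Lemma Lambda_quadratic (mu : {linear B -> R^o}) : dual mu ->
  exists rho C : R, [/\ 0 < rho, 0 <= C & forall t, 0 <= t <= rho ->
    forall k : {linear B -> R^o}, (forall x, k x = ls x + t * mu x) ->
      (Lambda alpha F k <= Lambda alpha F ls + (t * mu m + t ^+ 2 * C)%:E)%E].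
Proof.
move=> dmu; have z0 := tilt_mass_gt0.
have mmu := measurable_dual dmu mF; have mls := measurable_dual dls mF.
have [r r0 line] := dom_Lambda_line dls dmu dom_ls.
have ieb : intR astar (fun x => expR (r * `|mu (F x)|)).
  have mme : measurable_fun setT (fun x => expR (r * `|mu (F x)|)).
    apply: measurableT_comp => //; apply: measurable_funM => //.
    exact: measurableT_comp mmu.
  apply/tilt_intR => //.
  apply: (@intR_le _ _ _ _ _ (fun x => expR (ls (F x) + r * mu (F x)) +
    expR (ls (F x) + (- r) * mu (F x)))).
  - apply: measurable_funM => //; exact: measurableT_comp mls.
  - move=> x; rewrite ger0_norm ?mulr_ge0 ?expR_ge0// !expRD -mulrDr mulrC.
    rewrite ler_wpM2l ?expR_ge0// mulNr.
    by have := expR_norm_le (r * mu (F x)); rewrite normrM (gtr0_norm r0).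
  - by apply: intRD; apply: line; rewrite ?normrN gtr0_norm.
pose C := \int[astar]_x (8 / r ^+ 2 * expR (r * `|mu (F x)|)).
exists (r / 2), C; split; first by rewrite divr_gt0.
  by apply: Rint_ge0 => x; rewrite mulr_ge0 ?expR_ge0// divr_ge0// exprn_ge0// ltW.
move=> t /andP[t0 tr] k kE.
have dk := dual_comb dls dmu kE.
have iek : intR alpha (fun x => expR (k (F x))).
  rewrite (_ : (fun _ => _) = fun x => expR (ls (F x) + t * mu (F x))).
    by apply: line; rewrite ger0_norm//; lra.
  by apply/funext => x; rewrite kE.
have [zk0 ->] := LambdaE dk iek.
have [_ ->] := LambdaE dls ((dom_LambdaP dls).1 dom_ls).
rewrite -/z -EFinD lee_fin.
have iet : intR astar (fun x => expR (t * mu (F x))).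
  apply/tilt_intR.
    by apply: measurableT_comp => //; exact: measurable_funM.
  rewrite (_ : (fun _ => _) = fun x => expR (k (F x)))//.
  by apply/funext => x; rewrite kE expRD mulrC.
have Ek : \int[alpha]_x expR (k (F x)) = z * \int[astar]_x expR (t * mu (F x)).
  rewrite (density_Rint tilt)// -RintZ; last first.
    apply/(density_intRP tilt) => //.
    exact: intR_measurable iet.
  congr Rintegral; apply/funext => x; rewrite kE expRD.
  by field; rewrite gt_eqF.
have imu := bochner_integrable_dual sepB bF dmu.
have iq : intR astar (fun x => 8 / r ^+ 2 * expR (r * `|mu (F x)|)).
  exact: intRZ.
have le1 : \int[astar]_x expR (t * mu (F x)) <= 1 + (t * mu m + t ^+ 2 * C).
  rewrite addrA bochner_integral_dual// -(RintZ t imu) -[1](Rint_cst astar).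
  rewrite -(RintD (intR_cst astar 1) (intRZ t imu)).
  rewrite -(RintZ (t ^+ 2) iq).
  have i1 : intR astar (fun x => cst 1 x + t * mu (F x)).
    exact: intRD (intR_cst astar 1) (intRZ t imu).
  rewrite -(RintD i1 (intRZ (t ^+ 2) iq)).
  apply: Rint_le => //; first exact: intRD i1 (intRZ (t ^+ 2) iq).
  by move=> x; apply: expR_le_affine => //; rewrite t0.
have p0 : 0 < \int[astar]_x expR (t * mu (F x)).
  by move: zk0; rewrite Ek pmulr_rgt0.
rewrite Ek lnM ?posrE// lerD2l.
have h : -1 < \int[astar]_x expR (t * mu (F x)) - 1 by lra.
have := le_ln1Dx h; rewrite addrC subrK => /le_trans; apply.
lra.
Qed.

Hypothesis K0 : K !=set0.
Hypothesis closedK : closed K.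
Hypothesis convexK : convex_set K.
Hypothesis HKmin : forall l, dual l ->
  (HK_objective alpha F K ls <= HK_objective alpha F K l)%E.
Variable sigma : R.
Hypothesis sigmaE : ereal_inf [set (ls y : R)%:E | y in K] = sigma%:E.

(** Optimality of [ls] against the functionals [ls + t mu]; the constant [c] is
    any lower bound over [K] of the perturbed functional. *)
Lemma first_order (mu : {linear B -> R^o}) : dual mu ->
  exists rho C : R, [/\ 0 < rho, 0 <= C & forall t c, 0 <= t <= rho ->
    (forall y, K y -> c <= ls y + t * mu y) ->
    c <= sigma + t * mu m + t ^+ 2 * C].
Proof.
move=> dmu; have [rho [C [r0 C0 hC]]] := Lambda_quadratic dmu.
exists rho, C; split => // t c tr hc.
have [k kE] := linear_comb ls mu t.
have dk := dual_comb dls dmu kE.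
have := HKmin dk; rewrite /HK_objective sigmaE.
have [_ LE] := LambdaE dls ((dom_LambdaP dls).1 dom_ls).
have := hC t tr k kE; rewrite LE -EFinD => Lk.
have ck : (c%:E <= ereal_inf [set (k y : R)%:E | y in K])%E.
  by apply: le_ereal_inf_tmp => _ [y Ky <-]; rewrite lee_fin kE hc.
move=> h.
have : ((ln z)%:E - sigma%:E <= (ln z + (t * mu m + t ^+ 2 * C))%:E - c%:E)%E.
  by apply: (le_trans h); apply: leeB.
by rewrite -!EFinB lee_fin; lra.
Qed.

Lemma small_quadratic (x C rho : R) : 0 < rho -> 0 <= C ->
  (forall t, 0 <= t <= rho -> t * x <= t ^+ 2 * C) -> x <= 0.
Proof.
move=> r0 C0 h; rewrite leNgt; apply/negP => x0.
pose t := Num.min rho (x / (2 * (C + 1))).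
have t0 : 0 < t by rewrite lt_min r0 divr_gt0// mulr_gt0// ltr_wpDl.
have := h t; rewrite (ltW t0) ge_min lexx => /(_ isT).
rewrite expr2 -mulrA ler_pM2l//.
have : t <= x / (2 * (C + 1)) by rewrite ge_min lexx orbT.
rewrite ler_pdivlMr; last by rewrite mulr_gt0// ltr_wpDl.
have : 0 <= t * C by rewrite mulr_ge0// ltW.
lra.
Qed.

(** A functional strictly separating the mean from [K] would be a direction of
    descent of the dual problem. *)
Lemma tilt_mean_in : K m.
Proof.
apply: contrapT => mK.
have /open_nbhs_nbhs/nbhs_ballP[r /= r0 rK] : open_nbhs m (~` K).
  by split => //; exact: closed_openC.
have rk k : K k -> r <= `|k - m|.
  move=> Kk; rewrite leNgt; apply/negP => kr.
  by apply: (rK k) => //; rewrite -ball_normE /= distrC.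
have [mu [dmu _ muK]] := separation K0 convexK rk.
have [rho [C [rho0 C0 fo]]] := first_order dmu.
suff : r <= 0 by rewrite leNgt r0.
apply: (small_quadratic rho0 C0) => t /andP[t0 tr].
have := fo t (sigma + t * (mu m + r)); rewrite t0 tr => /(_ isT).
have h : forall y, K y -> sigma + t * (mu m + r) <= ls y + t * mu y.
  move=> y Ky; apply: lerD; last by rewrite ler_wpM2l// muK.
  by rewrite -lee_fin -sigmaE; apply: ereal_inf_lbound; exists y.
by move=> /(_ h); lra.
Qed.

(** Optimality against the multiples [(1 - t) ls]. *)
Lemma tilt_mean_minimal y : K y -> ls m <= ls y.
Proof.
move=> Ky; apply: (@le_trans _ _ sigma); last first.
  by rewrite -lee_fin -sigmaE; apply: ereal_inf_lbound; exists y.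
have [lo dlo oE] := @zero_functional R B.
have [k kE] := linear_comb lo ls (-1).
have kN x : k x = - ls x by rewrite kE oE add0r mulN1r.
have dk := dual_comb dlo dls kE.
have [rho [C [rho0 C0 fo]]] := first_order dk.
rewrite -subr_le0; apply: (@small_quadratic _ C (Num.min rho 1)) => //.
  by rewrite lt_min rho0 ltr01.
move=> t; rewrite le_min => /and3P[t0 tr t1].
have := fo t ((1 - t) * sigma); rewrite t0 tr => /(_ isT).
have h : forall y, K y -> (1 - t) * sigma <= ls y + t * k y.
  move=> y' Ky'; rewrite kN.
  have : sigma <= ls y'.
    by rewrite -lee_fin -sigmaE; apply: ereal_inf_lbound; exists y'.
  have t1' : 0 <= 1 - t by lra.
  by move=> /(ler_wpM2l t1'); lra.
by move=> /(_ h); rewrite kN; lra.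
Qed.

End Tilt.

(** The law minimising the relative entropy is the tilt of [alpha] by the
    minimiser of the dual problem: optimality of the latter says that the tilted
    mean lies in [K], on the face exposed by the functional. *)
Lemma exponential_projection : K !=set0 -> closed K -> convex_set K ->
  hypothesis_HK alpha F K ->
  exists (ls : {linear B -> R^o}) (z : R) (astar : probability T R),
  [/\ dual ls, 0 < z, is_density alpha astar (fun x => expR (ls (F x)) / z),
      intR astar (fun x => `|F x| ^+ 2) &
      K (bochner_integral astar F) /\
      forall y, K y -> ls (bochner_integral astar F) <= ls y].
Proof.
move=> K0 closedK convexK [ls dls HKmin].
have [lo dlo oE] := @zero_functional R B.
have obj0 : HK_objective alpha F K lo = 0%E.
  rewrite /HK_objective /Lambda /Zlaplace.
  under eq_integral do rewrite oE expR0.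
  rewrite integral_cst// [X in (1 * X)%E](_ : _ = 1%E); last exact: probability_setT.
  rewrite mule1 lne1 add0e (_ : [set _ | _ in _] = [set 0%E]) ?ereal_inf1 ?oppe0//.
  have [y0 Ky0] := K0.
  apply/seteqP; split=> [_ [y _ <-]|_ ->]; first by rewrite oE.
  by exists y0; rewrite ?oE.
have := HKmin lo dlo; rewrite obj0 /HK_objective.
set inf_K := ereal_inf _.
have inf_lt : (inf_K < +oo)%E.
  have [y0 Ky0] := K0; apply: (@le_lt_trans _ _ (ls y0)%:E); last exact: ltry.
  by apply: ereal_inf_lbound; exists y0.
have LN : Lambda alpha F ls != -oo%E.
  rewrite /Lambda; have := Zlaplace_gt0 dls.
  by case: (Zlaplace alpha F ls) => // r r0; rewrite lne_EFin.
move=> obj_le.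
have Ly : (Lambda alpha F ls < +oo)%E.
  rewrite ltey; apply/eqP => LE; move: obj_le; rewrite LE.
  by move: inf_lt; case: inf_K.
have inf_fin : inf_K \is a fin_num.
  rewrite fin_numE -ltey inf_lt andbT; apply/eqP => iE; move: obj_le.
  by rewrite iE; move: LN; case: (Lambda alpha F ls).
have dom_ls : dom_Lambda alpha F ls by [].
have ie := (dom_LambdaP dls).1 dom_ls.
have [z0 _] := LambdaE dls ie.
pose z := \int[alpha]_x expR (ls (F x)).
have ih : intR alpha (fun x => expR (ls (F x)) / z).
  rewrite (_ : (fun _ => _) = fun x => z^-1 * expR (ls (F x))); first exact: intRZ.
  by apply/funext => x; rewrite mulrC.
have [x||astar tilt] := @density_exists _ _ _ alpha _ (intR_measurable ih).
- by rewrite divr_ge0 ?expR_ge0// ltW.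
- rewrite -RintE// (_ : Rintegral _ _ _ = \int[alpha]_x (z^-1 * expR (ls (F x)))).
    by rewrite RintZ// mulVf// gt_eqF.
  by congr Rintegral; apply/funext => x; rewrite mulrC.
have sE : ereal_inf [set (ls y : R)%:E | y in K] = (fine inf_K)%:E by rewrite fineK.
exists ls, z, astar; split => //.
- exact: tilt_square_integrable tilt.
- split; first exact: (tilt_mean_in dls dom_ls tilt K0 closedK convexK HKmin sE).
  exact: (tilt_mean_minimal dls dom_ls tilt HKmin sE).
Qed.

End ExponentialTilt.

(** * Relative entropy and the I-projection *)

Section Gibbs.
Context {d : measure_display} {T : measurableType d} {R : realType}.

Lemma Rint_le_ae (P : probability T R) (f g : T -> R) : intR P f -> intR P g ->
  {ae P, forall x, f x <= g x} -> \int[P]_x f x <= \int[P]_x g x.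
Proof.
move=> fi gi fg; pose h x := Num.min (f x) (g x).
have mf := intR_measurable fi; have mg := intR_measurable gi.
have mh : measurable_fun setT h by exact: measurable_minr.
have hi : intR P h.
  apply: (@intR_le _ _ _ _ _ (fun x => `|f x| + `|g x|)) => //.
    move=> x; rewrite /h minEle; case: ifP => _; first by rewrite lerDl.
    by rewrite lerDr.
  by apply: intRD; exact: intR_norm.
rewrite (_ : \int[P]_x f x = \int[P]_x h x).
  by apply: Rint_le => // x; rewrite ge_min lexx orbT.
congr fine; apply: ae_eq_integral => //; [exact/measurable_EFinP..|].
by apply: filterS fg => x fgx _ /=; rewrite /h min_l.
Qed.

Lemma fin_num_integral_intR (P : probability T R) (f : T -> \bar R) :
  measurable_fun setT f -> (\int[P]_x f x)%E \is a fin_num ->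
  P.-integrable setT f.
Proof.
move=> mf; rewrite integralE => Ifin.
apply/integrableP; split => //.
have pos0 : (0 <= \int[P]_x f^\+ x)%E by apply: integral_ge0 => x _; exact: funepos_ge0.
have neg0 : (0 <= \int[P]_x f^\- x)%E by apply: integral_ge0 => x _; exact: funeneg_ge0.
rewrite (eq_integral (f^\+ \+ f^\-)%E); last first.
  by move=> x _; exact: (congr1 (@^~ x) (fune_abse f)).
rewrite ge0_integralD//; last 2 first.
- exact: measurable_funepos.
- exact: measurable_funeneg.
move: Ifin pos0 neg0.
case: (\int[P]_x f^\+ x)%E => [p| |] //; case: (\int[P]_x f^\- x)%E => [q| |] //.
by move=> _ _ _; rewrite -EFinD ltry.
Qed.

Lemma dominated_density (alpha nu : probability T R) : nu `<< alpha ->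
  exists k, is_density alpha nu k.
Proof.
move=> na; pose f := Radon_Nikodym_SigmaFinite.f nu alpha.
have f0 := Radon_Nikodym_SigmaFinite.f_ge0 na.
have ffin := Radon_Nikodym_SigmaFinite.f_fin_num na.
have fi := Radon_Nikodym_SigmaFinite.f_integrable na.
exists (fine \o f); split.
- by apply: measurableT_comp => //; exact: (measurable_int alpha).
- by move=> x; exact: fine_ge0.
- move=> A mA; rewrite (Radon_Nikodym_SigmaFinite.f_integral na)//.
  by apply: eq_integral => x _; rewrite /= fineK.
Qed.

Lemma measurable_lne (r : T -> R) : measurable_fun setT r ->
  measurable_fun setT (fun x => lne (r x)%:E).
Proof.
move=> mr; rewrite /lne; apply: measurable_fun_ifT.
- exact: measurable_fun_ler.
- exact: measurable_cst.
- by apply/measurable_EFinP; exact: measurableT_comp mr.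
Qed.

Lemma density_gt0_ae (alpha nu : probability T R) k : is_density alpha nu k ->
  {ae nu, forall x, 0 < k x}.
Proof.
move=> nuk; have [mk k0 kE] := nuk.
have mA : measurable [set x | k x <= 0].
  by rewrite -[X in measurable X]setTI; exact: measurable_fun_ler.
exists [set x | k x <= 0]; split => //.
  rewrite kE// (eq_integral (cst 0%E)) ?integral0// => x.
  by rewrite inE /= => kx; congr EFin; apply/eqP; rewrite eq_le kx k0.
by move=> x /= /negP; rewrite -leNgt.
Qed.

Lemma integral_log_density (alpha nu : probability T R) k :
  is_density alpha nu k ->
  (\int[nu]_x lne (Radon_Nikodym (charge_of_finite_measure nu) alpha x) =
   \int[nu]_x lne (k x)%:E)%E.
Proof.
move=> nuk; have [mk k0 kE] := nuk; have na := density_dominates nuk.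
set f := Radon_Nikodym _ _.
have ffin x : f x \is a fin_num by exact: Radon_Nikodym_fin_num.
have mf : measurable_fun setT (fine \o f).
  apply: measurableT_comp => //; apply: (measurable_int alpha).
  exact: Radon_Nikodym_integrable.
have mlf : measurable_fun setT (fun x => lne (f x)).
  under eq_fun do rewrite -(fineK (ffin _)).
  exact: (measurable_lne mf).
apply: ae_eq_integral => //; first exact: measurable_lne.
have := null_dominates_ae_eq measurableT na (density_Radon_Nikodym nuk).
by apply: filterS => x fx xT; congr lne; exact: fx xT.
Qed.

(** Gibbs' inequality: if [k] is the density of [nu], then
    [ln (h / k) <= h / k - 1] and the [nu]-integral of [h / k] is at most one. *)
Lemma relative_entropy_ge (alpha nu : probability T R) (h : T -> R) :
  measurable_fun setT h -> (forall x, 0 < h x) ->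
  (\int[alpha]_x (h x)%:E <= 1)%E -> intR nu (fun x => ln (h x)) ->
  ((\int[nu]_x ln (h x))%:E <= relative_entropy nu alpha)%E.
Proof.
move=> mh h0 h1 ilh; rewrite /relative_entropy.
case: asboolP => [[na]|_]; last by rewrite leey.
have [k nuk] := dominated_density na; have [mk k0 kE] := nuk.
rewrite (integral_log_density nuk) => Ifin.
have kpos := density_gt0_ae nuk.
have mlk := measurable_lne mk.
have ilk := fin_num_integral_intR mlk Ifin.
have lkE : ae_eq nu setT (fun x => lne (k x)%:E) (fun x => (ln (k x))%:E).
  by apply: filterS kpos => x kx _; rewrite lne_EFin.
have mlnk : measurable_fun setT (fun x => ln (k x)) by exact: measurableT_comp mk.
have ilnk : intR nu (fun x => ln (k x)).
  apply/integrableP; split; first exact/measurable_EFinP.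
  case/integrableP : ilk => _; apply: le_lt_trans.
  rewrite le_eqVlt; apply/orP; left; apply/eqP; apply: ae_eq_integral => //.
  - by apply/measurableT_comp => //; exact/measurable_EFinP.
  - exact: measurableT_comp.
  - by apply: filterS lkE => x + xT => /(_ xT) /= ->.
have -> : (\int[nu]_x lne (k x)%:E = (\int[nu]_x ln (k x))%:E)%E.
  by rewrite RintE//; apply: ae_eq_integral => //; exact/measurable_EFinP.
have mhk : measurable_fun setT (fun x => h x / k x).
  apply: measurable_funM => //.
  under eq_fun do rewrite -powR_inv1//.
  exact: (measurableT_comp (measurable_powR _)).
have hk0 x : 0 <= h x / k x by rewrite divr_ge0// ltW.
have hk1 : (\int[nu]_x (h x / k x)%:E <= 1)%E.
  rewrite (density_ge0_integral nuk); last 2 first.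
  - exact/measurable_EFinP.
  - by move=> x; rewrite lee_fin.
  apply: le_trans h1; apply: ge0_le_integral => //.
  - by move=> x _; rewrite mule_ge0// lee_fin.
  - by apply: emeasurable_funM; exact/measurable_EFinP.
  - exact/measurable_EFinP.
  - move=> x _; rewrite -EFinM lee_fin.
    have [->|kx] := eqVneq (k x) 0; first by rewrite mulr0 ltW.
    by rewrite divfK.
have ihk : intR nu (fun x => h x / k x).
  by apply: intR_lty => //; apply: (le_lt_trans hk1); exact: ltry.
rewrite lee_fin -subr_le0 -RintB//.
apply: (@le_trans _ _ (\int[nu]_x (h x / k x - cst 1 x))).
  apply: Rint_le_ae.
  - exact: intRB.
  - exact: (intRB ihk (intR_cst nu 1)).
  - apply: filterS kpos => x kx /=.
    rewrite -ln_div ?posrE//.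
    have hkx : 0 < h x / k x by rewrite divr_gt0.
    have := @le_ln1Dx _ (h x / k x - 1).
    by rewrite (addrC 1) subrK; apply; lra.
rewrite (RintB ihk (intR_cst nu 1)) (Rint_cst nu 1) subr_le0.
by rewrite -lee_fin RintE.
Qed.

End Gibbs.

Section IProjection.
Context {R : realType} {B : completeNormedModType R} (sepB : separable B)
  {d : measure_display} {T : measurableType d}.
Variables (alpha : probability T R) (F : T -> B) (K : set B).
Variables (ls : {linear B -> R^o}) (z : R) (astar : probability T R).
Hypothesis mF : measurable_fun setT (F : T -> cylindrical B).
Hypothesis dls : dual ls.
Hypothesis z0 : 0 < z.
Hypothesis tilt : is_density alpha astar (fun x => expR (ls (F x)) / z).
Hypothesis iF2 : intR astar (fun x => `|F x| ^+ 2).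
Let m := bochner_integral astar F.
Hypothesis Km : K m.
Hypothesis Kls : forall y, K y -> ls m <= ls y.

Let bF := square_integrable_bochner sepB mF iF2.

Lemma ln_tilt x : ln (expR (ls (F x)) / z) = ls (F x) - ln z.
Proof. by rewrite ln_div ?posrE ?expR_gt0// expRK. Qed.

Lemma relative_entropy_tilt : relative_entropy astar alpha = (ls m - ln z)%:E.
Proof.
have il := bochner_integrable_dual sepB bF dls.
have E : (\int[astar]_x
    lne (Radon_Nikodym (charge_of_finite_measure astar) alpha x) =
    (ls m - ln z)%:E)%E.
  rewrite (integral_log_density tilt).
  under eq_integral do rewrite lne_EFin ?divr_gt0 ?expR_gt0// ln_tilt.
  rewrite -RintE; last exact: intRB il (intR_cst astar (ln z)).
  by rewrite (RintB il (intR_cst astar (ln z))) (Rint_cst astar) bochner_integral_dual.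
rewrite /relative_entropy; case: asboolP => [_|[]]; first exact: E.
by split; [exact: density_dominates tilt|rewrite E].
Qed.

(** Comparing with the tilted density, further perturbed by [exp (s 1_A)], gives
    both the minimality of the tilt and, to first order in [s], uniqueness. *)
Lemma relative_entropy_tilt_le (nu : probability T R) (A : set T) (s : R) :
  mean_in F K nu -> measurable A -> 0 <= s ->
  ((ls m - ln z + s * fine (nu A) - (expR s - 1) * fine (astar A))%:E <=
    relative_entropy nu alpha)%E.
Proof.
move=> [bnu Knu] mA s0; set p := fine (astar A).
have il := bochner_integrable_dual sepB bnu dls.
have p0 : 0 <= p by exact: fine_ge0.
have es1 : 0 <= expR s - 1 by have := expR_ge1Dx s; lra.
pose c := 1 + (expR s - 1) * p.
have c0 : 0 < c by rewrite ltr_pwDl// mulr_ge0.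
pose w x := expR (s * \1_A x) / c.
have wE x : expR (s * \1_A x) = 1 + (expR s - 1) * \1_A x :> R.
  rewrite indicE; case: (x \in A) => /=; first by rewrite !mulr1 addrC subrK.
  by rewrite !mulr0 expR0 addr0.
have mw : measurable_fun setT w.
  apply: measurable_funM => //; apply: measurableT_comp => //.
  by apply: measurable_funM => //; exact: measurable_indic.
have w0 x : 0 < w x by rewrite divr_gt0// expR_gt0.
pose h x := w x * (expR (ls (F x)) / z).
have [mk k0 _] := tilt.
have lnh x : ln (h x) = ls (F x) + s * \1_A x - (ln z + ln c).
  rewrite /h lnM ?posrE ?divr_gt0 ?expR_gt0// ln_tilt ln_div ?posrE ?expR_gt0//.
  by rewrite expRK; ring.
have isA : intR nu (fun x => s * \1_A x) by apply: intRZ; exact: intR_indic.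
have iu : intR nu (fun x => ls (F x) + s * \1_A x) by exact: intRD.
have := @relative_entropy_ge _ _ _ alpha nu h.
have -> : \int[nu]_x ln (h x) =
    ls (bochner_integral nu F) + s * fine (nu A) - (ln z + ln c).
  rewrite (_ : Rintegral _ _ _ =
    \int[nu]_x (ls (F x) + s * \1_A x - cst (ln z + ln c) x)); last first.
    by congr Rintegral; apply/funext => x; rewrite lnh.
  rewrite (RintB iu (intR_cst nu _)) (Rint_cst nu) (RintD il isA).
  rewrite (RintZ s (intR_indic nu mA)) Rint_indic//.
  by rewrite bochner_integral_dual.
move=> ge; apply: le_trans (ge _ _ _ _).
- rewrite lee_fin; have := Kls Knu; have : ln c <= (expR s - 1) * p.
    by apply: le_ln1Dx; rewrite (lt_le_trans (ltrN10 _))// mulr_ge0.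
  rewrite -/p; lra.
- exact: measurable_funM.
- by move=> x; rewrite mulr_gt0// divr_gt0 ?expR_gt0.
- rewrite -(density_ge0_integral tilt (f := EFin \o w)); last 2 first.
  + exact/measurable_EFinP.
  + by move=> x; rewrite lee_fin ltW.
  have iw : intR astar w.
    apply: (@intR_bounded _ _ _ _ _ (expR s / c)) => // x.
    rewrite ger0_norm ?(ltW (w0 x))// ler_wpM2r ?invr_ge0 ?(ltW c0)//.
    by rewrite ler_expR indicE; case: (_ \in _); rewrite ?mulr1// mulr0.
  rewrite -RintE// lee_fin.
  have iA := intR_indic astar mA.
  rewrite (_ : \int[astar]_x w x =
    \int[astar]_x (c^-1 * (cst 1 x + (expR s - 1) * \1_A x))).
    rewrite RintZ; last exact: intRD (intR_cst astar 1) (intRZ _ iA).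
    rewrite (RintD (intR_cst astar 1) (intRZ _ iA)) (Rint_cst astar).
    by rewrite (RintZ _ iA) Rint_indic// -/p -/c mulVf// gt_eqF.
  by congr Rintegral; apply/funext => x; rewrite /w wE mulrC.
- rewrite (_ : (fun x => ln (h x)) =
    (fun x => ls (F x) + s * \1_A x - cst (ln z + ln c) x)).
    exact: intRB iu (intR_cst nu _).
  by apply/funext => x; rewrite lnh.
Qed.

(** Both sides vanish at [s = 0], with slopes [x] and [y]. *)
Lemma le_of_exp_slope (x y : R) : 0 <= y ->
  (forall s, 0 < s -> s * x <= (expR s - 1) * y) -> x <= y.
Proof.
move=> y0 h; apply/ler_addgt0Pr => e e0.
pose s := Num.min 1 (e / (expR 1 * y + 1)).
have ey : 0 < expR 1 * y + 1 by rewrite ltr_wpDl// mulr_ge0// expR_ge0.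
have s0 : 0 < s by rewrite lt_min ltr01 divr_gt0.
have s1 : s <= 1 by rewrite ge_min lexx.
have se : s * (expR 1 * y + 1) <= e.
  by rewrite -ler_pdivlMr// ge_min lexx orbT.
have hq := expR_le_quadratic s; rewrite (gtr0_norm s0) in hq.
have e1 : expR s <= expR 1 by rewrite ler_expR.
have : s * x <= s * (y + s * (expR 1 * y)).
  apply: (le_trans (h s s0)).
  have : (expR s - 1) * y <= (s + s ^+ 2 * expR 1) * y.
    apply: ler_wpM2r => //.
    have : s ^+ 2 * expR s <= s ^+ 2 * expR 1 by rewrite ler_wpM2l ?sqr_ge0.
    lra.
  by move/le_trans; apply; rewrite le_eqVlt; apply/orP; left; apply/eqP; ring.
rewrite ler_pM2l//; lra.
Qed.

Lemma tilt_is_I_projection : is_I_projection alpha (mean_in F K) astar.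
Proof.
have Cstar : mean_in F K astar by [].
rewrite /is_I_projection.
have -> : ereal_inf [set relative_entropy nu alpha | nu in mean_in F K] =
    (ls m - ln z)%:E.
  apply/eqP; rewrite eq_le; apply/andP; split.
    by apply: ereal_inf_lbound; exists astar; rewrite ?relative_entropy_tilt.
  apply: le_ereal_inf_tmp => _ [nu Cnu <-].
  have := relative_entropy_tilt_le Cnu (@measurable0 _ T) (lexx 0).
  by rewrite expR0 subrr !mul0r addr0 subr0.
split => //; [exact: relative_entropy_tilt|exact: ltry|].
move=> nu Cnu Hnu.
have le A : measurable A -> fine (nu A) <= fine (astar A).
  move=> mA; apply: le_of_exp_slope; first exact: fine_ge0.
  move=> s s0; have := relative_entropy_tilt_le Cnu mA (ltW s0).
  by rewrite Hnu lee_fin; lra.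
move=> A mA; rewrite -(fineK (fin_num_measure nu A mA)).
rewrite -(fineK (fin_num_measure astar A mA)); congr EFin.
apply/eqP; rewrite eq_le le//=.
have := le _ (measurableC mA); rewrite !probability_setC//.
rewrite -(fineK (fin_num_measure nu A mA)) -(fineK (fin_num_measure astar A mA)).
by rewrite -!EFinB /=; lra.
Qed.

End IProjection.

(** * Blocks of an exchangeable sample *)

Section Blocks.
Context {d : measure_display} {T : measurableType d} {R : realType}.
Variables (k : nat).

(** The default value makes blocks total functions; they are meaningful as long
    as they fit in the sample. *)
Definition block N (b : nat) (x : N.-tuple T) : k.-tuple T :=
  [tuple nth point x (b * k + i)%N | i < k].

Lemma measurable_block N b : (b * k + k <= N)%N ->
  measurable_fun setT (@block N b).
Proof.
move=> bN; apply/measurable_fun_tnthP => i.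
have iN : (b * k + i < N)%N by apply: leq_trans bN; rewrite ltn_add2l.
rewrite (_ : _ \o _ = (@tnth N T ^~ (Ordinal iN))); first exact: measurable_tnth.
by apply/funext => x /=; rewrite tnth_mktuple (tnth_nth point).
Qed.

Lemma block0_cat N (x : k.-tuple T) (y : N.-tuple T) :
  block 0 [tuple of x ++ y] = x.
Proof.
apply: eq_from_tnth => i; rewrite tnth_mktuple /= mul0n add0n nth_cat size_tuple.
by rewrite ltn_ord -tnth_nth.
Qed.

Lemma blockS_cat N b (x : k.-tuple T) (y : N.-tuple T) :
  block b.+1 [tuple of x ++ y] = block b y.
Proof.
apply: eq_from_tnth => i; rewrite !tnth_mktuple /= nth_cat size_tuple mulSn.
by rewrite -addnA ltnNge leq_addr /= addKn.
Qed.

Lemma integral_block_prod (mu : probability T R) (g : k.-tuple T -> R) m N :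
  measurable_fun setT g -> (forall x, 0 <= g x) -> intR (power mu k) g ->
  (m * k <= N)%N ->
  (\int[power mu N]_x (\prod_(b < m) g (block b x))%:E =
   ((\int[power mu k]_y g y) ^+ m)%:E)%E.
Proof.
move=> mg g0 gi; elim: m N => [|m IH] N mN.
  rewrite expr0 (eq_integral (cst 1%E)); last by move=> x _; rewrite big_ord0.
  rewrite integral_cst// mul1e; exact: probability_setT.
have [N' NE] : exists N', N = (k + N')%N.
  exists (N - k)%N; rewrite subnKC//; apply: leq_trans mN.
  by rewrite mulSn leq_addr.
subst N; move: mN; rewrite mulSn leq_add2l => mN.
have mb (b : 'I_m.+1) : measurable_fun setT (@block (k + N') b).
  apply: measurable_block; rewrite addnC -mulSn.
  apply: (@leq_trans (m.+1 * k)); first by rewrite leq_mul2r ltn_ord orbT.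
  by rewrite mulSn leq_add2l.
have mb' (b : 'I_m) : measurable_fun setT (@block N' b).
  apply: measurable_block; rewrite addnC -mulSn.
  by apply: leq_trans mN; rewrite leq_mul2r ltn_ord orbT.
rewrite integral_power_cat; last 2 first.
- apply/measurable_EFinP; apply: measurable_prod => b _.
  exact: measurableT_comp (mb b).
- by move=> x; rewrite lee_fin; apply: prodr_ge0.
under eq_integral => x _.
  under eq_integral => y _.
    rewrite big_ord_recl block0_cat.
    under eq_bigr => b _ do rewrite blockS_cat.
    rewrite EFinM; over.
  rewrite ge0_integralZl_EFin//; last 2 first.
  - by move=> y _; rewrite lee_fin; apply: prodr_ge0.
  - apply/measurable_EFinP; apply: measurable_prod => b _.
    exact: measurableT_comp (mb' b).
  rewrite IH// muleC; over.
rewrite ge0_integralZl_EFin//.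
- by rewrite -RintE// -EFinM exprS mulrC.
- by move=> x _; rewrite lee_fin.
- exact/measurable_EFinP.
- by rewrite exprn_ge0// Rint_ge0.
Qed.

(** Exchanges the block [b] with the initial one; it is the identity for
    [b = 0]. *)
Definition swap_nat (b i : nat) : nat :=
  if (i < k)%N then (b * k + i)%N
  else if (b * k <= i < b * k + k)%N then (i - b * k)%N else i.

Lemma swap_natK b i : swap_nat b (swap_nat b i) = i.
Proof.
rewrite /swap_nat; case: (ltnP i k) => [ik|ki].
  case: ltnP => [bik|kbi].
    have b0 : (b * k = 0)%N by case: b bik => // b; rewrite mulSn; lia.
    by rewrite b0.
  by rewrite leq_addr ltn_add2l ik /= addKn.
case: (boolP (b * k <= i < b * k + k)%N) => [/andP [h1 h2]|h].
  have -> : (i - b * k < k)%N by lia.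
  lia.
by rewrite ltnNge ki /= (negbTE h).
Qed.

Lemma swap_nat_lt n b i : (b * k + k <= n.+1)%N -> (i < n.+1)%N ->
  (swap_nat b i < n.+1)%N.
Proof.
move=> bn iN; rewrite /swap_nat; case: (ltnP i k) => ik; first lia.
by case: ifP => // _; lia.
Qed.

Lemma swap_inj n b : (b * k + k <= n.+1)%N ->
  injective (fun i : 'I_n.+1 => inord (swap_nat b i) : 'I_n.+1).
Proof.
move=> bn i j ij; apply: val_inj => /=.
have := congr1 (fun u : 'I_n.+1 => swap_nat b u) ij.
by rewrite /= !inordK ?swap_nat_lt// !swap_natK.
Qed.

Lemma block_swap n b (bn : (b * k + k <= n.+1)%N) (x : n.+1.-tuple T) :
  block b x = block 0 (tuple_perm (perm (swap_inj bn)) x).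
Proof.
apply: eq_from_tnth => i; rewrite !tnth_mktuple mul0n add0n.
have ik : (i < n.+1)%N.
  by apply: leq_trans bn; rewrite ltn_addl.
rewrite -[nth _ _ i](tnth_nth point _ (Ordinal ik)) tnth_mktuple permE.
rewrite (tnth_nth point) inordK ?swap_nat_lt//.
by rewrite /swap_nat /= ltn_ord.
Qed.

Lemma first_inE N (D : set (k.-tuple T)) : (k <= N)%N ->
  @first_in _ T N k D = [set x | D (block 0 x)].
Proof.
move=> kN.
have E (x : N.-tuple T) : take k x = block 0 x :> seq T.
  apply: (@eq_from_nth _ point).
    by rewrite size_takel ?size_tuple.
  move=> i; rewrite size_takel ?size_tuple// => ik.
  by rewrite nth_take// -(tnth_nth point _ (Ordinal ik)) tnth_mktuple /=.
apply/seteqP; split => x /=.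
  by move=> [y Dy xy]; have -> // : block 0 x = y; apply: val_inj; rewrite /= -E.
by move=> Dx; exists (block 0 x).
Qed.

End Blocks.
Arguments block {d T k N} b x.

(** * From a subexponential density to convergence of the marginals *)

Section Conditioning.
Context {d : measure_display} {T : measurableType d} {R : realType}.
Variables (alpha astar : probability T R) (n : nat) (A : set (n.+1.-tuple T)).
Variable L : R.
Local Notation P := (power alpha n.+1).
Local Notation Pstar := (power astar n.+1).
Hypothesis mA : measurable A.
Hypothesis symA : forall (s : {perm 'I_n.+1}) x, A (tuple_perm s x) <-> A x.
Let pA := fine (P A).
Hypothesis pA0 : 0 < pA.
Hypothesis dens : forall (f : n.+1.-tuple T -> R) (c : R),
  measurable_fun setT f -> (forall x, 0 <= f x <= c) ->
  \int[P]_x (f x * \1_A x) <= expR L * pA * \int[Pstar]_x f x.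

Variables (k : nat) (D : set (k.-tuple T)).
Hypothesis mD : measurable D.
Let q := fine (power astar k D).

Lemma conditioned_exchangeable b : (b * k + k <= n.+1)%N ->
  P ((block b @^-1` D) `&` A) = P ((block 0 @^-1` D) `&` A).
Proof.
move=> bn.
have k_le : (0 * k + k <= n.+1)%N by lia.
have mS : measurable ((@block _ T k n.+1 0 @^-1` D) `&` A).
  apply: measurableI => //; rewrite -[X in measurable X]setTI.
  exact: measurable_block.
rewrite -[RHS](power_perm alpha (perm (swap_inj bn)) mS).
congr (P _); apply/seteqP; split => x /=.
  by move=> [Dx Ax]; rewrite -block_swap; split => //; apply/symA.
by move=> [Dx /symA Ax]; rewrite block_swap.
Qed.

(** Averaging over disjoint blocks: by exchangeability every block has the same
    conditional law, while under the product law the average of the indicators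
    has exponential moments of the order of [s ^ 2]. Jensen's inequality enters
    as [v <= c - 1 + exp (v - c)]. *)
Lemma conditioned_block_le m (s : R) : (0 < m)%N -> (m * k <= n.+1)%N ->
  0 < s <= 1 ->
  fine (P ((block 0 @^-1` D) `&` A)) / pA - q <= L / (s * m%:R) + s * expR 1.
Proof.
move=> m0 mk /andP[s0 s1].
have q0 : 0 <= q by exact: fine_ge0.
have q1 : q <= 1.
  rewrite -lee_fin fineK ?fin_num_measure//; exact: probability_le1.
have mb (b : 'I_m) : measurable_fun setT (@block _ T k n.+1 b).
  apply: measurable_block; apply: leq_trans mk.
  by rewrite addnC -mulSn leq_mul2r ltn_ord orbT.
have mbD (b : 'I_m) : measurable ((@block _ T k n.+1 b @^-1` D)).
  by rewrite -[X in measurable X]setTI; exact: mb.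
pose u (y : k.-tuple T) : R := s * (\1_D y - q).
have u_le y : `|u y| <= s.
  rewrite normrM (gtr0_norm s0) ler_piMr ?(ltW s0)// indicE.
  by case: (_ \in _); rewrite ler_norml /=; lra.
have iD := intR_indic (power astar k) mD.
have iu : intR (power astar k) u.
  by apply: intRZ; exact: (intRB iD (intR_cst _ q)).
have mu_ := intR_measurable iu.
have Iu : \int[power astar k]_y u y = 0.
  rewrite (RintZ s (intRB iD (intR_cst _ q))) (RintB iD (intR_cst _ q)).
  by rewrite (Rint_cst _ q) Rint_indic// subrr mulr0.
pose g y := expR (u y).
have mg : measurable_fun setT g by exact: measurableT_comp mu_.
have g0 y : 0 <= g y by exact: expR_ge0.
have ig : intR (power astar k) g.
  apply: (@intR_bounded _ _ _ _ _ (expR s)) => // y.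
  by rewrite ger0_norm// ler_expR (le_trans (ler_norm _)).
have e1 : 0 < expR 1 :> R by exact: expR_gt0.
have Ig : \int[power astar k]_y g y <= expR (s ^+ 2 * expR 1).
  apply: (@le_trans _ _ (1 + s ^+ 2 * expR 1)); last exact: expR_ge1Dx.
  have iv := intRD (intR_cst (power astar k) (1 + s ^+ 2 * expR 1)) iu.
  apply: (@le_trans _ _
    (\int[power astar k]_y (cst (1 + s ^+ 2 * expR 1) y + u y))).
    apply: Rint_le => // y; apply: (le_trans (expR_le_quadratic _)).
    have : u y ^+ 2 * expR `|u y| <= s ^+ 2 * expR 1.
      apply: ler_pM; rewrite ?sqr_ge0 ?expR_ge0//.
        by rewrite -[u y ^+ 2]real_normK ?num_real// ler_pXn2r ?nnegrE ?(ltW s0).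
      by rewrite ler_expR (le_trans (u_le y)).
    rewrite /=; lra.
  by rewrite (RintD (intR_cst _ _) iu) (Rint_cst _ (1 + s ^+ 2 * expR 1)) Iu addr0.
(* centered count of the blocks in [D] *)
pose V (x : n.+1.-tuple T) := \sum_(b < m) u (block b x).
have mV : measurable_fun setT V.
  by apply: measurable_sum => b; exact: measurableT_comp mu_ (mb b).
have V_le x : `|V x| <= m%:R * s.
  apply: (le_trans (ler_norm_sum _ _ _)).
  rewrite -[m in m%:R](card_ord m) mulr_natl -sumr_const.
  exact: ler_sum.
(* logarithmic bound on the exponential moment of [V] given [A] *)
pose c := L + m%:R * (s ^+ 2 * expR 1).
pose G x := expR (V x - c).
have mG : measurable_fun setT G.
  by apply: measurableT_comp => //; exact: measurable_funB.
have G_le x : 0 <= G x <= expR (m%:R * s - c).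
  rewrite expR_ge0 ler_expR lerD2r (le_trans (ler_norm _))//; exact: V_le.
have IG : \int[Pstar]_x G x <= expR (- L).
  rewrite (_ : \int[Pstar]_x G x =
      expR (- c) * (\int[power astar k]_y g y) ^+ m).
    have -> : - L = - c + m%:R * (s ^+ 2 * expR 1) by rewrite /c; ring.
    rewrite expRD ler_wpM2l ?expR_ge0// expRM_natl.
    by apply: lerXn2r; rewrite ?nnegrE ?expR_ge0 ?Rint_ge0.
  have iG : intR Pstar G.
    apply: (@intR_bounded _ _ _ _ _ (expR (m%:R * s - c))) => // x.
    by have /andP[Gx0 Gx1] := G_le x; rewrite ger0_norm.
  apply: EFin_inj; rewrite RintE// EFinM -(@integral_block_prod _ _ _ k astar g m n.+1)//.
  rewrite -ge0_integralZl_EFin ?expR_ge0//.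
  - apply: eq_integral => x _; rewrite -EFinM; congr EFin.
    by rewrite /G addrC expRD /V expR_sum.
  - by move=> x _; rewrite lee_fin; apply: prodr_ge0.
  - apply/measurable_EFinP; apply: measurable_prod => b _.
    exact: measurableT_comp mg (mb b).
have iA := intR_indic P mA.
have iVA : intR P (fun x => V x * \1_A x).
  apply: (@intR_bounded _ _ _ _ _ (m%:R * s)).
    by apply: measurable_funM => //; exact: measurable_indic.
  move=> x; rewrite normrM indicE; case: (_ \in _).
    by rewrite normr1 mulr1.
  by rewrite normr0 mulr0 mulr_ge0// ltW.
have iGA : intR P (fun x => G x * \1_A x).
  apply: (@intR_bounded _ _ _ _ _ (expR (m%:R * s - c))).
    by apply: measurable_funM => //; exact: measurable_indic.
  move=> x; have /andP[Gx0 Gx1] := G_le x.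
  rewrite ger0_norm ?mulr_ge0//.
  by apply: le_trans Gx1; rewrite ler_piMr// indicE; case: (_ \in _).
have VA : \int[P]_x (V x * \1_A x) <= c * pA.
  apply: (@le_trans _ _ (\int[P]_x ((c - 1) * \1_A x + G x * \1_A x))).
    apply: Rint_le => //; first by apply: intRD => //; exact: intRZ.
    move=> x; rewrite -mulrDl ler_wpM2r//.
    by have := expR_ge1Dx (V x - c); rewrite -/(G x); lra.
  rewrite (RintD (intRZ (c - 1) iA) iGA) (RintZ (c - 1) iA) Rint_indic//.
  have h : \int[P]_x (G x * \1_A x) <= expR L * pA * expR (- L).
    apply: (le_trans (dens mG G_le)).
    by rewrite ler_wpM2l// mulr_ge0 ?expR_ge0// ltW.
  have eL : expR L * expR (- L) = 1 by rewrite -expRD subrr expR0.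
  have {}h : \int[P]_x (G x * \1_A x) <= pA.
    by apply: (le_trans h); rewrite mulrAC eL mul1r.
  rewrite -/pA; lra.
have VE : \int[P]_x (V x * \1_A x) =
    m%:R * (s * (fine (P ((block 0 @^-1` D) `&` A)) - q * pA)).
  have iDA (b : 'I_m) := intR_indic P (measurableI _ _ (mbD b) mA).
  have iuA (b : 'I_m) : intR P (fun x =>
      s * (\1_((block b @^-1` D) `&` A) x - q * \1_A x)).
    by apply: intRZ; apply: intRB; [exact: iDA|exact: intRZ].
  rewrite (_ : \int[P]_x (V x * \1_A x) = \int[P]_x (\sum_(b < m)
      (s * (\1_((block b @^-1` D) `&` A) x - q * \1_A x)))).
    rewrite Rint_sum//.
    under eq_bigr => b _.
      rewrite RintZ; last by apply: intRB; [exact: iDA|exact: intRZ].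
      rewrite (RintB (iDA b) (intRZ q iA)) (RintZ q iA) !Rint_indic//; last first.
        exact: measurableI.
      rewrite conditioned_exchangeable; last first.
        apply: leq_trans mk.
        by rewrite addnC -mulSn leq_mul2r ltn_ord orbT.
      over.
    by rewrite sumr_const card_ord mulr_natl.
  congr Rintegral; apply/funext => x; rewrite mulr_suml; apply: eq_bigr => b _.
  rewrite indicI /u /= -mulrA; congr (_ * _).
  by rewrite mulrBl; congr (_ * _ - _); rewrite !indicE.
move: VA; rewrite VE => VA.
have m0' : 0 < m%:R :> R by rewrite ltr0n.
rewrite -(ler_pM2l (x := m%:R * (s * pA))); last by rewrite !mulr_gt0.
apply: le_trans (_ : c * pA <= _).
  apply: le_trans VA; rewrite le_eqVlt; apply/orP; left; apply/eqP.
  by field; rewrite gt_eqF.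
rewrite le_eqVlt; apply/orP; left; apply/eqP; rewrite /c.
by field; rewrite !gt_eqF.
Qed.

End Conditioning.

(** * Sample means and neighbourhoods of a convex set *)

Section EmpiricalMean.
Context {d : measure_display} {T : measurableType d} {R : realType}.

Lemma ge0_integral_empirical n (x : n.+1.-tuple T) (f : T -> R) :
  measurable_fun setT f -> (forall y, 0 <= f y) ->
  (\int[empirical x]_y (f y)%:E =
    (n.+1%:R^-1 * \sum_(i < n.+1) f (tnth x i))%:E)%E.
Proof.
move=> mf f0; have mEf : measurable_fun setT (EFin \o f) by exact/measurable_EFinP.
rewrite ge0_integral_mscale//; last by move=> y _; rewrite lee_fin.
rewrite ge0_integral_measure_sum//; last by move=> y _; rewrite lee_fin.
rewrite EFinM -sumEFin; congr (_ * _)%E; apply: eq_bigr => i _.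
by rewrite integral_dirac// diracT mul1e -tnth_nth.
Qed.

Lemma intR_empirical n (x : n.+1.-tuple T) (f : T -> R) :
  measurable_fun setT f -> intR (empirical x) f.
Proof.
move=> mf; apply/integrableP; split; first exact/measurable_EFinP.
rewrite (eq_integral (fun y => (`|f y|)%:E))//.
rewrite ge0_integral_empirical ?ltry//; exact: measurableT_comp.
Qed.

Lemma Rint_empirical n (x : n.+1.-tuple T) (f : T -> R) :
  measurable_fun setT f ->
  \int[empirical x]_y f y = n.+1%:R^-1 * \sum_(i < n.+1) f (tnth x i).
Proof.
move=> mf; have mn : measurable_fun setT (fun y => `|f y|) by exact: measurableT_comp.
have mp : measurable_fun setT (fun y => f y + `|f y|) by exact: measurable_funD.
have E (g : T -> R) : measurable_fun setT g -> (forall y, 0 <= g y) ->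
    \int[empirical x]_y g y = n.+1%:R^-1 * \sum_(i < n.+1) g (tnth x i).
  by move=> mg g0; rewrite /Rintegral ge0_integral_empirical.
have p0 y : 0 <= f y + `|f y|.
  by have := ler_norm (- f y); rewrite normrN; lra.
rewrite (_ : Rintegral _ _ f = \int[empirical x]_y ((f y + `|f y|) - `|f y|)).
  rewrite (RintB (intR_empirical x mp) (intR_empirical x mn)) !E//.
  by rewrite big_split /= mulrDr addrK.
by congr Rintegral; apply/funext => y; rewrite addrK.
Qed.

Context {B : completeNormedModType R} (sepB : separable B).
Variable F : T -> B.
Hypothesis mF : measurable_fun setT (F : T -> cylindrical B).

Lemma empirical_bochner_integrable n (x : n.+1.-tuple T) :
  bochner_integrable (empirical x) F.
Proof.
split=> //; apply: intR_ltyP; apply: intR_empirical.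
exact: measurable_cylindrical_norm.
Qed.

Lemma bochner_integral_empirical n (x : n.+1.-tuple T) :
  bochner_integral (empirical x) F =
  n.+1%:R^-1 *: \sum_(i < n.+1) F (tnth x i).
Proof.
apply: bochner_integral_unique => //; first exact: empirical_bochner_integrable.
move=> l dl.
have Fi := empirical_bochner_integrable x.
have ml := intR_measurable (bochner_integrable_dual sepB Fi dl).
by rewrite Rint_empirical// linearZ linear_sum.
Qed.

Lemma empirical_in_mean n (C : set B) :
  empirical_in n (mean_in F C) =
  [set x | C (n.+1%:R^-1 *: \sum_(i < n.+1) F (tnth x i))].
Proof.
apply/seteqP; split => x; rewrite /empirical_in /mean_in /=.
  by rewrite bochner_integral_empirical => -[].
by rewrite -bochner_integral_empirical; split => //;
  exact: empirical_bochner_integrable.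
Qed.

Lemma measurable_empirical_in_mean n (C : set B) : closed C ->
  measurable (empirical_in n (mean_in F C)).
Proof.
move=> cC; rewrite empirical_in_mean.
apply: (@measurable_cylindrical_closed _ _ _ _
  (fun x : n.+1.-tuple T => n.+1%:R^-1 *: \sum_(i < n.+1) F (tnth x i)) C) => //.
apply: measurable_cylindricalZ; exact: measurable_sum_tnth.
Qed.

Lemma empirical_in_mean_perm n (C : set B) (s : {perm 'I_n.+1})
    (x : n.+1.-tuple T) :
  empirical_in n (mean_in F C) (tuple_perm s x) <->
  empirical_in n (mean_in F C) x.
Proof.
rewrite empirical_in_mean /=.
rewrite (_ : \sum_(i < n.+1) F (tnth (tuple_perm s x) i) =
             \sum_(i < n.+1) F (tnth x i)) //.
rewrite [RHS](reindex_inj (@perm_inj _ s)) /=.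
by apply: eq_bigr => i _; rewrite tnth_mktuple.
Qed.

End EmpiricalMean.

Section Fattening.
Context {R : realType} {B : normedModType R}.
Variable K : set B.

Lemma closed_fattening (e : R) : closed (fattening K e).
Proof.
rewrite (_ : fattening K e = edist_inf K @^-1` [set u | (u <= e%:E)%E])//.
apply: preimage_closed; last exact: closed_ereal_ge_ereal.
by move=> x _; exact: edist_inf_continuous.
Qed.

Lemma fattening_of_le (m x : B) (e : R) : 0 < e -> K m -> `|x - m| <= e ->
  fattening K e x.
Proof.
move=> e0 Km xm; apply/lee_addgt0Pr => r r0.
apply: (@le_trans _ _ (edist (x, m))).
  by apply: ereal_inf_lbound; exists m.
rewrite -EFinD; apply: edist_fin; first by rewrite addr_gt0.
by rewrite -ball_normE /ball_ /=; lra.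
Qed.

Lemma fattening_near (x : B) (e r : R) : 0 <= e -> 0 < r -> fattening K e x ->
  exists2 y, K y & `|x - y| < e + r.
Proof.
move=> e0 r0 xe; have : (edist_inf K x < (e + r)%:E)%E.
  by apply: (le_lt_trans xe); rewrite lte_fin ltrDl.
move=> /ereal_inf_lt[_ [y Ky <-]] xy; exists y => //.
by have := edist_lt_ball xy; rewrite -ball_normE.
Qed.

Lemma fattening_linear_ge (l : {linear B -> R^o}) (m x : B) (M e : R) :
  0 <= e -> 0 <= M -> (forall y, `|l y| <= M * `|y|) ->
  (forall y, K y -> l m <= l y) -> fattening K e x -> l m - M * e <= l x.
Proof.
move=> e0 M0 lM lm xe; apply/ler_addgt0Pr => r r0.
have [y Ky xy] := fattening_near e0 (divr_gt0 r0 (ltr_wpDl M0 ltr01)) xe.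
have h1 := lm y Ky.
have h2 : - (M * `|x - y|) <= l (x - y).
  by have := lM (x - y); rewrite ler_norml => /andP [].
rewrite linearB in h2.
have h3 : M * `|x - y| <= M * e + r.
  apply: (@le_trans _ _ (M * (e + r / (M + 1)))).
    by rewrite ler_wpM2l// ltW.
  rewrite mulrDr lerD2l mulrCA ler_piMr ?(ltW r0)// ler_pdivrMr ?ltr_wpDl//.
  lra.
move: h2; set lx := l x; set ly := l y; set lm' := l m => h2.
have h4 : lm' <= ly by [].
have h5 : - (M * `|x - y|) <= lx - ly by [].
lra.
Qed.

End Fattening.

(** * Conditioning on the mean being near the convex set *)

Lemma dist_le_of_complement (R : realDomainType) (u v t : R) :
  u - v <= t -> (1 - u) - (1 - v) <= t -> `|u - v| <= t.
Proof. by move=> h1 h2; rewrite ler_norml; apply/andP; split; lra. Qed.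

Section ConditionalDensity.
Context {R : realType} {B : completeNormedModType R} (sepB : separable B)
  {d : measure_display} {T : measurableType d}.
Variables (alpha astar : probability T R) (F : T -> B) (K : set B) (a : R).
Variables (ls : {linear B -> R^o}) (z : R).
Hypothesis type2B : type2 B a.
Hypothesis mF : measurable_fun setT (F : T -> cylindrical B).
Hypothesis dls : dual ls.
Hypothesis z0 : 0 < z.
Hypothesis tilt : is_density alpha astar (fun x => expR (ls (F x)) / z).
Hypothesis iF2 : intR astar (fun x => `|F x| ^+ 2).
Let m := bochner_integral astar F.
Hypothesis Km : K m.
Hypothesis Kls : forall y, K y -> ls m <= ls y.

Let bF := square_integrable_bochner sepB mF iF2.
Let G x := F x - m.
Let V := \int[astar]_x (`|G x| ^+ 2).

Lemma measurable_centered : measurable_fun setT (G : T -> cylindrical B).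
Proof. exact: measurable_cylindricalB. Qed.

Lemma centered_square_integrable : intR astar (fun x => `|G x| ^+ 2).
Proof.
apply: (@intR_le _ _ _ _ _ (fun x => 2 * (`|F x| ^+ 2 + `|m| ^+ 2))).
- apply: measurable_funX; apply: measurable_cylindrical_norm => //.
  exact: measurable_centered.
- move=> x; rewrite ger0_norm ?exprn_ge0//.
  have h1 := ler_normB (F x) m; have h2 := normr_ge0 (G x).
  have := sqr_ge0 (`|F x| - `|m|).
  have : `|G x| ^+ 2 <= (`|F x| + `|m|) ^+ 2.
    by apply: lerXn2r; rewrite ?nnegrE ?addr_ge0.
  rewrite sqrrB sqrrD; lra.
- by apply: intRZ; apply: intRD => //; exact: intR_cst.
Qed.

Lemma centered_mean : bochner_integral astar G = 0.
Proof.
have mG := measurable_centered.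
apply: bochner_integral_unique => //.
  exact: square_integrable_bochner centered_square_integrable.
move=> l dl; have il := bochner_integrable_dual sepB bF dl.
rewrite linear0 (_ : Rintegral _ _ _ = \int[astar]_x (l (F x) - cst (l m) x)).
  by rewrite (RintB il (intR_cst astar _)) (Rint_cst astar) -bochner_integral_dual// subrr.
by congr Rintegral; apply/funext => x; rewrite linearB.
Qed.

Variables (n : nat) (e r : R).
Hypothesis e0 : 0 < e.
Let N : R := n.+1%:R.
Hypothesis rNe : r <= (N * e) ^+ 2.
Local Notation P := (power alpha n.+1).
Local Notation Pstar := (power astar n.+1).
Let A := empirical_in n (mean_in F (fattening K e)).
Let pA := fine (P A).
Let ball := [set x : n.+1.-tuple T | `|\sum_(i < n.+1) G (tnth x i)| ^+ 2 <= r].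
Let q := fine (Pstar ball).
Let mean (x : n.+1.-tuple T) := N^-1 *: \sum_(i < n.+1) F (tnth x i).

Let N0 : 0 < N. Proof. by rewrite ltr0n. Qed.

Lemma measurable_near_mean : measurable A.
Proof. by apply: measurable_empirical_in_mean => //; exact: closed_fattening. Qed.

Lemma mean_near_of_ball x : ball x -> `|mean x - m| <= e.
Proof.
rewrite /ball /= => xr.
have -> : mean x - m = N^-1 *: \sum_(i < n.+1) G (tnth x i).
  rewrite /G sumrB sumr_const card_ord scalerBr -[m *+ _]scaler_nat scalerA.
  by rewrite mulVf ?scale1r// gt_eqF.
rewrite normrZ ger0_norm ?invr_ge0 ?(ltW N0)// ler_pdivrMl//.
have := le_trans xr rNe; rewrite ler_pXn2r// nnegrE ?mulr_ge0// ltW//.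
Qed.

Lemma ball_sub_near_mean : ball `<=` A.
Proof.
move=> x /mean_near_of_ball xm; rewrite /A empirical_in_mean//=.
exact: fattening_of_le xm.
Qed.

Let w (x : n.+1.-tuple T) := \prod_(i < n.+1) (expR (ls (F (tnth x i))) / z).

(** The weight depends on the sample mean only, which is the reason why the tilt
    is adapted to this conditioning. *)
Lemma tilt_weight x : w x = expR (N * (ls (mean x) - ln z)).
Proof.
rewrite /w big_split /= prodr_const card_ord -expR_sum mulrBr expRB.
rewrite linearZ linear_sum /= mulrA mulfV ?mul1r ?gt_eqF//; congr (_ * _).
by rewrite expRM_natl lnK ?posrE// exprVn.
Qed.

Variable M : R.
Hypothesis M0 : 0 <= M.
Hypothesis lsM : forall y, `|ls y| <= M * `|y|.

Lemma tilt_weight_ge x : A x -> expR (N * (ls m - M * e - ln z)) <= w x.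
Proof.
rewrite /A empirical_in_mean//= => xA; rewrite tilt_weight ler_expR.
by rewrite ler_pM2l// lerD2r; exact: (fattening_linear_ge (ltW e0) M0 lsM Kls xA).
Qed.

Lemma tilt_weight_le x : ball x -> w x <= expR (N * (ls m + M * e - ln z)).
Proof.
move=> /mean_near_of_ball xm; rewrite tilt_weight ler_expR ler_pM2l// lerD2r.
rewrite -lerBlDl -linearB (le_trans (ler_norm _))// (le_trans (lsM _))//.
exact: ler_wpM2l.
Qed.

Lemma tilted_ball_le : q <= expR (N * (ls m + M * e - ln z)) * pA.
Proof.
have mA := measurable_near_mean.
have mb : measurable ball.
  exact: measurable_sum_ball measurable_centered centered_square_integrable _ _.
have Hd := power_density n.+1 tilt.
have ib := intR_indic Pstar mb.
rewrite /q -(Rint_indic Pstar mb) (density_Rint Hd ib) -[pA](Rint_indic P mA).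
rewrite -RintZ; last exact: intR_indic.
apply: Rint_le.
- by apply/(density_intRP Hd); [exact: measurable_indic|].
- by apply: intRZ; exact: intR_indic.
move=> x; rewrite !indicE; case: (boolP (x \in ball)) => [|_].
  rewrite inE => xb; rewrite mul1r mem_set ?mulr1; last exact: ball_sub_near_mean.
  exact: tilt_weight_le.
by rewrite mul0r mulr_ge0 ?expR_ge0.
Qed.

Hypothesis q0 : 0 < q.

Lemma near_mean_pos : 0 < pA.
Proof.
by have := lt_le_trans q0 tilted_ball_le; rewrite pmulr_rgt0 ?expR_gt0.
Qed.

(** The weight of the tilt is at least [exp (N (ls m - M e - ln z))] on [A], and
    at most [exp (N (ls m + M e - ln z))] on the ball contained in [A]: this
    bounds the numerator of the conditional law from above, and the probability
    of [A] from below. *)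
Lemma conditional_density_le (f : n.+1.-tuple T -> R) (c : R) :
  measurable_fun setT f -> (forall x, 0 <= f x <= c) ->
  \int[P]_x (f x * \1_A x) <=
  expR (2 * N * M * e - ln q) * pA * \int[Pstar]_x f x.
Proof.
move=> mf fc; have f0 x : 0 <= f x by have /andP[] := fc x.
have mA := measurable_near_mean.
have Hd := power_density n.+1 tilt.
pose c0 := N * (ls m - M * e - ln z).
have fi : intR Pstar f.
  apply: (@intR_bounded _ _ _ _ _ c) => // x; rewrite ger0_norm//.
  by have /andP[] := fc x.
have ifw : intR P (fun x => f x * w x) by exact/(density_intRP Hd mf).
apply: (@le_trans _ _ (expR (- c0) * \int[Pstar]_x f x)).
  rewrite (density_Rint Hd fi) -RintZ//; apply: Rint_le.
  - apply: (@intR_bounded _ _ _ _ _ c).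
      by apply: measurable_funM => //; exact: measurable_indic.
    move=> x; rewrite ger0_norm ?mulr_ge0//.
    have /andP[_] := fc x; apply: le_trans.
    by rewrite ler_piMr// indicE; case: (_ \in _).
  - exact: intRZ.
  move=> x; rewrite mulrCA ler_wpM2l// indicE; case: (boolP (x \in A)) => [|_].
    rewrite inE => /tilt_weight_ge xw.
    by rewrite expRN ler_pdivlMl ?expR_gt0// mulr1.
  by rewrite mulr_ge0 ?expR_ge0// -/(w x) tilt_weight expR_ge0.
rewrite ler_wpM2r ?Rint_ge0// expRB lnK ?posrE//.
rewrite mulrAC ler_pdivlMr//.
apply: (le_trans (ler_wpM2l (expR_ge0 _) tilted_ball_le)).
rewrite mulrA -expRD ler_wpM2r ?fine_ge0// ler_expR /c0.
by rewrite le_eqVlt; apply/orP; left; apply/eqP; ring.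
Qed.

Lemma conditional_law_le k (D : set (k.-tuple T)) b (s : R) :
  measurable D -> (0 < b)%N -> (b * k <= n.+1)%N -> (k <= n.+1)%N -> 0 < s <= 1 ->
  conditional_law alpha (mean_in F (fattening K e)) n k D - fine (power astar k D)
  <= (2 * N * M * e - ln q) / (s * b%:R) + s * expR 1.
Proof.
move=> mD b0 bk kn s01; rewrite /conditional_law first_inE//.
have symA (p : {perm 'I_n.+1}) x : A (tuple_perm p x) <-> A x.
  exact: empirical_in_mean_perm.
have mA := measurable_near_mean; have pA0 := near_mean_pos.
have dens := conditional_density_le.
have H := conditioned_block_le mA symA pA0 dens.
exact: (H k D mD b s b0 bk s01).
Qed.

(** The upper bound, applied to an event and to its complement. *)
Lemma conditional_law_dist_le k (D : set (k.-tuple T)) b (s : R) :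
  measurable D -> (0 < b)%N -> (b * k <= n.+1)%N -> (k <= n.+1)%N -> 0 < s <= 1 ->
  `|conditional_law alpha (mean_in F (fattening K e)) n k D -
    fine (power astar k D)|
  <= (2 * N * M * e - ln q) / (s * b%:R) + s * expR 1.
Proof.
move=> mD b0 bk kn s01.
have h1 := conditional_law_le mD b0 bk kn s01.
have h2 := conditional_law_le (measurableC mD) b0 bk kn s01.
have fin (nu : probability (k.-tuple T) R) : fine (nu (~` D)) = 1 - fine (nu D).
  rewrite probability_setC//.
  by rewrite -[in LHS](fineK (fin_num_measure nu D mD)) -EFinB.
have mA := measurable_near_mean.
have mBD : measurable (@block _ T k n.+1 0 @^-1` D).
  by rewrite -[X in measurable X]setTI; exact: measurable_block.
have C1 : conditional_law alpha (mean_in F (fattening K e)) n k (~` D) =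
    1 - conditional_law alpha (mean_in F (fattening K e)) n k D.
  rewrite /conditional_law !first_inE//.
  have XE : fine (P ([set x | (~` D) (block 0 x)] `&` A)) =
      pA - fine (P ((block 0 @^-1` D) `&` A)).
    have -> : [set x : n.+1.-tuple T | (~` D) (block 0 x)] `&` A =
        A `\` (block 0 @^-1` D) by rewrite setDE setIC.
    rewrite measureD//; last first.
      by apply: le_lt_trans (probability_le1 _ mA) _; rewrite ltry.
    rewrite setIC fineB ?fin_num_measure//; exact: measurableI.
  have pA0 := near_mean_pos.
  have : (pA - fine (P ((block 0 @^-1` D) `&` A))) / pA =
      1 - fine (P ((block 0 @^-1` D) `&` A)) / pA.
    by rewrite mulrBl divff// gt_eqF.
  by rewrite -XE.
rewrite C1 fin in h2.
exact: dist_le_of_complement h1 h2.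
Qed.

End ConditionalDensity.

(** * Convergence of the conditional laws *)

Lemma tv_dist_bound (R : realType) d (T : measurableType d) (p q : set T -> R)
    (t : R) :
  (forall D, measurable D -> `|p D - q D| <= t) -> 0 <= tv_dist p q <= t.
Proof.
move=> h; rewrite /tv_dist.
have ne : [set `|p D - q D| | D in [set D : set T | measurable D]] !=set0.
  by exists `|p set0 - q set0|; exists set0 => //=.
have ub : ubound [set `|p D - q D| | D in [set D : set T | measurable D]] t.
  by move=> _ [D mD <-]; exact: h.
apply/andP; split; last exact: ge_sup.
apply: (le_trans (normr_ge0 (p set0 - q set0))).
by apply: ub_le_sup; [exists t|exists set0 => //=].
Qed.

Lemma leq_double_divn k N : (0 < k)%N -> (k <= N)%N -> (N <= 2 * (N %/ k * k))%N.
Proof.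
move=> k0 kN; have := ltn_ceil N k0; rewrite mulSn.
have : (k <= N %/ k * k)%N by rewrite leq_pmull// divn_gt0.
lia.
Qed.

(** The error tends to zero with [e] and [1 / sqrt N] for fixed [s]: the number
    of blocks is proportional to the sample size. *)
Lemma block_error_le (R : realType) (k N b : nat) (s M e C l : R) :
  (0 < b)%N -> (N <= 2 * (b * k))%N -> (0 < N)%N -> 0 < s -> 0 <= M -> 0 <= e ->
  0 <= C -> - (C * Num.sqrt N%:R) <= l ->
  (2 * N%:R * M * e - l) / (s * b%:R) <=
  2 * k%:R / s * (2 * M * e + C / Num.sqrt N%:R).
Proof.
move=> b0 Nb N0 s0 M0 e0 C0 lC.
have b0' : 0 < b%:R :> R by rewrite ltr0n.
have N0' : 0 < N%:R :> R by rewrite ltr0n.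
have sN : 0 < Num.sqrt N%:R :> R by rewrite sqrtr_gt0.
have sq2 : Num.sqrt N%:R ^+ 2 = N%:R :> R by rewrite sqr_sqrtr// ltW.
have Nb' : N%:R <= 2 * (b%:R * k%:R) :> R by rewrite -!natrM ler_nat.
set u := 2 * M * e + C / Num.sqrt N%:R.
have u0 : 0 <= u by rewrite addr_ge0 ?mulr_ge0 ?invr_ge0// ltW.
have NC : N%:R * (C / Num.sqrt N%:R) = C * Num.sqrt N%:R.
  by rewrite -{1}sq2; field; rewrite gt_eqF.
rewrite ler_pdivrMr ?mulr_gt0//.
have -> : 2 * k%:R / s * u * (s * b%:R) = 2 * (b%:R * k%:R) * u.
  by field; rewrite gt_eqF.
apply: le_trans (ler_wpM2r u0 Nb').
rewrite /u mulrDr NC; lra.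
Qed.

Section Convergence.
Context {R : realType} {B : completeNormedModType R} (sepB : separable B)
  {d : measure_display} {T : measurableType d}.
Variables (alpha astar : probability T R) (F : T -> B) (K : set B) (a : R).
Variables (ls : {linear B -> R^o}) (z : R).
Hypothesis type2B : type2 B a.
Hypothesis mF : measurable_fun setT (F : T -> cylindrical B).
Hypothesis dls : dual ls.
Hypothesis z0 : 0 < z.
Hypothesis tilt : is_density alpha astar (fun x => expR (ls (F x)) / z).
Hypothesis iF2 : intR astar (fun x => `|F x| ^+ 2).
Let m := bochner_integral astar F.
Hypothesis Km : K m.
Hypothesis Kls : forall y, K y -> ls m <= ls y.
Let V := fine (bochner_variance astar F).

Lemma radius_gt (n : nat) (e : R) :
  Num.sqrt (a * V) / Num.sqrt n.+1%:R < e ->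
  0 < e /\ a * n.+1%:R * V < (n.+1%:R * e) ^+ 2.
Proof.
move=> He; have N0 : 0 < n.+1%:R :> R by rewrite ltr0n.
have a0 : 0 < a by have [] := type2B.
have V0 : 0 <= V by apply: Rint_ge0 => x; rewrite exprn_ge0.
have sN : 0 < Num.sqrt n.+1%:R :> R by rewrite sqrtr_gt0.
have e0 : 0 < e by apply: le_lt_trans He; rewrite divr_ge0.
split=> //; rewrite mulrAC [ltLHS]mulrC exprMn expr2 -mulrA ltr_pM2l//.
rewrite ltr_pdivrMr// in He.
rewrite -(sqr_sqrtr (mulr_ge0 (ltW a0) V0)).
rewrite -[X in _ < X * _](sqr_sqrtr (ltW N0)) -exprMn mulrC.
rewrite ltr_pXn2r// ?nnegrE ?sqrtr_ge0 ?mulr_ge0// ?ltW//.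
by rewrite [V * a]mulrC [_ * e]mulrC.
Qed.

Lemma near_mean_gt0 n (e : R) : Num.sqrt (a * V) / Num.sqrt n.+1%:R < e ->
  (0 < power alpha n.+1 (empirical_in n (mean_in F (fattening K e))))%E.
Proof.
move=> /radius_gt[e0 re].
have [M M0 lM] := dual_bounded dls.
have mG := measurable_centered astar mF.
have iG2 := centered_square_integrable sepB mF iF2.
have G0 := centered_mean sepB mF iF2.
have q0 := small_ball_pos sepB type2B mG iG2 G0 re.
have pA0 := near_mean_pos sepB mF z0 tilt iF2 Km e0 (lexx _) (ltW M0) lM q0.
rewrite lt0e measure_ge0 andbT; apply/eqP => p0.
by rewrite p0 ltxx in pA0.
Qed.

Lemma conditional_law_cvg (eps : nat -> R) (k : nat) : (0 < k)%N ->
  eps @ \oo --> 0 ->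
  (forall n, (0 < n)%N -> Num.sqrt (a * V) / Num.sqrt n%:R < eps n) ->
  (fun n => tv_dist
    (conditional_law alpha (mean_in F (fattening K (eps n.+1))) n k)
    (fun D => fine (power astar k D))) @ \oo --> 0.
Proof.
move=> k0 eps0 epsV; apply/cvgrPdist_le => delta delta0.
have [M M0 lM] := dual_bounded dls.
have mG := measurable_centered astar mF.
have iG2 := centered_square_integrable sepB mF iF2.
have G0 := centered_mean sepB mF iF2.
have [C C0 [N1 _ HC]] := small_ball sepB type2B mG iG2 G0.
have e1 : 0 < expR 1 :> R by exact: expR_gt0.
(* [s] takes care of the second term of the error, uniformly in [n] *)
pose s := Num.min 1 (delta / (2 * expR 1)).
have s0 : 0 < s by rewrite lt_min ltr01 divr_gt0// mulr_gt0.
have s01 : 0 < s <= 1 by rewrite s0 ge_min lexx.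
have se : s * expR 1 <= delta / 2.
  apply: (@le_trans _ _ (delta / (2 * expR 1) * expR 1)).
    by rewrite ler_wpM2r ?(ltW e1)// ge_min lexx orbT.
  by rewrite le_eqVlt; apply/orP; left; apply/eqP; field; rewrite gt_eqF.
have k0' : 0 < k%:R :> R by rewrite ltr0n.
pose y := 2 * k%:R / s.
have y0 : 0 < y by rewrite divr_gt0// mulr_gt0.
(* the factor [y] multiplies two terms, which add up to [delta / 2] *)
pose u := delta / (4 * y).
have u0 : 0 < u by rewrite divr_gt0// mulr_gt0.
have Mu : 0 < u / (2 * M + 1) by rewrite divr_gt0// ltr_wpDl// mulr_ge0// ltW.
move/cvgrPdist_le : eps0 => /(_ _ Mu) [N2 _ Heps].
near=> n; rewrite sub0r normrN.
have nN1 : (N1 <= n.+1)%N by apply: leqW; near: n; exact: nbhs_infty_ge.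
have nN2 : (N2 <= n.+1)%N by apply: leqW; near: n; exact: nbhs_infty_ge.
have kn : (k <= n.+1)%N by apply: leqW; near: n; exact: nbhs_infty_ge.
have nC : (C / u) ^+ 2 <= n.+1%:R.
  apply: (@le_trans _ _ n%:R); last by rewrite ler_nat.
  by near: n; exact: nbhs_infty_ger.
set e := eps n.+1.
have [e0 re] := radius_gt (epsV n.+1 isT).
have qC := HC n.+1 nN1.
have q0 := lt_le_trans (expR_gt0 _) qC.
pose b := (n.+1 %/ k)%N.
have b0 : (0 < b)%N by rewrite divn_gt0.
have bk : (b * k <= n.+1)%N by exact: leq_divM.
have Nb : (n.+1 <= 2 * (b * k))%N by exact: leq_double_divn.
set q := fine _ in qC q0.
have lq : - (C * Num.sqrt n.+1%:R) <= ln q.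
  by rewrite -[leLHS]expRK ler_ln ?posrE ?expR_gt0.
have /andP[t0 t1] : 0 <= tv_dist
    (conditional_law alpha (mean_in F (fattening K e)) n k)
    (fun D => fine (power astar k D)) <=
    (2 * n.+1%:R * M * e - ln q) / (s * b%:R) + s * expR 1.
  apply: tv_dist_bound => D mD.
  exact: (conditional_law_dist_le sepB mF z0 tilt iF2 Km Kls e0 (ltW re)
    (ltW M0) lM q0 mD b0 bk kn s01).
rewrite ger0_norm//; apply: (le_trans t1).
have h1 := block_error_le b0 Nb (ltn0Sn n) s0 (ltW M0) (ltW e0) C0 lq.
have h2 : 2 * M * e + C / Num.sqrt n.+1%:R <= u + u.
  apply: lerD.
    have := Heps n.+1 nN2; rewrite sub0r normrN (gtr0_norm e0).
    rewrite ler_pdivlMr ?ltr_wpDl ?mulr_ge0 ?(ltW M0)// => h.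
    apply: le_trans h; rewrite mulrC ler_wpM2l ?(ltW e0)//.
    by rewrite lerDl.
  have sN : 0 < Num.sqrt n.+1%:R :> R by rewrite sqrtr_gt0.
  have Cu0 : 0 <= C / u by rewrite divr_ge0// ltW.
  have Cu : C / u <= Num.sqrt n.+1%:R.
    by rewrite -[leLHS]ger0_norm// -sqrtr_sqr ler_wsqrtr.
  by rewrite ler_pdivrMr// mulrC -ler_pdivrMr.
have h3 : y * (u + u) = delta / 2 by rewrite /u; field; rewrite gt_eqF.
have := ler_wpM2l (ltW y0) h2; rewrite h3 => h4.
rewrite [leRHS](splitr delta); apply: lerD se.
exact: le_trans h1 h4.
Unshelve. all: end_near. Qed.

End Convergence.

Theorem theorem3p4 (R : realType) (E : ptopologicalType)
    (alpha : probability (borel E) R) (B : completeNormedModType R)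
    (F : borel E -> B) (K : set B) (a : R)
    (polishE : polish R E)
    (sepB : separable B)
    (mF : measurable_fun setT (F : borel E -> cylindrical B))
    (K0 : K !=set0) (closedK : closed K) (convexK : convex_set K)
    (exp_moment : exists2 s : R, 0 < s &
       (\int[alpha]_x (expR (s * `|F x|))%:E < +oo)%E)
    (dom0 : dom_Lambda alpha F !=set0)
    (dom_open : dual_open (dom_Lambda alpha F))
    (type2B : type2 B a)
    (HK : hypothesis_HK alpha F K) :
  exists2 astar : probability (borel E) R,
    is_I_projection alpha (mean_in F K) astar &
    forall eps : nat -> R,
      eps @ \oo --> 0 ->
      (forall n, (0 < n)%N ->
         Num.sqrt (a * fine (bochner_variance astar F)) / Num.sqrt n%:R
           < eps n) ->
      let C n := mean_in F (fattening K (eps n)) in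
      (forall n, (0 < power alpha n.+1 (empirical_in n (C n.+1)))%E) /\
      forall k, (0 < k)%N ->
        (fun n => tv_dist (conditional_law alpha (C n.+1) n k)
                          (fun D => fine (power astar k D))) @ \oo --> 0.
Proof.
have [ls [z [astar [dls z0 tilt iF2 [Km Kls]]]]] :=
  exponential_projection sepB mF exp_moment dom_open K0 closedK convexK HK.
exists astar; first exact: (tilt_is_I_projection sepB mF dls z0 tilt iF2 Km Kls).
move=> eps eps0 epsV C; split=> [n|k k0].
  exact: (near_mean_gt0 sepB type2B mF dls z0 tilt iF2 Km (epsV _ _)).
exact: (conditional_law_cvg sepB type2B mF dls z0 tilt iF2 Km Kls).
Qed.
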